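(* Let $(M,g)$ be a smooth orientable Riemannian manifold of dimension $n$ with a metric connection $D$, and let $SM$ be its unit tangent sphere bundle with the metric $g=\langle\,,\rangle$ induced by $g$ and $D$. The Levi-Civita connection $\nabla^g$ of $SM$ is given by $$\nabla^g_XY=D^\star_XY-\tfrac12\mathcal R(X,Y)+A(X,Y)+\tau(X,Y),$$ where $A,\tau$ are the $\mathcal H^D$-valued tensors defined by $$\langle A(X,Y),Z\rangle=\tfrac12\langle\mathcal R(X,Z),Y\rangle+\tfrac12\langle\mathcal R(Y,Z),X\rangle$$ and $$\langle\tau(X,Y),Z^h\rangle=\tfrac12\bigl(T^*(Y,X,Z)+T^*(X,Z,Y)+T^*(Y,Z,X)\bigr),$$ for any vector fields $X,Y,Z$ on $SM$, where $T^*(X,Y,Z)=\langle T^*(X,Y),Z\rangle$.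
   Context: $D$ is a linear connection on $TM$ with $Dg=0$, torsion $T^D(X,Y)=D_XY-D_YX-[X,Y]$ and curvature $R^D(X,Y)=D_XD_Y-D_YD_X-D_{[X,Y]}$. $SM=\{u\in TM:\|u\|=1\}$ with projection $f:SM\to M$; $U$ is the section of $f^*TM$ over $SM$ with $U_u=u$. $T\,SM=\mathcal V\oplus\mathcal H^D$, where $\mathcal V=\ker df$ and $\mathcal H^D=\{X\in T\,SM:(f^*D)_XU=0\}$; $\mathcal H^D$ is identified with $f^*TM$ via $df$, and $\mathcal V_u$ with $u^\perp\subset T_{f(u)}M$ via $Y\mapsto(f^*D)_YU$. $X^h,X^v$ denote the horizontal and vertical projections. $SM$ carries the unique metric for which $\mathcal H^D\perp\mathcal V$ and these identifications are isometric. $D^\star$ is the metric connection on $T\,SM$ preserving the splitting, given under the identifications by $D^\star_YX^h=(f^*D)_YX^h$ and $D^\star_YX^v=(f^*D)_YX^v+\langle X^v,Y^v\rangle U$ (i.e. $f^*D$ followed by projection to $U^\perp$ on $\mathcal V$). $\mathcal R$ is the $\mathcal V$-valued 2-form $\mathcal R_u(X,Y)=R^D(f_*X,f_*Y)u\in u^\perp\simeq\mathcal V_u$. $T^*$ is the $\mathcal H^D$-valued 2-form $T^*(X,Y)=$ the element of $\mathcal H^D_u\simeq T_{f(u)}M$ corresponding to $T^D(f_*X,f_*Y)$. Both vanish when one argument is vertical. *)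

(* Defs.v *)
From HB Require Import structures.
From mathcomp Require Import all_boot all_order all_algebra.
From mathcomp Require Import all_classical all_reals all_analysis.

Set Implicit Arguments.
Unset Strict Implicit.
Unset Printing Implicit Defensive.

Import Order.TTheory GRing.Theory Num.Theory.
Import numFieldNormedType.Exports.

Local Open Scope classical_set_scope.
Local Open Scope ring_scope.

Fixpoint Ck_on (R : realType) (n k : nat) (O : set 'rV[R]_n)
    (h : 'rV[R]_n -> R) : Prop :=
  (forall x, O x -> {for x, continuous h}) /\
  if k is k'.+1 then
    forall i : 'I_n,
      (forall x, O x -> derivable h x (delta_mx 0 i)) /\
      Ck_on k' O (fun x => 'D_(delta_mx 0 i) h x)
  else True.

Definition smooth_on (R : realType) (n : nat) (O : set 'rV[R]_n)
    (h : 'rV[R]_n -> R) : Prop :=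
  forall k, Ck_on k O h.

(* The values of [chart_map] off [chart_dom], and of [chart_inv] off the open
   set [chart_img], are irrelevant. *)
Record chart (R : realType) (n : nat) (M : topologicalType) := Chart {
  chart_dom : set M;
  chart_map : M -> 'rV[R]_n;
  chart_inv : 'rV[R]_n -> M;
  chart_dom_open : open chart_dom;
  chart_img_open : open (chart_map @` chart_dom);
  chart_map_cont : forall p, chart_dom p -> {for p, continuous chart_map};
  chart_inv_cont : forall x, (chart_map @` chart_dom) x ->
    {for x, continuous chart_inv};
  chart_mapK : forall p, chart_dom p -> chart_inv (chart_map p) = p }.

Definition chart_img (R : realType) (n : nat) (M : topologicalType)
    (c : chart R n M) : set 'rV[R]_n :=
  chart_map c @` chart_dom c.

Definition smooth_transition (R : realType) (n : nat) (M : topologicalType)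
    (c c' : chart R n M) : Prop :=
  forall j : 'I_n,
    smooth_on (chart_map c @` (chart_dom c `&` chart_dom c'))
              (fun x => chart_map c' (chart_inv c x) 0 j).

Record manifold (R : realType) (n : nat) := Manifold {
  manifold_top : topologicalType;
  manifold_hausdorff : hausdorff_space manifold_top;
  manifold_second_countable : @second_countable manifold_top;
  atlas : set (chart R n manifold_top);
  atlas_cover : forall p, exists2 c, atlas c & chart_dom c p;
  atlas_smooth : forall c c', atlas c -> atlas c' -> smooth_transition c c' }.

(* [B] is an oriented atlas made of charts of the maximal smooth atlas. *)
Definition orientable (R : realType) (n : nat) (M : manifold R n) : Prop :=
  exists B : set (chart R n (manifold_top M)),
    [/\ forall p, exists2 c, B c & chart_dom c p,
        forall c c', B c -> atlas c' ->
          smooth_transition c c' /\ smooth_transition c' c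
      & forall c c' p, B c -> B c' -> chart_dom c p -> chart_dom c' p ->
          0 < \det (jacobian (chart_map c' \o chart_inv c) (chart_map c p))].

(* The manifold M and the sphere bundle SM are both seen through their algebras
   of smooth functions, so that tangent vectors, vector fields and connections
   are defined once. *)
Record smooth_space (R : realType) := SmoothSpace {
  point_of :> Type;
  smooth : set (point_of -> R) }.

Definition manifold_space (R : realType) (n : nat) (M : manifold R n) :
    smooth_space R :=
  @SmoothSpace R (manifold_top M)
    [set h : manifold_top M -> R |
      forall c, atlas c -> smooth_on (chart_img c) (h \o chart_inv c)].

Coercion manifold_space : manifold >-> smooth_space.


(* The ambient real vector space of all tangent spaces of N. *)
Definition vec (R : realType) (N : smooth_space R) : Type := (N -> R) -> R.

(* Tangent vectors at [p] are the derivations at [p] of the algebra of smooth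
   functions.  They are extended by 0 to non-smooth functions, so that [=]
   between tangent vectors is equality of derivations. *)
Definition tangent (R : realType) (N : smooth_space R) (p : N)
    (v : vec N) : Prop :=
  [/\ forall (a : R) h k, smooth h -> smooth k ->
        v (fun x => a * h x + k x) = a * v h + v k,
      forall h k, smooth h -> smooth k ->
        v (fun x => h x * k x) = v h * k p + h p * v k
    & forall h, ~ smooth h -> v h = 0].

Definition differential (R : realType) (N M : smooth_space R) (phi : N -> M)
    (v : vec N) : vec M :=
  fun h => if `[< smooth h >] then v (h \o phi) else 0.

(* Smooth sections of the pull-back bundle phi^*TM over N. *)
Definition section_along (R : realType) (N M : smooth_space R) (phi : N -> M)
    (s : N -> vec M) : Prop :=
  (forall u, tangent (phi u) (s u)) /\
  (forall h, smooth h -> smooth (fun u => s u h)).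

Definition vector_field (R : realType) (N : smooth_space R)
    (X : N -> vec N) : Prop :=
  section_along (fun p : N => p) X.

Definition bracket (R : realType) (N : smooth_space R)
    (X Y : N -> vec N) : N -> vec N :=
  fun p h => X p (fun q => Y q h) - Y p (fun q => X q h).

(* [nabla u v s] is the covariant derivative at [u] of the section [s] of
   phi^*TM in the direction of [v] in T_uN. *)
Record connection_along (R : realType) (N M : smooth_space R) (phi : N -> M)
    (nabla : N -> vec N -> (N -> vec M) -> vec M) :
    Prop := ConnectionAlong {
  connection_smooth : forall X s, vector_field X -> section_along phi s ->
    section_along phi (fun u => nabla u (X u) s);
  connection_linear : forall u (a : R) v w s, tangent u v -> tangent u w ->
    section_along phi s ->
    nabla u (a *: v + w) s = a *: nabla u v s + nabla u w s;
  connection_additive : forall u v s t, tangent u v ->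
    section_along phi s -> section_along phi t ->
    nabla u v (fun x => s x + t x) = nabla u v s + nabla u v t;
  connection_leibniz : forall u v h s, tangent u v -> smooth h ->
    section_along phi s ->
    nabla u v (fun x => h x *: s x) = v h *: s u + h u *: nabla u v s }.

Definition linear_connection (R : realType) (N : smooth_space R)
    (D : N -> vec N -> (N -> vec N) -> vec N) :
    Prop :=
  connection_along (fun p : N => p) D.

Record riemannian_metric (R : realType) (N : smooth_space R)
    (g : N -> vec N -> vec N -> R) : Prop :=
    RiemannianMetric {
  metric_linear : forall p (a : R) v v' w,
    tangent p v -> tangent p v' -> tangent p w ->
    g p (a *: v + v') w = a * g p v w + g p v' w;
  metric_sym : forall p v w, tangent p v -> tangent p w -> g p v w = g p w v;
  metric_pos : forall p v, tangent p v -> v <> 0 -> 0 < g p v v;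
  metric_smooth : forall X Y, vector_field X -> vector_field Y ->
    smooth (fun p => g p (X p) (Y p)) }.

Definition metric_connection (R : realType) (N : smooth_space R)
    (g : N -> vec N -> vec N -> R)
    (D : N -> vec N -> (N -> vec N) -> vec N) :
    Prop :=
  linear_connection D /\
  forall X Y Z, vector_field X -> vector_field Y -> vector_field Z ->
  forall p, X p (fun q => g q (Y q) (Z q)) =
    g p (D p (X p) Y) (Z p) + g p (Y p) (D p (X p) Z).

Definition torsion (R : realType) (N : smooth_space R)
    (D : N -> vec N -> (N -> vec N) -> vec N)
    (X Y : N -> vec N) : N -> vec N :=
  fun p => D p (X p) Y - D p (Y p) X - bracket X Y p.

Definition curvature (R : realType) (N : smooth_space R)
    (D : N -> vec N -> (N -> vec N) -> vec N)
    (X Y Z : N -> vec N) : N -> vec N :=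
  fun p => D p (X p) (fun q => D q (Y q) Z) - D p (Y p) (fun q => D q (X q) Z)
           - D p (bracket X Y p) Z.

Definition levi_civita (R : realType) (N : smooth_space R)
    (g : N -> vec N -> vec N -> R)
    (nabla : N -> vec N -> (N -> vec N) -> vec N) :
    Prop :=
  metric_connection g nabla /\
  forall X Y, vector_field X -> vector_field Y ->
  forall p, torsion nabla X Y p = 0.

(* Torsion and curvature are tensors: their values on tangent vectors at [p]
   are computed with any vector fields extending these vectors. *)
Definition extension (R : realType) (N : smooth_space R) (p : N)
    (v : vec N) : N -> vec N :=
  xget (fun=> 0) [set X | vector_field X /\ X p = v].

Definition torsion_at (R : realType) (N : smooth_space R)
    (D : N -> vec N -> (N -> vec N) -> vec N)
    (p : N) (v w : vec N) : vec N :=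
  torsion D (extension p v) (extension p w) p.

Definition curvature_at (R : realType) (N : smooth_space R)
    (D : N -> vec N -> (N -> vec N) -> vec N)
    (p : N) (v w z : vec N) : vec N :=
  curvature D (extension p v) (extension p w) (extension p z) p.

(* The vector \sum_i a_i d/dx_i at the point of coordinates [x]. *)
Definition chart_vector (R : realType) (n : nat) (M : manifold R n)
    (c : chart R n (manifold_top M)) (x a : 'rV[R]_n) : vec M :=
  fun h => if `[< @smooth R M h >] then 'D_a (h \o chart_inv c) x else 0.

Section SphereBundle.
Context {R : realType} {n : nat} {M : manifold R n}.
Variable g : M -> vec M -> vec M -> R.

Definition sphere_point : Type :=
  {pv : M * vec M | tangent pv.1 pv.2 /\ g pv.1 pv.2 pv.2 = 1}.

(* SM is an embedded submanifold of TM, whose charts are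
   (p, \sum_i a_i d/dx_i) |-> (x, a): a function on SM is smooth iff in these
   charts it locally extends to a smooth function on an open set of
   R^n x R^n. *)
Definition sphere_smooth (F : sphere_point -> R) : Prop :=
  forall (c : chart R n (manifold_top M)) (x0 a0 : 'rV[R]_n)
    (u0 : sphere_point),
    atlas c -> chart_img c x0 ->
    sval u0 = (chart_inv c x0, chart_vector c x0 a0) ->
  exists (W : set 'rV[R]_(n + n)) (Phi : 'rV[R]_(n + n) -> R),
    [/\ open W, W (row_mx x0 a0), smooth_on W Phi
      & forall (x a : 'rV[R]_n) (u : sphere_point),
          chart_img c x -> W (row_mx x a) ->
          sval u = (chart_inv c x, chart_vector c x a) ->
          F u = Phi (row_mx x a)].

Definition SM : smooth_space R := @SmoothSpace R sphere_point sphere_smooth.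

Definition proj (u : SM) : M := (sval u).1.
Definition tautological (u : SM) : vec M := (sval u).2.

Definition pullback_connection
    (D : M -> vec M -> (M -> vec M) -> vec M)
    (fD : SM -> vec SM -> (SM -> vec M) -> vec M) :
    Prop :=
  connection_along proj fD /\
  forall X, vector_field X -> forall u v, tangent u v ->
    fD u v (X \o proj) = D (proj u) (differential proj v) X.

Variable D : M -> vec M -> (M -> vec M) -> vec M.
Variable fD :
  SM -> vec SM -> (SM -> vec M) -> vec M.
Variable G : SM -> vec SM -> vec SM -> R.

(* v |-> (f^*D)_v U, which identifies V_u with the orthogonal of u *)
Definition connector (u : SM) (v : vec SM) : vec M :=
  fD u v tautological.

Definition vertical (u : SM) (v : vec SM) : Prop :=
  tangent u v /\ differential proj v = 0.

Definition horizontal (u : SM) (v : vec SM) : Prop :=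
  tangent u v /\ connector u v = 0.

(* The inverses of the identifications of H_u with T_{f(u)}M and of V_u with
   the orthogonal of u. *)
Definition hlift (u : SM) (w : vec M) : vec SM :=
  xget 0 [set v | horizontal u v /\ differential proj v = w].

Definition vlift (u : SM) (w : vec M) : vec SM :=
  xget 0 [set v | vertical u v /\ connector u v = w].

Definition hproj (u : SM) (v : vec SM) : vec SM :=
  hlift u (differential proj v).

Definition induced_metric : Prop :=
  [/\ riemannian_metric G,
      forall u v w, horizontal u v -> vertical u w -> G u v w = 0,
      forall u v w, horizontal u v -> horizontal u w ->
        G u v w = g (proj u) (differential proj v) (differential proj w)
    & forall u v w, vertical u v -> vertical u w ->
        G u v w = g (proj u) (connector u v) (connector u w)].

(* D^star_X Y.  Under the identifications the components Y^h and Y^v of Y are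
   [differential proj \o Y] and (f^*D)_Y U. *)
Definition Dstar (X Y : SM -> vec SM) : SM -> vec SM :=
  fun u =>
    hlift u (fD u (X u) (fun u' => differential proj (Y u'))) +
    vlift u (fD u (X u) (fun u' => connector u' (Y u')) +
             g (proj u) (connector u (Y u)) (connector u (X u)) *:
               tautological u).

Definition calR (u : SM) (v w : vec SM) : vec SM :=
  vlift u (curvature_at D (proj u) (differential proj v) (differential proj w)
             (tautological u)).

Definition Tstar (u : SM) (v w : vec SM) : vec SM :=
  hlift u (torsion_at D (proj u) (differential proj v) (differential proj w)).

Definition is_A
    (A : SM -> vec SM -> vec SM -> vec SM) :
    Prop :=
  forall u v w, tangent u v -> tangent u w ->
    horizontal u (A u v w) /\
    forall z, tangent u z ->
      G u (A u v w) z =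
        2^-1 * G u (calR u v z) w + 2^-1 * G u (calR u w z) v.

Definition is_tau
    (tau : SM -> vec SM -> vec SM -> vec SM) :
    Prop :=
  forall u v w, tangent u v -> tangent u w ->
    horizontal u (tau u v w) /\
    forall z, tangent u z ->
      G u (tau u v w) (hproj u z) =
        2^-1 * (G u (Tstar u w v) z + G u (Tstar u v z) w
                + G u (Tstar u w z) v).

End SphereBundle.

(* Main.v *)
(** Over the algebra of smooth functions everything reduces to the Koszul
    formula.  For fields [X], [Y], [Z] on [SM] the metric [G] splits as
    [<df Y, df Z> + <(f^*D)_Y U, (f^*D)_Z U>], the pull-back connection is metric,
    and the two structure equations
      [df [X, Y] = (f^*D)_X (df Y) - (f^*D)_Y (df X) - T^D(df X, df Y)],
      [(f^*D)_[X, Y] U = (f^*D)_X (f^*D)_Y U - (f^*D)_Y (f^*D)_X U - R^D(df X, df Y) U]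
    express the bracket.  Inserted into the Koszul formula they give
    [2 G(nabla_X Y, Z)], which is the value of the right-hand side term by term.

    What has to be established first is that derivations behave as tangent vectors:
    by Hadamard's lemma a derivation obeys the chain rule, so that on a manifold
    it is a combination of coordinate fields and on [SM] it is determined by its
    values on the functions [h o f] and [u |-> u(h)]; and there are enough
    vectors on [SM], since [F] can be differentiated along
    [(x, a) |-> (x, a / |a|)]. *)

Require Import Defs.
From HB Require Import structures.
From mathcomp Require Import all_boot all_order all_algebra.
From mathcomp Require Import ring lra.
From mathcomp Require Import all_classical all_reals all_analysis.
Import Order.TTheory GRing.Theory Num.Theory.
Import numFieldNormedType.Exports.
Set Implicit Arguments.
Unset Strict Implicit.
Unset Printing Implicit Defensive.
Local Open Scope classical_set_scope.
Local Open Scope ring_scope.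

(** * Chain rule from continuous partial derivatives *)

(** Derivations and connections act on global functions and global sections only. A local statement
    is therefore turned into an identity valid everywhere, by multiplying with a cutoff that is 1
    near the point; this is what [dual_basis] packages. [SM g] carries no topology here, so on it
    the cutoffs come from M through f and from bump functions of the fibre coordinates.

    The connection [fD] is prescribed only on the sections [X \o proj]. Its torsion, curvature and
    compatibility with the metric are reached by expanding sections in pulled-back fields, where
    necessary after checking that a defect is linear over functions.

    Lifts and extensions are chosen by [xget], so each needs an existence proof; for [vlift] this
    includes orthogonality to U, which is the reason for the correction term in [Dstar]. Vector
    fields on SM through a given vector become available only after tangent vectors with prescribed
    components have been built, so until then tangency of [fD u v s] cannot be read off
    [connection_smooth]. *)

Section Calculus.
Context {R : realType}.

Lemma cvg_bigsum (T I : Type) (F : set_system T) (FF : Filter F) (s : seq I)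
    (f : I -> T -> R) (l : I -> R) :
  (forall k, f k t @[t --> F] --> l k) ->
  \sum_(k <- s) f k t @[t --> F] --> \sum_(k <- s) l k.
Proof.
move=> fl; elim: s => [|k s IH].
  by rewrite big_nil; under eq_fun do rewrite big_nil; exact: cvg_cst.
by rewrite big_cons; under eq_fun do rewrite big_cons; exact: cvgD.
Qed.

Lemma is_derive_line (V : normedModType R) (h : V -> R) (x v : V) (t : R) :
  derivable h (t *: v + x) v ->
  is_derive t 1 (fun s : R => h (s *: v + x)) ('D_v h (t *: v + x)).
Proof.
move=> hd.
have E : (fun s : R => s^-1 *: (h ((s *: 1 + t) *: v + x) - h (t *: v + x))) =
    (fun s : R => s^-1 *: (h (s *: v + (t *: v + x)) - h (t *: v + x))).
  by apply/funext => s /=; rewrite [s *: 1]mulr1 scalerDl addrA.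
by apply: DeriveDef; rewrite /derivable /derive /= E.
Qed.

(** The conditions on [t] say that it lies between 0 and [s] for either sign of [s], so that
    difference quotients can use one statement. *)
Lemma MVT_line (V : normedModType R) (h : V -> R) (x v : V) (s : R) :
  (forall t, `|t| <= `|s| -> 0 <= t * s -> derivable h (t *: v + x) v) ->
  exists t, [/\ `|t| <= `|s|, 0 <= t * s &
    h (s *: v + x) - h x = s * 'D_v h (t *: v + x)].
Proof.
move=> hd; pose f t := h (t *: v + x).
have hdf t : `|t| <= `|s| -> 0 <= t * s ->
    is_derive t 1 f ('D_v h (t *: v + x)).
  by move=> ts t0; exact/is_derive_line/hd.
have cf t : `|t| <= `|s| -> 0 <= t * s -> {for t, continuous f}.
  move=> ts t0; have /derivable1_diffP := @ex_derive _ _ _ _ _ _ _ (hdf t ts t0).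
  exact: differentiable_continuous.
have hx : h x = f 0 by rewrite /f scale0r add0r.
case: (leP 0 s) => s0.
  have A t : 0 <= t <= s -> `|t| <= `|s| /\ 0 <= t * s.
    by move=> /andP[t0 ts]; rewrite !ger0_norm// mulr_ge0.
  have [t|t|t ts] := @MVT_segment R f (fun t => 'D_v h (t *: v + x)) 0 s s0.
  - rewrite in_itv/= => /andP[t0 ts].
    have [] := A t _; first by rewrite !ltW.
    by move=> *; exact: hdf.
  - apply: continuous_in_subspaceT => {}t; rewrite inE/= in_itv/= => /A[] *.
    exact: cf.
  - move: ts; rewrite in_itv/= => /A[ts t0] E; exists t; split => //.
    by rewrite hx -/(f s) E subr0 mulrC.
have A t : s <= t <= 0 -> `|t| <= `|s| /\ 0 <= t * s.
  move=> /andP[ts t0]; rewrite !ler0_norm// ?lerN2//; last exact: ltW.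
  by rewrite mulr_le0// ltW.
have [t|t|t ts] := @MVT_segment R f (fun t => 'D_v h (t *: v + x)) s 0 (ltW s0).
- rewrite in_itv/= => /andP[t0 ts].
  have [] := A t _; first by rewrite !ltW.
  by move=> *; exact: hdf.
- apply: continuous_in_subspaceT => {}t; rewrite inE/= in_itv/= => /A[] *.
  exact: cf.
- move: ts; rewrite in_itv/= => /A[ts t0] E; exists t; split => //.
  by rewrite hx -/(f s) -opprB E sub0r mulrN opprK mulrC.
Qed.

Section Coordinates.
Context {m : nat}.
Local Notation e i := (delta_mx 0 i : 'rV[R]_m).

Lemma rV_norm_le (x : 'rV[R]_m) r :
  0 <= r -> (forall i, `|x 0 i| <= r) -> `|x| <= r.
Proof.
move=> r0 xr; rewrite [leLHS]/Num.Def.normr/= mx_normrE.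
by apply: bigmax_le => // -[i j] _; rewrite ord1.
Qed.

Lemma rV_coord_le (x : 'rV[R]_m) i : `|x 0 i| <= `|x|.
Proof.
rewrite [leRHS]/Num.Def.normr/= mx_normrE.
exact: (le_bigmax _ (fun i : 'I_1 * 'I_m => `|x i.1 i.2|) (0, i)).
Qed.

(** Change one coordinate at a time and telescope. In the sup norm every intermediate point stays
    within [|y - x|] of [x], so derivatives on that ball suffice. *)
Lemma mean_value_coords (h : 'rV[R]_m -> R) (x y : 'rV[R]_m) :
  (forall z, `|z - x| <= `|y - x| -> forall i, derivable h z (e i)) ->
  exists z : 'I_m -> 'rV[R]_m, (forall k, `|z k - x| <= `|y - x|) /\
    h y - h x = \sum_k (y 0 k - x 0 k) * 'D_(e k) h (z k).
Proof.
(* [p k] takes its first [k] coordinates from [y] and the others from [x]. *)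
move=> hd; pose p (k : nat) : 'rV[R]_m := \row_i (if (i < k)%N then y 0 i else x 0 i).
have pS (k : 'I_m) : p k.+1 = (y 0 k - x 0 k) *: e k + p k.
  apply/rowP => i; rewrite !mxE eqxx/= ltnS leq_eqVlt -(inj_eq val_inj) /=.
  case: (ltngtP i k) => [||/val_inj ->] /=;
    by rewrite ?mulr0 ?add0r// mulr1 subrK.
have near (k : 'I_m) t : `|t| <= `|y 0 k - x 0 k| -> 0 <= t * (y 0 k - x 0 k) ->
    `|(t *: e k + p k) - x| <= `|y - x|.
  move=> ts _; apply: rV_norm_le => // i; rewrite !mxE eqxx/=.
  have [->|ik] := eqVneq i k.
    rewrite ltnn mulr1 addrK; apply: (le_trans ts).
    by have := rV_coord_le (y - x) k; rewrite !mxE.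
  rewrite mulr0 add0r; case: ifP => _.
    by have := rV_coord_le (y - x) i; rewrite !mxE.
  by rewrite subrr normr0.
have /choice[t tP] : forall k : 'I_m, exists t, `|(t *: e k + p k) - x| <= `|y - x| /\
    h (p k.+1) - h (p k) = (y 0 k - x 0 k) * 'D_(e k) h (t *: e k + p k).
  move=> k; have [t ts t0|t [ts t0 E]] := @MVT_line _ h (p k) (e k) (y 0 k - x 0 k).
    by apply: hd; exact: near.
  by exists t; split; [exact: near | rewrite pS].
exists (fun k => t k *: e k + p k); split => [k|]; first by case: (tP k).
under eq_bigr => k _ do rewrite -(tP k).2.
rewrite -(big_mkord xpredT (fun k => h (p k.+1) - h (p k))) telescope_sumr//.
by congr (h _ - h _); apply/rowP => i; rewrite !mxE ?ltn_ord ?ltn0.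
Qed.

Lemma cvg_rV (T : Type) (F : set_system T) (FF : Filter F) (z : T -> 'rV[R]_m) (l : 'rV[R]_m) :
  (forall i, z t 0 i @[t --> F] --> l 0 i) -> z t @[t --> F] --> l.
Proof.
move=> zl; apply/cvgrPdist_le => /= eps eps0.
have : \forall t \near F, forall i, `|l 0 i - z t 0 i| <= eps.
  apply: filter_forall => i; have /cvgrPdist_le := zl i; exact.
apply: filterS => t ti; apply: rV_norm_le => [|i]; first exact: ltW.
by rewrite !mxE.
Qed.

Lemma continuous_rV (T : topologicalType) (z : T -> 'rV[R]_m) (x : T) :
  (forall i, {for x, continuous (fun y => z y 0 i)}) -> {for x, continuous z}.
Proof. by move=> zc; apply: cvg_rV => i; exact: zc. Qed.

(** Enough for the chain rule without passing through total differentiability, and directly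
    available from [Ck_on]. *)
Definition C1_near (h : 'rV[R]_m -> R) (x : 'rV[R]_m) :=
  (\forall y \near x, forall i, derivable h y (e i)) /\
  (forall i, {for x, continuous (fun y => 'D_(e i) h y)}).

(** The mean value formula is applied along the curve [t |-> gam (t *: v + x)]. Only directional
    derivatives of the coordinates of [gam] enter, which is what the normalization map on SM will
    offer. *)
Lemma is_derive_chain (V : normedModType R) (gam : V -> 'rV[R]_m)
    (h : 'rV[R]_m -> R) (x v : V) :
  C1_near h (gam x) ->
  (forall k, derivable (fun y => gam y 0 k) x v) ->
  is_derive x v (h \o gam)
    (\sum_k 'D_v (fun y => gam y 0 k) x * 'D_(e k) h (gam x)).
Proof.
move=> [hd hc] gd; have /nbhs_ballP[r /= r0 hr] := hd.
pose c (t : R) := gam (t *: v + x).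
have cc : c t @[t --> 0^'] --> gam x.
  apply: cvg_rV => i; have /derivable1P/derivable1_diffP := gd i.
  move=> /differentiable_continuous H0.
  have H : gam (t *: v + x) 0 i @[t --> 0] --> gam (0 *: v + x) 0 i := H0.
  rewrite scale0r add0r in H.
  by apply: cvg_trans H; apply: cvg_app; exact: cvg_within.
have /choice[z zP] : forall t, exists z : 'I_m -> 'rV[R]_m,
    (forall k, `|z k - gam x| <= `|c t - gam x|) /\ (`|c t - gam x| < r ->
    h (c t) - h (gam x) = \sum_k (c t 0 k - gam x 0 k) * 'D_(e k) h (z k)).
  move=> t; have [cr|cr] := ltP `|c t - gam x| r.
    have [z w|z [z1 z2]] := @mean_value_coords h (gam x) (c t).
      move=> ?; apply: hr; rewrite -ball_normE /= distrC.
      exact: le_lt_trans w cr.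
    by exists z.
  (* A default keeping the intermediate points convergent for all [t]; the formula is used only near
     0. *)
  by exists (fun=> gam x); split => // k; rewrite subrr normr0.
have zc k : z t k @[t --> 0^'] --> gam x.
  apply/cvgrPdist_le => /= eps eps0; move/cvgrPdist_le : cc => /(_ eps eps0).
  apply: filterS => t; apply: le_trans; rewrite distrC (le_trans ((zP t).1 k))//.
  by rewrite distrC.
have Q : \forall t \near 0^', t^-1 *: (h (c t) - h (gam x)) =
    \sum_k (t^-1 *: (c t 0 k - gam x 0 k)) * 'D_(e k) h (z t k).
  move/cvgrPdist_lt : cc => /(_ r r0); apply: filterS => t.
  rewrite distrC => /(zP t).2 ->; rewrite scaler_sumr; apply: eq_bigr => k _.
  by rewrite scalerAl.
have L : t^-1 *: (h (c t) - h (gam x)) @[t --> 0^'] -->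
    \sum_k 'D_v (fun y => gam y 0 k) x * 'D_(e k) h (gam x).
  have : \sum_k (t^-1 *: (c t 0 k - gam x 0 k)) * 'D_(e k) h (z t k) @[t --> 0^']
      --> \sum_k 'D_v (fun y => gam y 0 k) x * 'D_(e k) h (gam x).
    apply: cvg_bigsum => k; apply: cvgM; first exact: (gd k).
    exact: (cvg_comp _ _ (zc k) (hc k)).
  by apply: cvg_trans; apply: near_eq_cvg; apply: filterS Q => t ->.
apply: DeriveDef; first by apply/cvg_ex; eexists; exact: L.
by apply/cvg_lim => //; exact: L.
Qed.

Lemma derive_coord (x v : 'rV[R]_m) k :
  is_derive x v (fun y : 'rV[R]_m => y 0 k) (v 0 k).
Proof.
have d : derivable (fun y : 'rV[R]_m => y) x v by exact: derivable_id.
apply: DeriveDef.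
  exact: ((@derivable_mxP R _ 1 m (fun y => y) x v).1 d 0 k).
by have := derive_mx d; rewrite derive_id => /rowP/(_ k); rewrite mxE => ->.
Qed.

Lemma is_derive_dir (h : 'rV[R]_m -> R) (x v : 'rV[R]_m) :
  C1_near h x -> is_derive x v h (\sum_k v 0 k * 'D_(e k) h x).
Proof.
move=> hC; have := @is_derive_chain _ (fun y => y) h x v hC (fun k => @ex_derive _ _ _ _ _ _ _ (derive_coord x v k)).
by under eq_bigr do rewrite (@derive_val _ _ _ _ _ _ _ (derive_coord _ _ _)).
Qed.


End Coordinates.
End Calculus.

(** * Smooth functions on open subsets of R^n *)

Section CkTheory.
Context {R : realType}.

Lemma near_eq_continuous (T U : topologicalType) (f h : T -> U) (x : T) :
  (\forall y \near x, f y = h y) -> {for x, continuous f} ->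
  {for x, continuous h}.
Proof.
move=> fh fc; have H := near_eq_cvg fh.
by rewrite /prop_for /continuous_at -(nbhs_singleton fh); exact: (cvg_trans (H _) fc).
Qed.

Section OneSpace.
Context {n : nat}.
Implicit Types (O W : set 'rV[R]_n) (h f : 'rV[R]_n -> R).
Local Notation e i := (delta_mx 0 i : 'rV[R]_n).

Lemma Ck_onW k O h : Ck_on k.+1 O h -> Ck_on k O h.
Proof.
elim: k h => [|k IH] h [hc hd]; first by [].
by split => // i; split; [exact: (hd i).1 | exact: IH (hd i).2].
Qed.

Lemma Ck_on0 k O h : Ck_on k O h -> forall x, O x -> {for x, continuous h}.
Proof. by case: k => [|k] []. Qed.

Lemma Ck_on_sub k O W h : W `<=` O -> Ck_on k O h -> Ck_on k W h.
Proof.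
move=> WO; elim: k h => [|k IH] h [hc hd].
  by split => // x /WO; exact: hc.
split => [x /WO|i]; first exact: hc.
by split => [x /WO|]; [exact: (hd i).1 | exact: IH (hd i).2].
Qed.

(** All clauses of [Ck_on] are conditions on the total function at single points of the set, so the
    sets [W] may be arbitrary. *)
Lemma Ck_on_local k O h :
  (forall x, O x -> exists2 W, W x & Ck_on k W h) -> Ck_on k O h.
Proof.
elim: k h => [|k IH] h H.
  by split => // x Ox; have [W Wx [+ _]] := H x Ox; exact.
split => [x Ox|i]; first by have [W Wx [+ _]] := H x Ox; exact.
split => [x Ox|]; first by have [W Wx [_ /(_ i)[+ _]]] := H x Ox; exact.
by apply: IH => x Ox; have [W Wx [_ /(_ i)[_ ?]]] := H x Ox; exists W.
Qed.

Lemma open_near O x : open O -> O x -> \forall y \near x, O y.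
Proof. by move=> oO Ox; exact: (open_nbhs_nbhs (conj oO Ox)). Qed.

(** Openness turns agreement on [O] into agreement near each point, hence into equality of
    derivatives. *)
Lemma Ck_on_ext k O f h : open O -> (forall x, O x -> f x = h x) ->
  Ck_on k O f -> Ck_on k O h.
Proof.
move=> oO; elim: k f h => [|k IH] f h fh [fc fd].
  split => // x Ox; apply: near_eq_continuous (fc x Ox).
  by apply: filterS (open_near oO Ox) => y /fh.
have E x : O x -> \forall y \near x, f y = h y.
  by move=> Ox; apply: filterS (open_near oO Ox) => y /fh.
split => [x Ox|i]; first exact: near_eq_continuous (E x Ox) (fc x Ox).
split => [x Ox|].
  by apply: near_eq_derivable ((fd i).1 x Ox); exact: E.
apply: IH (fd i).2 => x Ox; apply: near_eq_derive; exact: E.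
Qed.

Lemma Ck_on_C1 k O h x : open O -> O x -> Ck_on k.+1 O h -> C1_near h x.
Proof.
move=> oO Ox [hc hd]; split.
  by apply: filterS (open_near oO Ox) => y Oy i; exact: (hd i).1.
by move=> i; exact: (Ck_on0 (hd i).2).
Qed.

Lemma Ck_on_cst k O a : Ck_on k O (fun=> a).
Proof.
elim: k a => [|k IH] a; first by split => // x _; exact: cst_continuous.
split => [x _|i]; first exact: cst_continuous.
split => [x _|]; first exact: derivable_cst.
by under eq_fun do rewrite derive_cst; exact: IH.
Qed.

Lemma Ck_on_coord k O i : Ck_on k O (fun x => x 0 i).
Proof.
case: k => [|k]; first by split => // x _; exact: coord_continuous.
split => [x _|j]; first exact: coord_continuous.
split => [x _|]; first exact: (@ex_derive _ _ _ _ _ _ _ (derive_coord _ _ _)).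
under eq_fun do rewrite (@derive_val _ _ _ _ _ _ _ (derive_coord _ _ _)).
exact: Ck_on_cst.
Qed.

Lemma Ck_onD k O f h : open O -> Ck_on k O f -> Ck_on k O h ->
  Ck_on k O (fun x => f x + h x).
Proof.
move=> oO; elim: k f h => [|k IH] f h [fc fd] [hc hd].
  by split => // x Ox; exact: (continuousD (fc x Ox) (hc x Ox)).
split => [x Ox|i]; first exact: (continuousD (fc x Ox) (hc x Ox)).
split => [x Ox|]; first by apply: derivableD; [exact: (fd i).1|exact: (hd i).1].
apply: Ck_on_ext (IH _ _ (fd i).2 (hd i).2) => // x Ox.
by rewrite [RHS]deriveD; [|exact: (fd i).1|exact: (hd i).1].
Qed.

Lemma Ck_onM k O f h : open O -> Ck_on k O f -> Ck_on k O h ->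
  Ck_on k O (fun x => f x * h x).
Proof.
move=> oO; elim: k f h => [|k IH] f h fC hC.
  case: fC hC => fc _ [hc _].
  by split => // x Ox; exact: (continuousM (fc x Ox) (hc x Ox)).
have [fc fd] := fC; have [hc hd] := hC.
split => [x Ox|i]; first exact: (continuousM (fc x Ox) (hc x Ox)).
split => [x Ox|]; first by apply: derivableM; [exact: (fd i).1|exact: (hd i).1].
have := Ck_onD oO (IH _ _ (Ck_onW fC) (hd i).2) (IH _ _ (Ck_onW hC) (fd i).2).
apply: Ck_on_ext => // x Ox.
by rewrite [RHS]deriveM; [|exact: (fd i).1|exact: (hd i).1].
Qed.

Lemma Ck_on_sum k O (I : Type) (s : seq I) (f : I -> 'rV[R]_n -> R) :
  open O -> (forall i, Ck_on k O (f i)) ->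
  Ck_on k O (fun x => \sum_(i <- s) f i x).
Proof.
move=> oO fC; elim: s => [|i s IH].
  by under eq_fun do rewrite big_nil; exact: Ck_on_cst.
by under eq_fun do rewrite big_cons; exact: Ck_onD.
Qed.

End OneSpace.

(** Induction on [k] with [h] general: a partial derivative of the composite is a sum of products of
    partials of [gam] with partials of [h] composed with [gam], and the latter fall under the
    induction hypothesis. *)
Lemma Ck_on_comp (m n k : nat) (O : set 'rV[R]_n) (W : set 'rV[R]_m)
    (gam : 'rV[R]_m -> 'rV[R]_n) (h : 'rV[R]_n -> R) :
  open O -> open W -> (forall x, W x -> O (gam x)) ->
  (forall j, Ck_on k W (fun x => gam x 0 j)) -> Ck_on k O h ->
  Ck_on k W (fun x => h (gam x)).
Proof.
move=> oO oW WO; elim: k h => [|k IH] h gC hC.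
  split => // x Wx; apply: (@continuous_comp _ _ _ gam h); last exact/(Ck_on0 hC)/WO.
  by apply: continuous_rV => j; exact: (Ck_on0 (gC j)).
have gd j i x : W x -> derivable (fun x => gam x 0 j) x (delta_mx 0 i).
  by move=> Wx; exact: ((gC j).2 i).1.
have hd x : W x -> C1_near h (gam x) by move=> /WO Ox; exact: Ck_on_C1 hC.
have C i x (Wx : W x) := is_derive_chain (hd x Wx) (fun j => gd j i x Wx).
split => [x Wx|i].
  apply: (@continuous_comp _ _ _ gam h); last exact/(Ck_on0 hC)/WO.
  by apply: continuous_rV => j; exact: (Ck_on0 (gC j)).
split => [x Wx|]; first exact: (@ex_derive _ _ _ _ _ _ _ (C i x Wx)).
apply: (@Ck_on_ext _ _ _ (fun x => \sum_j 'D_(delta_mx 0 i) (fun y => gam y 0 j) x *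
    'D_(delta_mx 0 j) h (gam x))) => //.
  by move=> x Wx; rewrite -(@derive_val _ _ _ _ _ _ _ (C i x Wx)).
apply: Ck_on_sum => // j; apply: Ck_onM => //; first exact: ((gC j).2 i).2.
exact: (IH _ (fun l => Ck_onW (gC l)) (hC.2 j).2).
Qed.

Section SmoothOn.
Context {n : nat}.
Implicit Types (O W : set 'rV[R]_n) (h f : 'rV[R]_n -> R).

Lemma smooth_on_sub O W h : W `<=` O -> smooth_on O h -> smooth_on W h.
Proof. by move=> WO hs k; exact: Ck_on_sub (hs k). Qed.

Lemma smooth_on_local O h :
  (forall x, O x -> exists2 W, W x & smooth_on W h) -> smooth_on O h.
Proof.
by move=> H k; apply: Ck_on_local => x /H[W Wx hs]; exists W.
Qed.

Lemma smooth_on_ext O f h : open O -> (forall x, O x -> f x = h x) ->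
  smooth_on O f -> smooth_on O h.
Proof. by move=> oO fh fs k; exact: Ck_on_ext (fs k). Qed.

Lemma smooth_on_C1 O h x : open O -> O x -> smooth_on O h -> C1_near h x.
Proof. by move=> oO Ox /(_ 1%N); exact: Ck_on_C1. Qed.

Lemma smooth_on_continuous O h x : O x -> smooth_on O h -> {for x, continuous h}.
Proof. by move=> Ox /(_ 0%N) hs; exact: (Ck_on0 hs). Qed.

Lemma smooth_on_partial O h i : smooth_on O h ->
  smooth_on O (fun x => 'D_(delta_mx 0 i) h x).
Proof. by move=> hs k; exact: ((hs k.+1).2 i).2. Qed.

Lemma smooth_on_cst O a : smooth_on O (fun=> a).
Proof. by move=> k; exact: Ck_on_cst. Qed.

Lemma smooth_on_coord O i : smooth_on O (fun x => x 0 i).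
Proof. by move=> k; exact: Ck_on_coord. Qed.

Lemma smooth_onD O f h : open O -> smooth_on O f -> smooth_on O h ->
  smooth_on O (fun x => f x + h x).
Proof. by move=> oO fs hs k; exact: Ck_onD. Qed.

Lemma smooth_onM O f h : open O -> smooth_on O f -> smooth_on O h ->
  smooth_on O (fun x => f x * h x).
Proof. by move=> oO fs hs k; exact: Ck_onM. Qed.

Lemma smooth_on_sum O (I : Type) (s : seq I) (f : I -> 'rV[R]_n -> R) :
  open O -> (forall i, smooth_on O (f i)) ->
  smooth_on O (fun x => \sum_(i <- s) f i x).
Proof. by move=> oO fs k; apply: Ck_on_sum => // i; exact: fs. Qed.

End SmoothOn.

Lemma smooth_on_comp (m n : nat) (O : set 'rV[R]_n) (W : set 'rV[R]_m)
    (gam : 'rV[R]_m -> 'rV[R]_n) (h : 'rV[R]_n -> R) :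
  open O -> open W -> (forall x, W x -> O (gam x)) ->
  (forall j, smooth_on W (fun x => gam x 0 j)) -> smooth_on O h ->
  smooth_on W (fun x => h (gam x)).
Proof.
move=> oO oW WO gs hs k.
by apply: (Ck_on_comp oO oW WO) (hs k) => j; exact: gs.
Qed.

End CkTheory.

(** * Hadamard's lemma *)

Lemma continuous_pairing (T U V : topologicalType) (f : T -> U) (g : T -> V) (x : T) :
  {for x, continuous f} -> {for x, continuous g} ->
  {for x, continuous (fun t => (f t, g t))}.
Proof. by move=> fc gc; exact: (cvg_pair fc gc). Qed.

Section UnitIntegral.
Context {R : realType}.
Local Notation mu := (@lebesgue_measure R).

Definition unit_integral (a : R -> R) : R := \int[mu]_(t in `[0, 1]) a t.
Local Notation J := unit_integral.

Lemma unit_integrable (a : R -> R) : continuous a ->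
  mu.-integrable `[0, 1] (EFin \o a).
Proof.
move=> ac; apply: continuous_compact_integrable; first exact: segment_compact.
exact: continuous_subspaceT.
Qed.

Lemma unit_integralB (a b : R -> R) : continuous a -> continuous b ->
  J (fun t => a t - b t) = J a - J b.
Proof. by move=> ac bc; rewrite /J RintegralB//; exact: unit_integrable. Qed.

Lemma unit_integralD (a b : R -> R) : continuous a -> continuous b ->
  J (fun t => a t + b t) = J a + J b.
Proof. by move=> ac bc; rewrite /J RintegralD//; exact: unit_integrable. Qed.

Lemma unit_integralZ r (a : R -> R) : continuous a ->
  J (fun t => r * a t) = r * J a.
Proof. by move=> ac; rewrite /J RintegralZl//; exact: unit_integrable. Qed.

Lemma continuous_bigsum (T : topologicalType) (I : Type) (s : seq I) (a : I -> T -> R) :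
  (forall i, continuous (a i)) -> continuous (fun t => \sum_(i <- s) a i t).
Proof. by move=> ac t; apply: cvg_bigsum => i; exact: ac. Qed.

Lemma unit_integral_sum (I : Type) (s : seq I) (a : I -> R -> R) :
  (forall i, continuous (a i)) ->
  J (fun t => \sum_(i <- s) a i t) = \sum_(i <- s) J (a i).
Proof.
move=> ac; elim: s => [|i s IH].
  rewrite big_nil /J; under eq_Rintegral do rewrite big_nil.
  by rewrite Rintegral_cst// mul0r.
rewrite big_cons -IH -unit_integralD//; last exact: continuous_bigsum.
by apply: eq_Rintegral => t _; rewrite big_cons.
Qed.

Lemma unit_integral_close (a b : R -> R) eps : continuous a -> continuous b ->
  (forall t, 0 <= t <= 1 -> `|a t - b t| <= eps) -> `|J a - J b| <= eps.
Proof.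
move=> ac bc ab; rewrite -unit_integralB//.
have abc : continuous (fun t => a t - b t).
  by move=> t; apply: continuousB; [exact: ac|exact: bc].
have nc : continuous (fun t => `|a t - b t|).
  move=> t; apply: (@continuous_comp _ _ _ (fun t => a t - b t) (fun x : R => `|x|)).
    exact: abc.
  exact: norm_continuous.
apply: (le_trans (le_normr_Rintegral _ (unit_integrable abc))) => //.
have -> : eps = J (fun=> eps).
  by rewrite /J Rintegral_cst//= lebesgue_measure_itv/= lte_fin ltr01 oppr0 adde0 mulr1.
apply: le_Rintegral => //; first exact: unit_integrable.
by apply: unit_integrable => t; exact: cst_continuous.
Qed.

Lemma unit_integral_FTC (F a : R -> R) : continuous a ->
  (forall t : R, is_derive t (1 : R) F (a t)) -> J a = F 1 - F 0.
Proof.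
move=> ac Fa.
have Fd (t : R) : derivable F t 1 by exact: (@ex_derive _ _ _ _ _ _ _ (Fa t)).
have Fc : continuous F by move=> t; exact/differentiable_continuous/derivable1_diffP.
rewrite /J /Rintegral (@continuous_FTC2 _ a F 0 1)//.
- exact: continuous_subspaceT.
- split; [by move=> t _; exact: Fd| |].
    exact/cvg_at_right_filter/Fc.
  exact/cvg_at_left_filter/Fc.
- by move=> t _; rewrite derive1E; exact: (@derive_val _ _ _ _ _ _ _ (Fa t)).
Qed.

(** The tube lemma: compactness of [0, 1] makes joint continuity uniform in [t]. *)
Lemma unit_near_uniform (W : topologicalType) (k : R * W -> R) (w0 : W) eps :
  continuous k -> 0 < eps ->
  \forall w \near w0, forall t, 0 <= t <= 1 -> `|k (t, w) - k (t, w0)| <= eps.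
Proof.
move=> kc eps0.
have K : compact (`[0, 1]%classic : set R) by exact: segment_compact.
move/compact_near_coveringP : K => /(_ _ (nbhs w0)
  (fun w t => `|k (t, w) - k (t, w0)| <= eps) _) H.
have {H} : \forall w \near w0, `[0, 1]%classic `<=`
    (fun t => `|k (t, w) - k (t, w0)| <= eps).
  apply: H => t0 _.
  have c2 : {for (t0, w0), continuous (fun p : R * W => k (p.1, w0))}.
    apply: (@continuous_comp _ _ _ (fun p : R * W => (p.1, w0)) k); last exact: kc.
    by apply: continuous_pairing; [exact: cvg_fst|exact: cst_continuous].
  have c3 : k p - k (p.1, w0) @[p --> (t0, w0)] --> k (t0, w0) - k (t0, w0).
    exact: continuousB (kc (t0, w0)) c2.
  rewrite subrr in c3; move/cvgrPdist_le : c3 => /(_ eps eps0).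
  by apply: filterS => -[t w] /=; rewrite sub0r normrN.
by apply: filterS => w H t t01; apply: H; rewrite /= in_itv.
Qed.

Section RayMean.
Context {V : normedModType R}.
Implicit Types f : V -> R.

(* Differentiating under the integral sign turns the j-th mean of [f] into the
   (j+1)-st mean of a derivative of [f]: smoothness follows by induction. *)
Definition ray_mean j f (z : V) : R := J (fun t => t ^+ j * f (t *: z)).

Lemma continuous_exprM (T : topologicalType) j (a : T -> R) (h : T -> R) p :
  {for p, continuous a} -> {for p, continuous h} ->
  {for p, continuous (fun p => a p ^+ j * h p)}.
Proof.
move=> ac hc; have c := @continuous_comp _ _ _ a (fun t => t ^+ j) p ac
  (@exprn_continuous _ j _).
exact: (continuousM c hc).
Qed.

Lemma continuous_ray j f : continuous f ->
  continuous (fun p : R * V => p.1 ^+ j * f (p.1 *: p.2)).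
Proof.
move=> fc p; apply: (@continuous_exprM _ j fst); first exact: cvg_fst.
apply: (@continuous_comp _ _ _ (fun p : R * V => p.1 *: p.2) f).
  exact: scale_continuous.
exact: fc.
Qed.

Lemma continuous_ray1 j f z : continuous f ->
  continuous (fun t : R => t ^+ j * f (t *: z)).
Proof.
move=> fc t; apply: (@continuous_comp _ _ _ (fun t => (t, z))
  (fun p : R * V => p.1 ^+ j * f (p.1 *: p.2))); last exact: continuous_ray.
by apply: continuous_pairing; [exact: cvg_id|exact: cst_continuous].
Qed.

Lemma continuous_ray_mean j f : continuous f -> continuous (ray_mean j f).
Proof.
move=> fc z; apply/cvgrPdist_le => eps eps0.
apply: filterS (unit_near_uniform z (@continuous_ray j f fc) eps0) => w H.
rewrite distrC; apply: unit_integral_close => //; exact: continuous_ray1.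
Qed.

(** The difference quotient is the integral of [q s], and the integrands converge uniformly on
    [0, 1], so the limit passes under the integral. *)
Lemma is_derive_ray_mean j f (z v : V) : continuous f ->
  (forall y, derivable f y v) -> continuous (fun y => 'D_v f y) ->
  is_derive z v (ray_mean j f) (ray_mean j.+1 (fun y => 'D_v f y) z).
Proof.
move=> fc fd dfc.
pose q (s t : R) := s^-1 * (t ^+ j * f (t *: (s *: v + z)) - t ^+ j * f (t *: z)).
have qc s : continuous (q s).
  move=> t; have c := continuousB (@continuous_ray1 j f (s *: v + z) fc t)
    (@continuous_ray1 j f z fc t).
  exact: (continuousM (@cst_continuous _ _ s^-1 t) c).
have qE s : s^-1 *: (ray_mean j f (s *: v + z) - ray_mean j f z) = J (q s).
  rewrite [RHS]unit_integralZ.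
    by rewrite unit_integralB//; exact: continuous_ray1.
  move=> t; have c := continuousB (@continuous_ray1 j f (s *: v + z) fc t)
    (@continuous_ray1 j f z fc t).
  exact: c.
suff L : s^-1 *: (ray_mean j f (s *: v + z) - ray_mean j f z) @[s --> 0^'] -->
    ray_mean j.+1 (fun y => 'D_v f y) z.
  apply: DeriveDef; first by apply/cvg_ex; eexists; exact: L.
  by apply/cvg_lim => //; exact: L.
apply/cvgrPdist_le => eps eps0.
(* The mean value theorem will give [q s t = k (t, th)] with [|th| <= |s|], while the expected limit
   is [k (t, 0)]. *)
pose k (p : R * R) := p.1 ^+ j.+1 * 'D_v f (p.2 *: v + p.1 *: z).
have kc : continuous k.
  move=> p; apply: (@continuous_exprM _ j.+1 fst); first exact: cvg_fst.
  apply: (@continuous_comp _ _ _ (fun p : R * R => p.2 *: v + p.1 *: z)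
    (fun y => 'D_v f y)); last exact: dfc.
  have c1 : {for p, continuous (fun p : R * R => p.2 *: v)}.
    have c : q.2 *: v @[q --> p] --> p.2 *: v by apply: cvgZr_tmp; exact: cvg_snd.
    exact: c.
  have c2 : {for p, continuous (fun p : R * R => p.1 *: z)}.
    have c : q.1 *: z @[q --> p] --> p.1 *: z by apply: cvgZr_tmp; exact: cvg_fst.
    exact: c.
  exact: (continuousD c1 c2).
have /nbhs_ballP[r /= r0 H] := unit_near_uniform 0 kc eps0.
near=> s.
have s0 : s != 0 by near: s; exact: nbhs_dnbhs_neq.
have sr : `|s| < r by near: s; exact: dnbhs0_lt.
rewrite qE distrC; apply: unit_integral_close => //.
  exact: (@continuous_ray1 j.+1 (fun y => 'D_v f y)).
move=> t t01; have /andP[t0 t1] := t01.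
(* The increment is [t * s] because [t *: (s *: v + z)] is [(t * s) *: v + t *: z]; this extra
   factor [t] raises the exponent from [j] to [j.+1]. *)
have [//|th [th1 _ E]] := @MVT_line _ _ f (t *: z) v (t * s).
rewrite /q -mulrBr scalerDr scalerA E.
have -> : s^-1 * (t ^+ j * (t * s * 'D_v f (th *: v + t *: z))) = k (t, th).
  by rewrite /k/= exprSr; field.
have -> : t ^+ j.+1 * 'D_v f (t *: z) = k (t, 0) by rewrite /k/= scale0r add0r.
apply: H => //; rewrite -ball_normE/= sub0r normrN (le_lt_trans th1)//.
by rewrite (le_lt_trans _ sr)// normrM ler_piMl// ger0_norm.
Unshelve. all: by end_near. Qed.


End RayMean.
End UnitIntegral.

Section Hadamard.
Context {R : realType} {n : nat}.
Implicit Types f : 'rV[R]_n -> R.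
Local Notation e i := (delta_mx 0 i : 'rV[R]_n).

Lemma derive_translate f (x v : 'rV[R]_n) :
  'D_v (fun y => f (y + x)) 0 = 'D_v f x.
Proof.
have E : (fun s : R => s^-1 *: (f (s *: v + 0 + x) - f (0 + x))) =
    (fun s : R => s^-1 *: (f (s *: v + x) - f x)).
  by apply/funext => s; rewrite addr0 add0r.
by rewrite /derive /= E.
Qed.

Lemma smooth_ray_mean j f : smooth_on setT f -> smooth_on setT (ray_mean j f).
Proof.
move=> fs k; elim: k j f fs => [|k IH] j f fs.
  split => // x _; apply: continuous_ray_mean => y.
  exact: smooth_on_continuous fs.
have fc : continuous f by move=> y; exact: smooth_on_continuous fs.
have D i x : is_derive x (e i) (ray_mean j f) (ray_mean j.+1 (fun y => 'D_(e i) f y) x).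
  apply: is_derive_ray_mean => // y; first exact: (((fs 1%N).2 i).1).
  exact: smooth_on_continuous (smooth_on_partial i fs).
split => [x _|i]; first exact: continuous_ray_mean.
split => [x _|]; first exact: (@ex_derive _ _ _ _ _ _ _ (D i x)).
under eq_fun do rewrite (@derive_val _ _ _ _ _ _ _ (D _ _)).
exact/IH/smooth_on_partial.
Qed.

(** Integrate the derivative of [f] along the segment from [x] to [y]. The translate [h] moves [x]
    to the origin, where the rays of [ray_mean] start. *)
Lemma Hadamard_lemma f (x : 'rV[R]_n) : smooth_on setT f ->
  exists psi : 'I_n -> 'rV[R]_n -> R, (forall i, smooth_on setT (psi i)) /\
    (forall i, psi i x = 'D_(e i) f x) /\
    forall y, f y = f x + \sum_i (y 0 i - x 0 i) * psi i y.
Proof.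
move=> fs; pose h y := f (y + x).
have sh (z : 'rV[R]_n) (k : 'rV[R]_n -> R) : smooth_on setT k ->
    smooth_on setT (fun y => k (y + z)).
  move=> ks; apply: (@smooth_on_comp _ _ _ setT setT (fun y => y + z)) => //; try exact: openT.
  move=> j; under eq_fun do rewrite mxE.
  by apply: smooth_onD; [exact: openT|exact: smooth_on_coord|exact: smooth_on_cst].
have hs : smooth_on setT h by exact: sh.
pose psi i (y : 'rV[R]_n) := ray_mean 0 (fun z => 'D_(e i) h z) (y - x).
have cD i : continuous (fun z => 'D_(e i) h z).
  by move=> z; exact: smooth_on_continuous (smooth_on_partial i hs).
exists psi; split; [|split].
- by move=> i; apply: sh; apply: smooth_ray_mean; exact: smooth_on_partial.
- move=> i; rewrite /psi /ray_mean subrr.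
  under eq_fun do rewrite expr0 mul1r scaler0.
  rewrite /unit_integral Rintegral_cst//= lebesgue_measure_itv/= lte_fin ltr01 oppr0 adde0 mulr1.
  exact: derive_translate.
- move=> y; pose z := y - x.
  have dh (t : R) : is_derive t (1 : R) (fun s : R => h (s *: z + 0))
      (\sum_i z 0 i * (t ^+ 0 * 'D_(e i) h (t *: z))).
    have C : C1_near h (t *: z + 0) by exact: smooth_on_C1 openT _ hs.
    have [D1 D2] := is_derive_dir z C.
    apply: is_derive_eq; first exact: is_derive_line.
    by rewrite D2 addr0; apply: eq_bigr => i _; rewrite expr0 mul1r.
  have c i : continuous (fun t : R => t ^+ 0 * 'D_(e i) h (t *: z)).
    exact: (@continuous_ray1 _ _ 0 (fun z => 'D_(e i) h z)).
  have c' i : continuous (fun t : R => z 0 i * (t ^+ 0 * 'D_(e i) h (t *: z))).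
    by move=> t; exact: (continuousM (@cst_continuous _ _ (z 0 i) t) (c i t)).
  have := unit_integral_FTC (continuous_bigsum c') dh.
  rewrite unit_integral_sum// scale0r scale1r !addr0 /h add0r subrK => E.
  rewrite -[LHS](subrK (f x)) -E addrC; congr (_ + _); apply: eq_bigr => i _.
  by rewrite unit_integralZ// !mxE.
Qed.

End Hadamard.

(** * Bump functions *)

Section Bump.
Context {R : realType}.

(* The index [m] makes the family closed under differentiation. *)
Definition flat m (x : R) : R :=
  if 0 < x then x^-1 ^+ m * expR (- x^-1) else 0.

Lemma flat_le0 m x : x <= 0 -> flat m x = 0.
Proof. by move=> x0; rewrite /flat ltNge x0. Qed.

(** From [expR y >= y ^+ m.+2 / (m.+2)!] at [y = x^-1]. Two spare powers of [x] give the vanishing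
    derivative at 0 for every [m]. *)
Lemma flat_bound m x : 0 <= flat m x <= (m.+2)`!%:R * x ^+ 2.
Proof.
rewrite /flat; case: ifP => x0; last first.
  by rewrite lexx mulr_ge0// sqr_ge0.
have y0 : 0 < x^-1 by rewrite invr_gt0.
apply/andP; split; first by rewrite mulr_ge0 ?exprn_ge0 ?expR_ge0 ?ltW.
rewrite expRN ler_pdivrMr ?expR_gt0//.
have := @expR_ge1Dxn R x^-1 m.+1 (ltW y0).
have f0 : 0 < (m.+2)`!%:R :> R by rewrite ltr0n fact_gt0.
move=> H; have {H} : x^-1 ^+ m.+2 / (m.+2)`!%:R <= expR x^-1.
  by apply: le_trans H; rewrite lerDr.
rewrite ler_pdivrMr// => H.
have -> : x^-1 ^+ m = x ^+ 2 * x^-1 ^+ m.+2.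
  by rewrite -(addn2 m) exprD mulrCA -exprMn divff ?gt_eqF// expr1n mulr1.
apply: (le_trans (ler_wpM2l (sqr_ge0 x) H)).
by rewrite le_eqVlt; apply/orP; left; apply/eqP; ring.
Qed.

Lemma is_derive_flat m (x : R) :
  is_derive x (1 : R) (flat m) (flat m.+2 x - m%:R * flat m.+1 x).
Proof.
have [x0|x0|->] := ltgtP x 0.
- rewrite !flat_le0 ?ltW// mulr0 subr0.
  have E : \forall y \near x, cst 0 y = flat m y.
    near=> y; rewrite flat_le0 ?ltW//; near: y; exact: lt_nbhsl.
  exact: (near_eq_is_derive E (is_derive_cst _ _ _)).
- have E : \forall y \near x, y^-1 ^+ m * expR (- y^-1) = flat m y.
    near=> y; rewrite /flat ifT//; near: y; exact: lt_nbhsr.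
  apply: (near_eq_is_derive E).
  have xn : x != 0 by rewrite gt_eqF.
  have D1 : is_derive x (1 : R) (fun y : R => y^-1) (- x^-1 ^+ 2).
    apply: DeriveDef; first exact: (@derivableV _ _ id).
    by rewrite (@deriveV _ _ id)// derive_id [_ *: _]mulr1 exprVn.
  have D2 : is_derive x (1 : R) (fun y : R => y^-1 ^+ m) (m%:R * x^-1 ^+ m.-1 * - x^-1 ^+ 2).
    by have := is_deriveX m D1; rewrite exprfctE.
  have D3 : is_derive x (1 : R) (fun y : R => expR (- y^-1)) (expR (- x^-1) * x^-1 ^+ 2).
    have := @is_derive1_comp _ _ _ x _ _ (is_derive_expR (- x^-1)) (is_deriveN D1 : is_derive x (1:R) (fun y : R => - y^-1) _).
    by rewrite opprK.
  have := is_deriveM D2 D3.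
  move=> D4; apply: (is_derive_eq D4).
  rewrite /flat x0 /= ![_ *: _]mulrC.
  case: m {E D2 D4} => [|m]; rewrite ?mul0r ?expr0/= ?exprS; ring.
- rewrite !(@flat_le0 _ 0)// mulr0 subr0.
  suff L : h^-1 *: (flat m (h *: (1 : R) + 0) - flat m 0) @[h --> 0^'] --> (0 : R).
    apply: DeriveDef; first by apply/cvg_ex; eexists; exact: L.
    by apply/cvg_lim => //; exact: L.
  apply/cvgrPdist_le => /= eps eps0.
  pose C : R := (m.+2)`!%:R.
  have C0 : 0 < C by rewrite ltr0n fact_gt0.
  near=> h.
  have h0 : h != 0 by near: h; exact: nbhs_dnbhs_neq.
  (* With this radius [C * h ^+ 2] divided by [|h|] stays below [eps]. *)
  have hr : `|h| < eps / C by near: h; apply: dnbhs0_lt; rewrite divr_gt0.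
  rewrite sub0r normrN [_ *: 1]mulr1 addr0 (@flat_le0 _ 0)// subr0.
  have /andP[f0 f1] := flat_bound m h.
  rewrite normrM normfV (ger0_norm f0) mulrC ler_pdivrMr ?normr_gt0//.
  rewrite (le_trans f1)// -/C -(@real_normK _ h) ?num_real// expr2 mulrA ler_wpM2r//.
  by rewrite mulrC -ler_pdivlMr// ltW.
Unshelve. all: by end_near. Qed.

Lemma is_derive_rV1 (F : R -> R) (x : 'rV[R]_1) (d : R) :
  is_derive (x 0 0) (1 : R) F d ->
  is_derive x (delta_mx 0 0 : 'rV[R]_1) (fun y : 'rV[R]_1 => F (y 0 0)) d.
Proof.
move=> [D1 D2].
have E : (fun s : R => s^-1 *: (F ((s *: (delta_mx 0 0 : 'rV[R]_1) + x) 0 0) - F (x 0 0))) =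
    (fun s : R => s^-1 *: (F (s *: (1 : R) + x 0 0) - F (x 0 0))).
  by apply/funext => s; rewrite !mxE eqxx.
by apply: DeriveDef; rewrite /derivable /derive /= E.
Qed.

Lemma smooth_flat m : smooth_on setT (fun x : 'rV[R]_1 => flat m (x 0 0)).
Proof.
move=> k; elim: k m => [|k IH] m.
  split => // x _; apply: (@continuous_comp _ _ _ (fun x : 'rV[R]_1 => x 0 0)).
    exact: coord_continuous.
  apply/differentiable_continuous/derivable1_diffP.
  exact: (@ex_derive _ _ _ _ _ _ _ (is_derive_flat m _)).
have D (x : 'rV[R]_1) := is_derive_rV1 (is_derive_flat m (x 0 0)).
split => [x _|i]; first exact: (Ck_on0 (IH m)).
rewrite (ord1 i); split => [x _|].
  exact: (@ex_derive _ _ _ _ _ _ _ (D x)).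
under eq_fun do rewrite (@derive_val _ _ _ _ _ _ _ (D _)) -mulNr.
apply: Ck_onD; [exact: openT|exact: IH|].
by apply: Ck_onM; [exact: openT|exact: Ck_on_cst|exact: IH].
Qed.

Section Composite.
Context {n : nat}.
Implicit Types (f : 'rV[R]_n -> R).

Lemma smooth_flat_comp f O : open O -> smooth_on O f ->
  smooth_on O (fun x => flat 0 (f x)).
Proof.
move=> oO fs.
have H := @smooth_on_comp _ _ _ setT O (fun x => f x *: (1 : 'rV[R]_1))
  (fun x : 'rV[R]_1 => flat 0 (x 0 0)) openT oO (fun _ _ => I) _ (smooth_flat 0).
have E x : flat 0 (f x) = flat 0 ((f x *: (1 : 'rV[R]_1)) 0 0).
  by rewrite !mxE eqxx mulr1.
under eq_fun do rewrite E.
apply: H => j; under eq_fun do rewrite !mxE (ord1 j) eqxx mulr1.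
exact: fs.
Qed.

(* Composing [flat 0] with itself yields both plateaus without a division. *)
Definition cutoff (x : R) : R := expR 1 * flat 0 (1 - expR 1 * flat 0 x).

Lemma flat0E (x : R) : 0 < x -> flat 0 x = expR (- x^-1).
Proof. by move=> x0; rewrite /flat x0 expr0 mul1r. Qed.

(** The constant [expR 1] is the inverse of [flat 0 1]; it normalizes this plateau to height 1. *)
Lemma cutoff1 x : x <= 0 -> cutoff x = 1.
Proof.
move=> x0; rewrite /cutoff (flat_le0 _ x0) mulr0 subr0 flat0E// invr1.
exact: expRxMexpNx_1.
Qed.

(** For [1 <= x] the inner term [expR (1 - x^-1)] is at least 1, so the outer [flat] has a
    nonpositive argument. *)
Lemma cutoff0 x : 1 <= x -> cutoff x = 0.
Proof.
move=> x1; have x0 : 0 < x by apply: lt_le_trans x1.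
rewrite /cutoff (@flat_le0 _ (1 - _)) ?mulr0// subr_le0 flat0E//.
by rewrite -expRD -[leLHS]expR0 ler_expR subr_ge0 invf_le1.
Qed.

Lemma smooth_cutoff_comp f O : open O -> smooth_on O f ->
  smooth_on O (fun x => cutoff (f x)).
Proof.
move=> oO fs; apply: smooth_onM => //; first exact: smooth_on_cst.
apply: smooth_flat_comp => //; apply: smooth_onD => //; first exact: smooth_on_cst.
under eq_fun do rewrite -mulNr.
by apply: smooth_onM => //; [exact: smooth_on_cst|exact: smooth_flat_comp].
Qed.

Lemma exists_bump (x : 'rV[R]_n) (W : set 'rV[R]_n) : nbhs x W ->
  exists (w : 'rV[R]_n -> R) (r : R), [/\ 0 < r, smooth_on setT w,
    forall y, `|y - x| <= r -> W y,
    forall y, r <= `|y - x| -> w y = 0 & \forall y \near x, w y = 1].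
Proof.
move=> /nbhs_ballP[d /= d0 dW].
(* Halving puts the closed ball of radius [r] inside the open ball of radius [d]. *)
pose r := d / 2; have r0 : 0 < r by rewrite divr_gt0.
pose q (y : 'rV[R]_n) : R := \sum_i (y 0 i - x 0 i) ^+ 2.
have qs : smooth_on setT q.
  apply: smooth_on_sum => [|i]; first exact: openT.
  have s1 : smooth_on setT (fun y : 'rV[R]_n => y 0 i - x 0 i).
    by apply: smooth_onD; [exact: openT|exact: smooth_on_coord|exact: smooth_on_cst].
  by under eq_fun do rewrite expr2; apply: smooth_onM => //; exact: openT.
(* The sup norm is not smooth, so the cutoff is applied to the Euclidean square [q]: it is 1 for
   [q <= r^2 / 2] and 0 for [q >= r^2], and sup-norm distance at least [r] forces the latter. *)
exists (fun y => cutoff (2 / r ^+ 2 * q y - 1)), r; split => //.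
- apply: smooth_cutoff_comp; first exact: openT.
  apply: smooth_onD; [exact: openT| |exact: smooth_on_cst].
  by apply: smooth_onM => //; [exact: openT|exact: smooth_on_cst].
- move=> y yr; apply: dW; rewrite -ball_normE/= distrC (le_lt_trans yr)//.
  by rewrite /r; lra.
- move=> y yr; apply: cutoff0.
  have : exists i, r <= `|y 0 i - x 0 i|.
    apply: contrapT => /forallNP H; move: yr; rewrite leNgt => /negP; apply.
    rewrite [ltLHS]/Num.Def.normr/= mx_normrE; apply: bigmax_lt => // -[i j] _ /=.
    by rewrite ord1 !mxE ltNge; apply/negP; exact: H.
  move=> [i ri].
  have : r ^+ 2 <= q y.
    rewrite /q (bigD1 i)//= -[leLHS]addr0 lerD//.
      by rewrite -[leRHS]real_normK ?num_real// lerXn2r// nnegrE ltW.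
    by apply: sumr_ge0 => j _; exact: sqr_ge0.
  move=> H; have : 2 <= 2 / r ^+ 2 * q y.
    by rewrite mulrAC ler_pdivlMr ?exprn_gt0// ler_pM2l.
  by lra.
- have qc : {for x, continuous q} by exact: smooth_on_continuous qs.
  have q0 : q x = 0 by apply: big1 => i _; rewrite subrr expr0n.
  have e0 : 0 < r ^+ 2 / 2 by rewrite divr_gt0 ?exprn_gt0.
  move/cvgrPdist_lt : qc => /(_ _ e0); rewrite q0; apply: filterS => y.
  rewrite sub0r normrN => H; apply: cutoff1.
  have {}H : q y < r ^+ 2 / 2 by apply: le_lt_trans H; exact: ler_norm.
  rewrite subr_le0 mulrAC ler_pdivrMr ?exprn_gt0//.
  by move: H; rewrite ltr_pdivlMr//; lra.
Qed.

End Composite.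
End Bump.

(** * Derivations and sections over an algebra of smooth functions *)

Section SmoothClosed.
Context {R : realType}.

(** The algebra is a C-infinity ring. This is all that the calculus of derivations uses, so M and SM
    can share it. Requiring [T] smooth everywhere is no loss, as local functions are first cut
    off. *)
Definition smooth_closed (N : smooth_space R) :=
  forall m (f : 'I_m -> N -> R) (T : 'rV[R]_m -> R),
    (forall i, smooth (f i)) -> smooth_on setT T ->
    smooth (fun p => T (\row_i f i p)).

Section Tangent.
Context {N : smooth_space R}.
Implicit Types (h k : N -> R) (p : N) (v w : vec N).

Lemma tangent_lin p v a h k : tangent p v -> smooth h -> smooth k ->
  v (fun x => a * h x + k x) = a * v h + v k.
Proof. by case=> + _ _; exact. Qed.

Lemma tangent_mul p v h k : tangent p v -> smooth h -> smooth k ->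
  v (fun x => h x * k x) = v h * k p + h p * v k.
Proof. by case=> _ + _; exact. Qed.

Lemma tangent_nonsmooth p v h : tangent p v -> ~ smooth h -> v h = 0.
Proof. by case=> _ _; exact. Qed.

Lemma tangent0 p : tangent p (0 : vec N).
Proof. by split=> // *; rewrite /= ?mulr0 ?mul0r addr0. Qed.

Lemma vecZDE (a : R) v w h : (a *: v + w : vec N) h = a * v h + w h.
Proof. by []. Qed.

Lemma tangentZD p (a : R) v w : tangent p v -> tangent p w ->
  tangent p (a *: v + w : vec N).
Proof.
move=> tv tw; split=> [b h k hs ks|h k hs ks|h hs].
- by rewrite !vecZDE (tangent_lin b tv)// (tangent_lin b tw)//; ring.
- by rewrite !vecZDE (tangent_mul tv)// (tangent_mul tw)//; ring.
- by rewrite vecZDE (tangent_nonsmooth tv)// (tangent_nonsmooth tw)// mulr0 addr0.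
Qed.

Lemma tangentZ p (a : R) v : tangent p v -> tangent p (a *: v : vec N).
Proof. by move=> tv; have := tangentZD a tv (tangent0 p); rewrite addr0. Qed.

Lemma tangentD p v w : tangent p v -> tangent p w -> tangent p (v + w : vec N).
Proof. by move=> tv tw; have := tangentZD 1 tv tw; rewrite scale1r. Qed.

Lemma tangentN p v : tangent p v -> tangent p (- v : vec N).
Proof. by move=> tv; rewrite -scaleN1r; exact: tangentZ. Qed.

Lemma tangentB p v w : tangent p v -> tangent p w -> tangent p (v - w : vec N).
Proof. by move=> tv tw; apply: tangentD => //; exact: tangentN. Qed.

Lemma tangent_sum p (I : Type) (s : seq I) (v : I -> vec N) :
  (forall i, tangent p (v i)) -> tangent p (\sum_(i <- s) v i : vec N).
Proof.
move=> tv; elim: s => [|i s IH]; first by rewrite big_nil; exact: tangent0.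
by rewrite big_cons; exact: tangentD.
Qed.

Lemma vec_sumE (I : Type) (s : seq I) (v : I -> vec N) h :
  (\sum_(i <- s) v i : vec N) h = \sum_(i <- s) v i h.
Proof. by elim: s => [|i s IH]; rewrite ?big_nil ?big_cons// -IH. Qed.

Lemma eq_tangent p v w : tangent p v -> tangent p w ->
  (forall h, smooth h -> v h = w h) -> v = w.
Proof.
move=> tv tw vw; apply/funext => h.
have [hs|hs] := pselect (smooth h); first exact: vw.
by rewrite (tangent_nonsmooth tv)// (tangent_nonsmooth tw).
Qed.

Hypothesis NC : smooth_closed N.

Lemma smooth_cst a : smooth (fun _ : N => a).
Proof.
have H : forall i : 'I_0, smooth ((fun (_ : 'I_0) (_ : N) => (0 : R)) i) by case.
exact: (NC H (smooth_on_cst setT a)).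
Qed.

Lemma smooth2 h k (T : 'rV[R]_2 -> R) : smooth h -> smooth k ->
  smooth_on setT T -> smooth (fun p => T (\row_i (if i == 0 then h p else k p))).
Proof.
move=> hs ks Ts.
have H (i : 'I_2) : smooth ((fun (i : 'I_2) p => if i == 0 then h p else k p) i).
  by case: (i == 0).
exact: (NC H Ts).
Qed.

Lemma smoothD h k : smooth h -> smooth k -> smooth (fun p => h p + k p).
Proof.
move=> hs ks.
have Ts : smooth_on setT (fun x : 'rV[R]_2 => x 0 0 + x 0 1).
  by apply: smooth_onD; [exact: openT|exact: smooth_on_coord..].
have := smooth2 hs ks Ts.
by under [X in smooth X -> _]eq_fun do rewrite !mxE/=.
Qed.

Lemma smoothM h k : smooth h -> smooth k -> smooth (fun p => h p * k p).
Proof.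
move=> hs ks.
have Ts : smooth_on setT (fun x : 'rV[R]_2 => x 0 0 * x 0 1).
  by apply: smooth_onM; [exact: openT|exact: smooth_on_coord..].
have := smooth2 hs ks Ts.
by under [X in smooth X -> _]eq_fun do rewrite !mxE/=.
Qed.

Lemma smoothZ (a : R) h : smooth h -> smooth (fun p => a * h p).
Proof. by move=> hs; apply: smoothM => //; exact: smooth_cst. Qed.

Lemma smoothN h : smooth h -> smooth (fun p => - h p).
Proof. by move=> hs; under eq_fun do rewrite -mulN1r; exact: smoothZ. Qed.

Lemma smoothB h k : smooth h -> smooth k -> smooth (fun p => h p - k p).
Proof. by move=> hs ks; apply: smoothD => //; exact: smoothN. Qed.

Lemma smooth_sum (I : Type) (s : seq I) (h : I -> N -> R) :
  (forall i, smooth (h i)) -> smooth (fun p => \sum_(i <- s) h i p).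
Proof.
move=> hs; elim: s => [|i s IH].
  by under eq_fun do rewrite big_nil; exact: smooth_cst.
by under eq_fun do rewrite big_cons; exact: smoothD.
Qed.

Section AtPoint.
Context {p : N} {v : vec N}.
Hypothesis tv : tangent p v.

Lemma tangent_cst a : v (fun=> a) = 0.
Proof.
have s1 := smooth_cst 1; have sa := smooth_cst a.
have H1 : v (fun=> 1) = 0.
  have := tangent_mul tv s1 s1.
  under [X in v X = _ -> _]eq_fun do rewrite mulr1.
  by rewrite mulr1 mul1r; lra.
have s0 := smooth_cst 0.
have H0 : v (fun=> 0) = 0.
  have := tangent_mul tv s0 s0.
  under [X in v X = _ -> _]eq_fun do rewrite mulr0.
  by rewrite mulr0 mul0r addr0.
have := tangent_lin a tv s1 s0.
under [X in v X = _ -> _]eq_fun do rewrite mulr1 addr0.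
by rewrite H1 H0 mulr0 addr0.
Qed.

Lemma tangentDf h k : smooth h -> smooth k -> v (fun x => h x + k x) = v h + v k.
Proof.
move=> hs ks; have := tangent_lin 1 tv hs ks.
by under [X in v X = _ -> _]eq_fun do rewrite mul1r; rewrite mul1r.
Qed.

Lemma tangentZf a h : smooth h -> v (fun x => a * h x) = a * v h.
Proof.
move=> hs; have := tangent_lin a tv hs (smooth_cst 0).
under [X in v X = _ -> _]eq_fun do rewrite addr0.
by rewrite tangent_cst addr0.
Qed.

Lemma tangentNf h : smooth h -> v (fun x => - h x) = - v h.
Proof.
by move=> hs; under eq_fun do rewrite -mulN1r; rewrite tangentZf// mulN1r.
Qed.

Lemma tangentBf h k : smooth h -> smooth k -> v (fun x => h x - k x) = v h - v k.
Proof. by move=> hs ks; rewrite tangentDf ?tangentNf//; exact: smoothN. Qed.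

Lemma tangent_sumf (I : Type) (s : seq I) (h : I -> N -> R) :
  (forall i, smooth (h i)) ->
  v (fun x => \sum_(i <- s) h i x) = \sum_(i <- s) v (h i).
Proof.
move=> hs; elim: s => [|i s IH].
  by under eq_fun do rewrite big_nil; rewrite big_nil tangent_cst.
under eq_fun do rewrite big_cons.
by rewrite big_cons tangentDf ?IH//; exact: smooth_sum.
Qed.

(* Hadamard's lemma makes a derivation obey the chain rule. *)
Lemma tangent_chain m (f : 'I_m -> N -> R) (T : 'rV[R]_m -> R) :
  (forall i, smooth (f i)) -> smooth_on setT T ->
  v (fun q => T (\row_i f i q)) =
  \sum_i 'D_(delta_mx 0 i) T (\row_i f i p) * v (f i).
Proof.
move=> fs Ts; pose x := \row_i f i p.
have [psi [psis [psix E]]] := Hadamard_lemma x Ts.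
under [X in v X]eq_fun => q do rewrite E.
have s2 i : smooth (fun q => f i q - f i p) by apply: smoothB => //; exact: smooth_cst.
have s3 i : smooth (fun q => psi i (\row_i f i q)) by exact: NC.
have s4 i : smooth (fun q => (f i q - f i p) * psi i (\row_i f i q)) by exact: smoothM.
under [X in v X]eq_fun => q.
  under eq_bigr do rewrite !mxE.
  over.
rewrite tangentDf; [|exact: smooth_cst|exact: smooth_sum].
rewrite tangent_cst add0r tangent_sumf//; apply: eq_bigr => i _.
(* The factor [f i q - f i p] vanishes at [p], so the derivative of [psi i] does not contribute. *)
rewrite (tangent_mul tv)// subrr mul0r addr0 tangentBf//; last exact: smooth_cst.
by rewrite tangent_cst subr0 psix mulrC.
Qed.

End AtPoint.

End Tangent.

(* [E i] is the i-th coordinate field times a cutoff and [f i] the i-th coordinate,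
   cut off further out.  As the last identity holds at every point [q], local
   computations become algebraic identities between global sections. *)
Record dual_basis (M : smooth_space R) (p : M) (m : nat) (rho : M -> R)
    (f : 'I_m -> M -> R) (E : 'I_m -> M -> vec M) : Prop := DualBasis {
  dual_basis_cutoff : smooth rho;
  dual_basis_cutoff1 : rho p = 1;
  dual_basis_flat : forall w, tangent p w -> w rho = 0;
  dual_basis_coord : forall i, smooth (f i);
  dual_basis_field : forall i, vector_field (E i);
  dual_basis_expand : forall q w, tangent q w ->
    rho q *: w = \sum_i w (f i) *: E i q }.

Definition has_dual_bases (M : smooth_space R) :=
  forall p : M, exists m rho f E, @dual_basis M p m rho f E.

Section DualBasis.
Context {M : smooth_space R} {p : M} {m : nat} {rho : M -> R}
  {f : 'I_m -> M -> R} {E : 'I_m -> M -> vec M}.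
Hypothesis B : @dual_basis M p m rho f E.

Lemma dual_basis_expand1 w : tangent p w -> w = \sum_i w (f i) *: E i p.
Proof.
by move=> tw; rewrite -(dual_basis_expand B tw) (dual_basis_cutoff1 B) scale1r.
Qed.

End DualBasis.

Section Along.
Context {N M : smooth_space R} {phi : N -> M}.
Hypotheses (NC : smooth_closed N) (MC : smooth_closed M).
Hypothesis phis : forall h, smooth h -> smooth (fun u => h (phi u)).
Implicit Types (h k : N -> R) (u : N) (v w : vec N) (s t : N -> vec M).

Lemma differentialE v (h : M -> R) : smooth h -> differential phi v h = v (fun u => h (phi u)).
Proof. by move=> hs; rewrite /differential asboolT. Qed.

Lemma differential_tangent u v : tangent u v -> tangent (phi u) (differential phi v).
Proof.
move=> tv; split=> [a h k hs ks|h k hs ks|h hs].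
- rewrite !differentialE//; first exact: (tangent_lin a tv (phis hs) (phis ks)).
  by apply: smoothD => //; exact: smoothZ.
- by rewrite !differentialE//; [exact: (tangent_mul tv (phis hs) (phis ks))|exact: smoothM].
- by rewrite /differential asboolF.
Qed.

Lemma differentialZD (a : R) v w :
  differential phi (a *: v + w : vec N) = a *: differential phi v + differential phi w.
Proof.
apply/funext => h; rewrite vecZDE /differential.
by case: ifP => _ //; rewrite mulr0 addr0.
Qed.

Lemma section_tangent s u : section_along phi s -> tangent (phi u) (s u).
Proof. by case=> + _; exact. Qed.

Lemma section_smooth s (h : M -> R) : section_along phi s -> smooth h ->
  smooth (fun u => s u h).
Proof. by case=> _ + hs; exact. Qed.

Lemma sectionD s t : section_along phi s -> section_along phi t ->
  section_along phi (fun u => s u + t u : vec M).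
Proof.
move=> ss st; split=> [u|h hs]; first by apply: tangentD; exact: section_tangent.
exact: (smoothD NC (section_smooth ss hs) (section_smooth st hs)).
Qed.

Lemma sectionZ h s : smooth h -> section_along phi s ->
  section_along phi (fun u => h u *: s u : vec M).
Proof.
move=> hs ss; split=> [u|k ks]; first by apply: tangentZ; exact: section_tangent.
exact: (smoothM NC hs (section_smooth ss ks)).
Qed.

Lemma section0 : section_along phi (fun=> 0 : vec M).
Proof. by split=> [u|h hs]; [exact: tangent0|exact: smooth_cst]. Qed.

Lemma section_sum (I : Type) (r : seq I) (s : I -> N -> vec M) :
  (forall i, section_along phi (s i)) ->
  section_along phi (fun u => \sum_(i <- r) s i u : vec M).
Proof.
move=> ss; elim: r => [|i r IH].
  by under eq_fun do rewrite big_nil; exact: section0.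
by under eq_fun do rewrite big_cons; exact: sectionD.
Qed.

Lemma sectionN s : section_along phi s -> section_along phi (fun u => - s u : vec M).
Proof.
move=> ss; under eq_fun do rewrite -scaleN1r.
by apply: (@sectionZ (fun=> -1)) => //; exact: smooth_cst.
Qed.

Lemma sectionB s t : section_along phi s -> section_along phi t ->
  section_along phi (fun u => s u - t u : vec M).
Proof. by move=> ss st; apply: sectionD => //; exact: sectionN. Qed.

Lemma section_pullback (X : M -> vec M) : vector_field X ->
  section_along phi (fun u => X (phi u)).
Proof.
move=> [X1 X2]; split=> [u|h hs]; first exact: X1.
exact: (phis (X2 _ hs)).
Qed.

Lemma section_differential (X : N -> vec N) : vector_field X ->
  section_along phi (fun u => differential phi (X u)).
Proof.
move=> [X1 X2]; split=> [u|h hs]; first exact: differential_tangent.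
by under eq_fun do rewrite differentialE//; apply: X2; exact: phis.
Qed.

(** An operator linear over functions at [u] is determined by its values on pulled-back fields, with
    no local sections involved. *)
Lemma tensorial_expand (W : lmodType R) u (T : (N -> vec M) -> W) m rho f E :
  @dual_basis M (phi u) m rho f E ->
  (forall s t, section_along phi s -> section_along phi t ->
    T (fun x => s x + t x) = T s + T t) ->
  (forall h s, smooth h -> section_along phi s ->
    T (fun x => h x *: s x) = h u *: T s) ->
  forall s, section_along phi s ->
    T s = \sum_i s u (f i) *: T (fun x => E i (phi x)).
Proof.
move=> B TD TZ s ss.
have T0 : T (fun=> 0) = 0.
  have := TZ (fun=> 0) _ (smooth_cst NC 0) section0.
  by under eq_fun do rewrite scaler0; rewrite scale0r.
have Tsum (I : Type) (r : seq I) (a : I -> N -> vec M) :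
    (forall i, section_along phi (a i)) ->
    T (fun x => \sum_(i <- r) a i x) = \sum_(i <- r) T (a i).
  move=> sa; elim: r => [|i r IH].
    by under eq_fun do rewrite big_nil; rewrite big_nil.
  under eq_fun do rewrite big_cons.
  by rewrite big_cons TD ?IH//; exact: section_sum.
have sE i : section_along phi (fun x => E i (phi x)).
  exact/section_pullback/(dual_basis_field B).
have ci i : smooth (fun x => s x (f i)) by exact: section_smooth (dual_basis_coord B i).
(* Multiplying by [rho] leaves the value of [T] unchanged and makes the section a global combination
   of the pulled-back [E i]. *)
have := TZ _ _ (phis (dual_basis_cutoff B)) ss.
rewrite (dual_basis_cutoff1 B) scale1r => <-.
under eq_fun => x do rewrite (dual_basis_expand B (section_tangent x ss)).
by rewrite Tsum => [|i]; [apply: eq_bigr => i _; exact: TZ|exact: sectionZ].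
Qed.

End Along.
End SmoothClosed.

(** * Torsion and curvature of a pull-back connection *)

Section Vec.
Context {R : realType} {M : smooth_space R}.
Implicit Types (v w : vec M).

Lemma vecDE v w h : (v + w : vec M) h = v h + w h. Proof. by []. Qed.
Lemma vecNE v h : (- v : vec M) h = - v h. Proof. by []. Qed.
Lemma vecZE (a : R) v h : (a *: v : vec M) h = a * v h. Proof. by []. Qed.
Lemma vec0E h : (0 : vec M) h = 0. Proof. by []. Qed.
Definition vecE := (vecDE, vecNE, vecZE, vec0E, @vec_sumE R M).

Hypothesis MC : smooth_closed M.
Implicit Types (X Y : M -> vec M).

Lemma bracket_tangent X Y p : vector_field X -> vector_field Y ->
  tangent p (bracket X Y p).
Proof.
move=> [X1 X2] [Y1 Y2]; split=> [a h k hs ks|h k hs ks|h hs].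
- rewrite /bracket.
  under [Z in X p Z]eq_fun => q do rewrite (tangent_lin a (Y1 q) hs ks).
  under [Z in Y p Z]eq_fun => q do rewrite (tangent_lin a (X1 q) hs ks).
  rewrite (tangent_lin a (X1 p) (Y2 h hs) (Y2 k ks)).
  rewrite (tangent_lin a (Y1 p) (X2 h hs) (X2 k ks)); ring.
- rewrite /bracket.
  under [Z in X p Z]eq_fun => q do rewrite (tangent_mul (Y1 q) hs ks).
  under [Z in Y p Z]eq_fun => q do rewrite (tangent_mul (X1 q) hs ks).
  rewrite (tangentDf (X1 p)) ?(tangentDf (Y1 p)); try by apply: smoothM => //; (exact: X2 || exact: Y2).
  rewrite !(tangent_mul (X1 p)) ?(tangent_mul (Y1 p)) //; try by (exact: X2 || exact: Y2).
  ring.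
- rewrite /bracket.
  under [Z in X p Z]eq_fun => q do rewrite (tangent_nonsmooth (Y1 q) hs).
  under [Z in Y p Z]eq_fun => q do rewrite (tangent_nonsmooth (X1 q) hs).
  by rewrite (tangent_cst MC (X1 p)) (tangent_cst MC (Y1 p)) subrr.
Qed.

Lemma field_smooth X h : vector_field X -> smooth h -> smooth (fun q => X q h).
Proof. by move=> [_ X2] hs; exact: X2. Qed.

Lemma field_tangent X p : vector_field X -> tangent p (X p).
Proof. by case. Qed.

End Vec.

Section Extension.
Context {R : realType} {M : smooth_space R}.
Hypotheses (MC : smooth_closed M) (MB : has_dual_bases M).
Implicit Types (p : M) (v w : vec M).

Lemma vector_field_through p v : tangent p v ->
  exists X, vector_field X /\ X p = v.
Proof.
move=> tv; have [m [rho [f [E B]]]] := MB p.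
exists (fun q => \sum_i v (f i) *: E i q); split; last first.
  by rewrite -(dual_basis_expand1 B).
apply: (section_sum MC) => i.
apply: (@sectionZ _ _ _ _ MC (fun=> v (f i))); first exact: smooth_cst.
exact: dual_basis_field B i.
Qed.

(** The default value of [xget] in [extension] is never reached at a tangent vector. *)
Lemma extensionP p v : tangent p v ->
  vector_field (extension p v) /\ extension p v p = v.
Proof.
move=> /vector_field_through[X XP]; rewrite /extension.
exact: (@xgetPex _ _ [set X | vector_field X /\ X p = v] (ex_intro _ X XP)).
Qed.

Lemma differential_id p v : tangent p v -> differential (fun q : M => q) v = v.
Proof.
move=> tv; apply: (@eq_tangent _ _ p) => //.
  by apply: differential_tangent => //.
by move=> h hs; rewrite differentialE.
Qed.

End Extension.

Section Connection.
Context {R : realType} {N M : smooth_space R} {phi : N -> M}.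
Hypotheses (NC : smooth_closed N) (MC : smooth_closed M).
Hypothesis phis : forall h, smooth h -> smooth (fun u => h (phi u)).
Context {nabla : N -> vec N -> (N -> vec M) -> vec M}.
Hypothesis nablaP : connection_along phi nabla.
Implicit Types (u : N) (v w : vec N) (s t : N -> vec M).

Lemma connection_tangent u v s : (exists2 X, vector_field X & X u = v) ->
  section_along phi s -> tangent (phi u) (nabla u v s).
Proof.
move=> [X fX <-] ss.
exact: (section_tangent u (connection_smooth nablaP fX ss)).
Qed.

Lemma connectionZ u v (a : R) s : tangent u v -> section_along phi s ->
  nabla u v (fun x => a *: s x) = a *: nabla u v s.
Proof.
move=> tv ss; have := connection_leibniz nablaP tv (smooth_cst NC a) ss.
by rewrite (tangent_cst NC tv) scale0r add0r.
Qed.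

Lemma connection0 u v : tangent u v -> nabla u v (fun=> 0) = 0.
Proof.
move=> tv; have := connectionZ 0 tv (@section0 _ _ _ phi NC).
by under eq_fun do rewrite scale0r; rewrite scale0r.
Qed.

Lemma connection_sum (I : Type) (r : seq I) u v (s : I -> N -> vec M) :
  tangent u v -> (forall i, section_along phi (s i)) ->
  nabla u v (fun x => \sum_(i <- r) s i x) = \sum_(i <- r) nabla u v (s i).
Proof.
move=> tv ss; elim: r => [|i r IH].
  by under eq_fun do rewrite big_nil; rewrite big_nil connection0.
under eq_fun do rewrite big_cons.
by rewrite big_cons (connection_additive nablaP)// ?IH//; exact: section_sum.
Qed.

Lemma connection_dir0 u s : section_along phi s -> nabla u 0 s = 0.
Proof.
move=> ss; have := connection_linear nablaP 1 (tangent0 u) (tangent0 u) ss.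
rewrite !scale1r addr0 => /eqP; rewrite -subr_eq0 opprD addrA subrr sub0r oppr_eq0.
by move/eqP.
Qed.

Lemma connection_dirZ u (a : R) v s : tangent u v -> section_along phi s ->
  nabla u (a *: v) s = a *: nabla u v s.
Proof.
move=> tv ss; have := connection_linear nablaP a tv (tangent0 u) ss.
by rewrite addr0 connection_dir0// addr0.
Qed.

Lemma connection_dir_sum (I : Type) (r : seq I) u (v : I -> vec N) s :
  (forall i, tangent u (v i)) -> section_along phi s ->
  nabla u (\sum_(i <- r) v i : vec N) s = \sum_(i <- r) nabla u (v i) s.
Proof.
move=> tv ss; elim: r => [|i r IH]; first by rewrite !big_nil connection_dir0.
rewrite !big_cons; have := connection_linear nablaP 1 (tv i) (tangent_sum r tv) ss.
by rewrite !scale1r IH.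
Qed.

Section InDualBasis.
Context {u : N} {m : nat} {rho : M -> R} {f : 'I_m -> M -> R} {E : 'I_m -> M -> vec M}.
Hypothesis B : @dual_basis R M (phi u) m rho f E.

(** Locality of the connection in the form needed: [rho] is 1 and has zero derivative at the base
    point, so the Leibniz rule leaves one term. *)
Lemma connection_cutoff v s : tangent u v -> section_along phi s ->
  nabla u v (fun x => rho (phi x) *: s x) = nabla u v s.
Proof.
move=> tv ss; have rs := dual_basis_cutoff B.
rewrite (connection_leibniz nablaP tv (phis rs) ss).
have -> : v (fun x => rho (phi x)) = 0.
  by rewrite -differentialE// (dual_basis_flat B)//; exact: differential_tangent.
by rewrite scale0r add0r (dual_basis_cutoff1 B) scale1r.
Qed.

Lemma connection_combination v (a : 'I_m -> N -> R) (F : 'I_m -> M -> vec M) :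
  tangent u v -> (forall i, smooth (a i)) -> (forall i, vector_field (F i)) ->
  nabla u v (fun x => \sum_i a i x *: F i (phi x)) =
  \sum_i (v (a i) *: F i (phi u) + a i u *: nabla u v (fun x => F i (phi x))).
Proof.
move=> tv sa fF; have sF i := section_pullback phis (fF i).
rewrite connection_sum//; last by move=> i; exact: sectionZ.
by apply: eq_bigr => i _; rewrite (connection_leibniz nablaP).
Qed.

End InDualBasis.
End Connection.

Section Pullback.
Context {R : realType} {M : smooth_space R}.
Context {D : M -> vec M -> (M -> vec M) -> vec M}.
Hypotheses (MC : smooth_closed M) (MB : has_dual_bases M).
Hypothesis DP : linear_connection D.

Section Map.
Context {N : smooth_space R} {phi : N -> M}.
Hypothesis NC : smooth_closed N.
Hypothesis phis : forall h, smooth h -> smooth (fun u => h (phi u)).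
Context {nabla : N -> vec N -> (N -> vec M) -> vec M}.
Hypothesis nablaP : connection_along phi nabla.
Hypothesis nablaD : forall X, vector_field X -> forall u v, tangent u v ->
  nabla u v (X \o phi) = D (phi u) (differential phi v) X.

Context {u : N} {m : nat} {rho : M -> R} {f : 'I_m -> M -> R} {E : 'I_m -> M -> vec M}.
Hypothesis B : @dual_basis R M (phi u) m rho f E.
Let fE i : vector_field (E i) := dual_basis_field B i.
Let fs i : smooth (f i) := dual_basis_coord B i.

(** The formula that determines the pull-back connection: cut off, expand in the pulled-back [E i],
    and apply the Leibniz rule. *)
Lemma pullback_expand v s : tangent u v -> section_along phi s ->
  nabla u v s = \sum_i (v (fun x => s x (f i)) *: E i (phi u) +
                        s u (f i) *: D (phi u) (differential phi v) (E i)).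
Proof.
move=> tv ss; rewrite -(connection_cutoff MC phis nablaP B tv ss).
under eq_fun => x do rewrite (dual_basis_expand B (section_tangent x ss)).
rewrite (@connection_combination _ _ _ _ NC phis _ nablaP _ _ v (fun i x => s x (f i)) E tv _ fE).
  by apply: eq_bigr => i _; rewrite -nablaD.
by move=> i; exact: (section_smooth ss (fs i)).
Qed.

(* Neither this form nor [curvature_form1] involves [phi] other than through the
   base point: comparing a map [phi] with the identity of [M] identifies them with
   the torsion and the curvature of [D]. *)
Definition torsion_form (v w : vec M) : vec M :=
  \sum_i (w (f i) *: D (phi u) v (E i) - v (f i) *: D (phi u) w (E i)).

(** In the first two terms the coefficients of [E i] contain
    [X (Y (f i \o phi)) - Y (X (f i \o phi))]. These are the coefficients of the bracket and cancel,
    leaving first-order data only. *)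
Lemma torsion_along_form (X Y : N -> vec N) : vector_field X -> vector_field Y ->
  nabla u (X u) (fun x => differential phi (Y x)) -
  nabla u (Y u) (fun x => differential phi (X x)) -
  differential phi (bracket X Y u) =
  torsion_form (differential phi (X u)) (differential phi (Y u)).
Proof.
move=> fX fY; have tX := field_tangent u fX; have tY := field_tangent u fY.
have sX := section_differential MC phis fX; have sY := section_differential MC phis fY.
have tb := bracket_tangent NC u fX fY.
rewrite (pullback_expand tX sY) (pullback_expand tY sX).
rewrite (dual_basis_expand1 B (differential_tangent MC phis tb)) /torsion_form.
rewrite -!sumrB; apply: eq_bigr => i _.
rewrite (differentialE (bracket X Y u) (fs i)) /bracket.
have E1 (Z : N -> vec N) : (fun x => differential phi (Z x) (f i)) = (fun x => Z x (fun y => f i (phi y))).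
  by apply/funext => x; rewrite differentialE.
rewrite !E1; apply/funext => h; rewrite !vecE; ring.
Qed.

Definition curvature_along (X Y : N -> vec N) (s : N -> vec M) (x : N) : vec M :=
  nabla x (X x) (fun y => nabla y (Y y) s) - nabla x (Y x) (fun y => nabla y (X y) s)
  - nabla x (bracket X Y x) s.

Definition curvature_form1 (v w : vec M) (F : M -> vec M) : vec M :=
  \sum_j (w (f j) *: D (phi u) v (fun q => D q (E j q) F) -
          v (f j) *: D (phi u) w (fun q => D q (E j q) F)).

(** The inner derivative of [F \o phi] becomes a combination of the pulled-back fields [D_(E j) F],
    to which the Leibniz rule applies again; second derivatives of [f j \o phi] cancel against the
    bracket. *)
Lemma curvature_along_pullback (X Y : N -> vec N) (F : M -> vec M) :
  vector_field X -> vector_field Y -> vector_field F ->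
  curvature_along X Y (fun x => F (phi x)) u =
  curvature_form1 (differential phi (X u)) (differential phi (Y u)) F.
Proof.
move=> fX fY fF; have sF := section_pullback phis fF.
have fG j : vector_field (fun q => D q (E j q) F) by exact: (connection_smooth DP).
have A (Z W : N -> vec N) : vector_field Z -> vector_field W ->
    nabla u (Z u) (fun y => nabla y (W y) (fun x => F (phi x))) =
    \sum_j (Z u (fun x => differential phi (W x) (f j)) *: D (phi u) (E j (phi u)) F +
      differential phi (W u) (f j) *: D (phi u) (differential phi (Z u)) (fun q => D q (E j q) F)).
  move=> fZ fW; have tZ := field_tangent u fZ.
  (* The cutoff makes the expansion of the inner derivative valid at all points and not only at
     [u]. *)
  rewrite -(connection_cutoff MC phis nablaP B tZ); last exact: (connection_smooth nablaP).
  have sW := section_differential MC phis fW.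
  have -> : (fun x => rho (phi x) *: nabla x (W x) (fun x => F (phi x))) =
      (fun x => \sum_j differential phi (W x) (f j) *: (fun q => D q (E j q) F) (phi x)).
    apply/funext => x; rewrite (nablaD fF (field_tangent x fW)).
    rewrite -(connection_dirZ DP _ (section_tangent x sW) fF).
    rewrite (dual_basis_expand B (section_tangent x sW)) (connection_dir_sum DP)//.
      by apply: eq_bigr => j _; rewrite (connection_dirZ DP)//; exact: field_tangent.
    by move=> j; apply: tangentZ; exact: field_tangent.
  rewrite (@connection_combination _ _ _ _ NC phis _ nablaP _ _ (Z u)
     (fun j x => differential phi (W x) (f j)) _ tZ _ fG).
    by apply: eq_bigr => j _; rewrite -nablaD.
  by move=> j; exact: (section_smooth sW (fs j)).
have tb := bracket_tangent NC u fX fY.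
have tdb := differential_tangent MC phis tb.
rewrite /curvature_along !A// nablaD// [X in D _ X F](dual_basis_expand1 B tdb).
rewrite (connection_dir_sum DP)//; last by move=> j; apply: tangentZ; exact: field_tangent.
rewrite -!sumrB; apply: eq_bigr => i _.
rewrite (connection_dirZ DP)//; last exact: field_tangent.
rewrite (differentialE (bracket X Y u) (fs i)) /bracket.
have E1 (Z : N -> vec N) : (fun x => differential phi (Z x) (f i)) = (fun x => Z x (fun y => f i (phi y))).
  by apply/funext => x; rewrite differentialE.
rewrite !E1; apply/funext => h; rewrite !vecE; ring.
Qed.

(** Curvature is linear over functions in [s], because the derivatives of a coefficient cancel, and
    so is fixed by pulled-back fields. *)
Lemma curvature_along_form (X Y : N -> vec N) s : vector_field X -> vector_field Y ->
  section_along phi s ->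
  curvature_along X Y s u =
  \sum_i s u (f i) *: curvature_form1 (differential phi (X u)) (differential phi (Y u)) (E i).
Proof.
move=> fX fY ss; have tX := field_tangent u fX; have tY := field_tangent u fY.
have tb := bracket_tangent NC u fX fY.
have sn (Z : N -> vec N) t : vector_field Z -> section_along phi t ->
    section_along phi (fun x => nabla x (Z x) t).
  by move=> fZ st; exact: (connection_smooth nablaP).
have nD (Z : N -> vec N) t t' : vector_field Z -> section_along phi t -> section_along phi t' ->
    (fun y => nabla y (Z y) (fun x => t x + t' x)) = (fun y => nabla y (Z y) t + nabla y (Z y) t').
  move=> fZ st st'; apply/funext => y; apply: (connection_additive nablaP) => //.
  exact: field_tangent.
have nZ (Z : N -> vec N) h t : vector_field Z -> smooth h -> section_along phi t ->
    (fun y => nabla y (Z y) (fun x => h x *: t x)) =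
    (fun y => Z y h *: t y + h y *: nabla y (Z y) t).
  move=> fZ hs st; apply/funext => y; apply: (connection_leibniz nablaP) => //.
  exact: field_tangent.
have H := @tensorial_expand _ _ _ phi NC phis (vec M) u (fun s => curvature_along X Y s u)
   m rho f E B.
rewrite H//.
- by apply: eq_bigr => i _; rewrite curvature_along_pullback.
- move=> t t' st st'; rewrite /curvature_along !nD// !(connection_additive nablaP)//; try exact: sn.
  by apply/funext => h; rewrite !vecE; ring.
- move=> k t ks st; rewrite /curvature_along !nZ//.
  have zs (Z : N -> vec N) : vector_field Z -> smooth (fun y => Z y k).
    by move=> fZ; exact: field_smooth.
  rewrite !(connection_additive nablaP)//; try (apply: sectionZ => //; (exact: zs || exact: sn)).
  rewrite !(connection_leibniz nablaP)//; try (exact: zs || exact: sn).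
  by apply/funext => h; rewrite /bracket !vecE; ring.
Qed.

End Map.
End Pullback.

(** * Comparison with the torsion and curvature tensors of D *)

Section PullbackTensors.
Context {R : realType} {N M : smooth_space R} {phi : N -> M}.
Context {D : M -> vec M -> (M -> vec M) -> vec M}.
Context {nabla : N -> vec N -> (N -> vec M) -> vec M}.
Hypotheses (NC : smooth_closed N) (MC : smooth_closed M) (MB : has_dual_bases M).
Hypothesis phis : forall h, smooth h -> smooth (fun u => h (phi u)).
Hypothesis DP : linear_connection D.
Hypothesis nablaP : connection_along phi nabla.
Hypothesis nablaD : forall X, vector_field X -> forall u v, tangent u v ->
  nabla u v (X \o phi) = D (phi u) (differential phi v) X.

(** D is its own pull-back along the identity of M, so the preceding forms also compute its torsion
    and curvature. *)
Let Did X : vector_field X -> forall p v, tangent p v ->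
  D p v (X \o id) = D p (differential (fun q : M => q) v) X.
Proof. by move=> _ p v tv; rewrite (differential_id MC tv). Qed.

(** Both sides are the same [torsion_form]: the left for [phi], the right for the identity of M and
    the extensions chosen by [torsion_at]. The choice of extensions thereby disappears. *)
Lemma torsion_along (X Y : N -> vec N) u : vector_field X -> vector_field Y ->
  nabla u (X u) (fun x => differential phi (Y x)) -
  nabla u (Y u) (fun x => differential phi (X x)) -
  differential phi (bracket X Y u) =
  torsion_at D (phi u) (differential phi (X u)) (differential phi (Y u)).
Proof.
move=> fX fY; have [m [rho [f [E B]]]] := MB (phi u).
have t (Z : N -> vec N) : vector_field Z -> tangent (phi u) (differential phi (Z u)).
  by move=> fZ; apply: differential_tangent => //; exact: field_tangent.
rewrite (torsion_along_form MC NC phis nablaP nablaD B fX fY).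
have [fv vE] := extensionP MC MB (t X fX).
have [fw wE] := extensionP MC MB (t Y fY).
rewrite /torsion_at /torsion; move: fv fw vE wE.
move: (extension _ _) (extension _ _) => W V fV fW VE WE.
(* The form for the identity map, at the base point [phi u] and in the same dual basis. *)
have := torsion_along_form MC MC (fun _ h => h) DP Did B fV fW.
have dE (Z : M -> vec M) : vector_field Z ->
    (fun x => differential (fun q : M => q) (Z x)) = Z.
  by move=> fZ; apply/funext => x; apply: (differential_id MC); exact: field_tangent.
rewrite (dE V fV) (dE W fW) (differential_id MC (bracket_tangent MC _ fV fW)) => ->.
rewrite (differential_id MC (field_tangent _ fV)) (differential_id MC (field_tangent _ fW)).
by rewrite VE WE.
Qed.

Lemma curvature_alongE (X Y : N -> vec N) s u : vector_field X -> vector_field Y ->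
  section_along phi s ->
  nabla u (X u) (fun y => nabla y (Y y) s) - nabla u (Y u) (fun y => nabla y (X y) s)
  - nabla u (bracket X Y u) s =
  curvature_at D (phi u) (differential phi (X u)) (differential phi (Y u)) (s u).
Proof.
move=> fX fY ss; have [m [rho [f [E B]]]] := MB (phi u).
have t (Z : N -> vec N) : vector_field Z -> tangent (phi u) (differential phi (Z u)).
  by move=> fZ; apply: differential_tangent => //; exact: field_tangent.
have := curvature_along_form MC DP NC phis nablaP nablaD B fX fY ss.
rewrite /curvature_along => ->.
have [fv vE] := extensionP MC MB (t X fX).
have [fw wE] := extensionP MC MB (t Y fY).
have [fz zE] := extensionP MC MB (section_tangent u ss).
rewrite /curvature_at /curvature; move: fv fw fz vE wE zE.
move: (extension _ _) (extension _ _) (extension _ _) => Z W V fV fW fZ VE WE ZE.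
have := curvature_along_form MC DP MC (fun _ h => h) DP Did B fV fW fZ.
rewrite /curvature_along => ->.
rewrite (differential_id MC (field_tangent _ fV)) (differential_id MC (field_tangent _ fW)).
by rewrite VE WE ZE.
Qed.

End PullbackTensors.

(** * Tangent vectors of a manifold *)

Section ExtendByZero.
Context {R : realType} {n : nat}.
Implicit Types (O : set 'rV[R]_n) (f w : 'rV[R]_n -> R).

(** Compact support in a one-ball version: the closed ball lies in [O], and its image in a Hausdorff
    manifold will be closed. *)
Definition supported_in O f := exists (x : 'rV[R]_n) (r : R),
  (forall y, `|y - x| <= r -> O y) /\ (forall y, r <= `|y - x| -> f y = 0).

Lemma supported_inM O f w : supported_in O w -> supported_in O (fun x => w x * f x).
Proof.
by move=> [x [r [rO w0]]]; exists x, r; split=> // y /w0 ->; rewrite mul0r.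
Qed.

Definition extend_by0 O f (x : 'rV[R]_n) : R := if `[< O x >] then f x else 0.

(** [O] and the exterior of the closed ball are open, cover the space, and the extension is smooth
    on each. *)
Lemma smooth_extend_by0 O f : open O -> smooth_on O f -> supported_in O f ->
  smooth_on setT (extend_by0 O f).
Proof.
move=> oO fs [x [r [rO f0]]]; apply: smooth_on_local => y _.
have [yr|ry] := leP `|y - x| r.
  exists O; first exact: rO.
  by apply: smooth_on_ext fs => // z Oz; rewrite /extend_by0 asboolT.
exists [set z | r < `|z - x|] => //.
have oW : open [set z : 'rV[R]_n | r < `|z - x|].
  have -> : [set z : 'rV[R]_n | r < `|z - x|] =
      (fun z : 'rV[R]_n => `|z - x|) @^-1` [set t | r < t] by [].
  apply: open_comp; last exact: open_gt.
  move=> z _; apply: (@continuous_comp _ _ _ (fun z : 'rV[R]_n => z - x) (fun z : 'rV[R]_n => `|z|)).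
    exact: (continuousB (@cvg_id _ _) (@cst_continuous _ _ x z)).
  exact: norm_continuous.
apply: (@smooth_on_ext _ _ _ (fun=> 0)) => //; last exact: smooth_on_cst.
by move=> z /ltW rz; rewrite /extend_by0 f0// if_same.
Qed.

End ExtendByZero.

Section Manifold.
Context {R : realType} {n : nat} {M : manifold R n}.
Local Notation T := (manifold_top M).
Local Notation e i := (delta_mx 0 i : 'rV[R]_n).
Implicit Types (c : chart R n T) (p q : T) (x y : 'rV[R]_n) (f : 'rV[R]_n -> R).

Lemma chart_img_inv c x : chart_img c x ->
  chart_dom c (chart_inv c x) /\ chart_map c (chart_inv c x) = x.
Proof. by move=> [p cp <-]; rewrite chart_mapK. Qed.

Lemma chart_img_map c p : chart_dom c p -> chart_img c (chart_map c p).
Proof. by move=> cp; exists p. Qed.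

Lemma near_chart_inv c x (V : set T) : chart_img c x ->
  (\forall q \near chart_inv c x, V q) -> \forall y \near x, V (chart_inv c y).
Proof. by move=> cx; exact: (chart_inv_cont cx). Qed.

Lemma near_chart_map c p (V : set 'rV[R]_n) : chart_dom c p ->
  (\forall y \near chart_map c p, V y) -> \forall q \near p, V (chart_map c q).
Proof. by move=> cp; exact: (chart_map_cont cp). Qed.

Lemma near_chart_dom c p : chart_dom c p -> \forall q \near p, chart_dom c q.
Proof. by move=> cp; exact: (open_nbhs_nbhs (conj (chart_dom_open c) cp)). Qed.

Lemma near_chart_img c x : chart_img c x -> \forall y \near x, chart_img c y.
Proof.
move=> cx; have o : open (chart_img c) by exact: chart_img_open.
exact: (open_nbhs_nbhs (conj o cx)).
Qed.

Lemma near_open (U : topologicalType) (x : U) (P : set U) : (\forall y \near x, P y) ->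
  exists W : set U, [/\ open W, W x & forall z, W z -> P z].
Proof.
move=> H; have : nbhs x P by [].
by rewrite nbhsE => -[W [oW Wx] WP]; exists W.
Qed.

Lemma smooth_closed_manifold : smooth_closed M.
Proof.
move=> m f F fs Fs c cA.
apply: (@smooth_on_comp _ _ _ setT (chart_img c) (fun x => \row_i f i (chart_inv c x))) => //.
- exact: openT.
- exact: chart_img_open.
- by move=> j; under eq_fun do rewrite mxE; exact: fs.
Qed.

Definition chart_extend c f (p : T) : R :=
  if `[< chart_dom c p >] then f (chart_map c p) else 0.

Lemma chart_extendE c f p : chart_dom c p -> chart_extend c f p = f (chart_map c p).
Proof. by move=> cp; rewrite /chart_extend asboolT. Qed.

(** On the overlap with [c] the transition map is smooth. Elsewhere the Hausdorff property enters:
    the image of the closed ball is compact, hence closed, and the function vanishes on its open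
    complement. *)
Lemma smooth_chart_extend c f : atlas c -> smooth_on (chart_img c) f ->
  supported_in (chart_img c) f -> @smooth R M (chart_extend c f).
Proof.
move=> cA fs [x0 [r [rO f0]]] c' cA'.
apply: smooth_on_local => x' c'x; pose p := chart_inv c' x'.
have [cp|cp] := pselect (chart_dom c p).
  pose W := [set y | chart_img c' y /\ chart_dom c (chart_inv c' y)].
  have oW : open W.
    rewrite openE => y [y1 y2]; rewrite /interior.
    exact: filterI (near_chart_img y1) (near_chart_inv y1 (near_chart_dom y2)).
  exists W => //.
  have WE : W `<=` chart_map c' @` (chart_dom c' `&` chart_dom c).
    move=> y [/chart_img_inv[y1 y2] y3]; exists (chart_inv c' y) => //.
  apply: (@smooth_on_ext _ _ _ (fun y => f (chart_map c (chart_inv c' y)))) => //.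
    by move=> y [_ cy]; rewrite /= chart_extendE.
  apply: (@smooth_on_comp _ _ _ (chart_img c) W (fun y => chart_map c (chart_inv c' y))) => //.
  - exact: chart_img_open.
  - by move=> y [_ /chart_img_map].
  - by move=> j; apply: smooth_on_sub WE _; exact: (atlas_smooth cA' cA).
pose Z := chart_inv c @` [set y | `|y - x0| <= r].
have cZ : closed Z.
  apply: compact_closed; first exact: manifold_hausdorff.
  apply: continuous_compact.
    apply: continuous_in_subspaceT => y; rewrite inE => /rO cy.
    exact: chart_inv_cont.
  apply: bounded_closed_compact.
    exists (`|x0| + r); split; first exact: num_real.
    move=> t rt y /= yr; apply: ltW; apply: le_lt_trans rt.
    by rewrite -[y](subrK x0) addrC (le_trans (ler_normD _ _))// lerD2l.
  have -> : [set y : 'rV[R]_n | `|y - x0| <= r] =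
      (fun y : 'rV[R]_n => `|y - x0|) @^-1` [set t | t <= r] by [].
  apply: closed_comp; last exact: closed_le.
  move=> y _; apply: (@continuous_comp _ _ _ (fun z : 'rV[R]_n => z - x0) (fun z : 'rV[R]_n => `|z|)).
    exact: (continuousB (@cvg_id _ _) (@cst_continuous _ _ x0 y)).
  exact: norm_continuous.
have pZ : ~ Z p by move=> [y /rO /chart_img_inv[cy _] yp]; apply: cp; rewrite -yp.
have Z0 q : ~ Z q -> chart_extend c f q = 0.
  move=> qZ; rewrite /chart_extend; case: asboolP => // cq; apply: f0.
  rewrite leNgt; apply/negP => /ltW H; apply: qZ; exists (chart_map c q) => //.
  exact: chart_mapK.
have : \forall y \near x', chart_img c' y /\ ~ Z (chart_inv c' y).
  apply: filterI; first exact: near_chart_img.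
  exact: (@near_chart_inv c' x' (~` Z) c'x (open_nbhs_nbhs (conj (closed_openC cZ) pZ))).
move=> /near_open[W [oW Wx WZ]]; exists W => //.
apply: (@smooth_on_ext _ _ _ (fun=> 0)) => //; last exact: smooth_on_cst.
by move=> y /WZ[_ /Z0].
Qed.

Lemma manifold_bump p (V : set T) : (\forall q \near p, V q) ->
  exists s : T -> R, [/\ @smooth R M s, forall q, s q != 0 -> V q
    & \forall q \near p, s q = 1].
Proof.
move=> Vp; have [c cA cp] := atlas_cover p.
have H : \forall y \near chart_map c p, chart_img c y /\ V (chart_inv c y).
  apply: filterI; first exact/near_chart_img/chart_img_map.
  by apply: near_chart_inv; [exact: chart_img_map|rewrite chart_mapK].
have [w [r [r0 ws wV w0 w1]]] := exists_bump H.
exists (chart_extend c w); split.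
- apply: smooth_chart_extend => //; first exact: smooth_on_sub ws.
  by exists (chart_map c p), r; split=> // y /wV[].
- move=> q; rewrite /chart_extend; case: asboolP => [cq wq|]; last by rewrite eqxx.
  have /wV[_] : `|chart_map c q - chart_map c p| <= r.
    rewrite leNgt; apply/negP => /ltW /w0 E; move: wq; by rewrite E eqxx.
  by rewrite chart_mapK.
- apply: filterS2 (near_chart_dom cp) (near_chart_map cp w1) => q cq.
  by rewrite chart_extendE.
Qed.

(** With a bump [s] supported where [h = k], the products [s * h] and [s * k] coincide globally; the
    product rule then compares [v h] and [v k]. *)
Lemma tangent_local p (v : vec M) (h k : M -> R) : @tangent R M p v ->
  smooth h -> smooth k -> (\forall q \near p, h q = k q) -> v h = v k.
Proof.
move=> tv hs ks hk; have [s [ss sV s1]] := manifold_bump hk.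
have sp : s p = 1 by exact: nbhs_singleton s1.
have E : (fun q => s q * h q) = (fun q => s q * k q).
  apply/funext => q; have [->|/sV ->//] := eqVneq (s q) 0; by rewrite !mul0r.
have := tangent_mul tv ss hs; rewrite E (tangent_mul tv ss ks).
by rewrite sp (nbhs_singleton hk) !mul1r => /addrI.
Qed.

Lemma smooth_chart_C1 c x (h : T -> R) : atlas c -> chart_img c x -> @smooth R M h ->
  C1_near (h \o chart_inv c) x.
Proof. by move=> cA cx hs; apply: smooth_on_C1 cx (hs c cA); exact: chart_img_open. Qed.

Lemma chart_vectorE c x a (h : M -> R) : atlas c -> chart_img c x -> smooth h ->
  chart_vector c x a h = \sum_i a 0 i * 'D_(e i) (h \o chart_inv c) x.
Proof.
move=> cA cx hs; rewrite /chart_vector asboolT//.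
exact: (@derive_val _ _ _ _ _ _ _ (is_derive_dir a (smooth_chart_C1 cA cx hs))).
Qed.

Lemma chart_vector_tangent c x a : atlas c -> chart_img c x ->
  @tangent R M (chart_inv c x) (chart_vector c x a).
Proof.
move=> cA cx.
have d (h : M -> R) : smooth h -> derivable (h \o chart_inv c) x a.
  move=> hs; exact: (@ex_derive _ _ _ _ _ _ _ (is_derive_dir a (smooth_chart_C1 cA cx hs))).
split=> [b h k hs ks|h k hs ks|h hs]; last by rewrite /chart_vector asboolF.
- rewrite /chart_vector !asboolT//; last first.
    apply: smoothD => //; [exact: smooth_closed_manifold|].
    by apply: smoothZ => //; exact: smooth_closed_manifold.
  have db : derivable (b *: (h \o chart_inv c)) x a by exact/derivableZ/d.
  by have := deriveD db (d k ks); rewrite deriveZ; [move=> <-|exact: d].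
- rewrite /chart_vector !asboolT//; last first.
    by apply: smoothM => //; exact: smooth_closed_manifold.
  by have := deriveM (d h hs) (d k ks) => /= ->; rewrite addrC; congr (_ + _); rewrite mulrC.
Qed.

Lemma chart_vector_sum c x a : atlas c -> chart_img c x ->
  (chart_vector c x a : vec M) = \sum_i a 0 i *: (chart_vector c x (e i) : vec M).
Proof.
move=> cA cx; apply: (@eq_tangent _ M (chart_inv c x)).
- exact: chart_vector_tangent.
- by apply: tangent_sum => i; apply: tangentZ; exact: chart_vector_tangent.
move=> h hs; rewrite vec_sumE chart_vectorE//; apply: eq_bigr => i _.
by rewrite vecZE /chart_vector asboolT.
Qed.

(** Chart coordinates are not functions on all of M, and derivations act on global ones only; these
    are global substitutes agreeing with the coordinates near [q]. *)
Definition local_coords c (f : 'I_n -> M -> R) q :=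
  (forall i, smooth (f i)) /\
  \forall q' \near q, forall i, f i q' = chart_map c q' 0 i.

(** Near [q] a smooth [h] equals [F] of the global coordinates, with [F] its cut-off coordinate
    expression; [tangent_chain] then computes [w h]. *)
Lemma tangent_coords c q (f : 'I_n -> M -> R) (w : vec M) : atlas c -> chart_dom c q ->
  local_coords c f q -> @tangent R M q w ->
  w = chart_vector c (chart_map c q) (\row_i w (f i)).
Proof.
move=> cA cq [fs fc] tw; pose x := chart_map c q.
have cx : chart_img c x by exact: chart_img_map.
apply: (@eq_tangent _ M q) => //.
  by have := chart_vector_tangent (\row_i w (f i)) cA cx; rewrite chart_mapK.
move=> h hs; have [b [r [r0 bs bO b0 b1]]] := exists_bump (near_chart_img cx).
pose F := extend_by0 (chart_img c) (fun y => b y * h (chart_inv c y)).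
have oI : open (chart_img c) by exact: chart_img_open.
have Fs : smooth_on setT F.
  apply: smooth_extend_by0 => //; last by apply: supported_inM; exists x, r.
  by apply: smooth_onM => //; [exact: smooth_on_sub bs|exact: hs].
have rE q' : (forall i, f i q' = chart_map c q' 0 i) -> \row_i f i q' = chart_map c q'.
  by move=> H; apply/rowP => i; rewrite mxE.
have FE : \forall y \near x, F y = h (chart_inv c y).
  apply: filterS2 (near_chart_img cx) b1 => y cy by1.
  by rewrite /F /extend_by0 asboolT// by1 mul1r.
have HE : \forall q' \near q, h q' = F (\row_i f i q').
  apply: filterS3 (near_chart_dom cq) fc (near_chart_map cq FE) => q' cq' fq' Fq'.
  by rewrite rE// Fq' chart_mapK.
have Hs : @smooth R M (fun q => F (\row_i f i q)).
  exact: (smooth_closed_manifold fs Fs).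
rewrite (tangent_local tw hs Hs HE) (tangent_chain smooth_closed_manifold tw fs Fs).
rewrite chart_vectorE//; apply: eq_bigr => i _; rewrite !mxE mulrC; congr (_ * _).
rewrite rE; last exact: (nbhs_singleton fc).
exact: (@near_eq_derive _ _ _ F (h \o chart_inv c) x (e i) FE).
Qed.

Lemma chart_vector_coord c x a (f : 'I_n -> M -> R) i : atlas c -> chart_img c x ->
  local_coords c f (chart_inv c x) -> chart_vector c x a (f i : M -> R) = a 0 i.
Proof.
move=> cA cx [fs fc]; rewrite /chart_vector asboolT//.
rewrite (@near_eq_derive _ _ _ _ (fun y : 'rV[R]_n => y 0 i)).
  exact: (@derive_val _ _ _ _ _ _ _ (derive_coord x a i)).
apply: filterS2 (near_chart_img cx) (near_chart_inv cx fc) => y cy /= ->.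
by rewrite (chart_img_inv cy).2.
Qed.

(** One choice of data serves all points near [p], as smoothness and differentiability arguments
    compare neighbouring points. *)
Lemma chart_frame c p : atlas c -> chart_dom c p ->
  exists (rho : M -> R) (f : 'I_n -> M -> R) (E : 'I_n -> M -> vec M),
  (\forall q \near p, @dual_basis R M q n rho f E) /\
  (forall q, rho q != 0 -> chart_dom c q /\ local_coords c f q).
Proof.
move=> cA cp; pose x0 := chart_map c p.
have cx0 : chart_img c x0 by exact: chart_img_map.
have oI : open (chart_img c) by exact: chart_img_open.
have [w1 [r1 [r10 w1s w1O w10 w11]]] := exists_bump (near_chart_img cx0).
have [W [oW Wx0 W1]] := near_open w11.
have H : \forall y \near x0, chart_img c y /\ W y.
  by apply: filterI; [exact: near_chart_img|exact: (open_nbhs_nbhs (conj oW Wx0))].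
(* Nested bumps: [w2] is supported in the open set [W] where [w1] is 1, so around every point with
   [rho q != 0] the functions [f i] are the true coordinates. *)
have [w2 [r2 [r20 w2s w2O w20 w21]]] := exists_bump H.
have sup1 : supported_in (chart_img c) w1 by exists x0, r1.
have sup2 : supported_in (chart_img c) w2 by exists x0, r2; split => // y /w2O[].
pose f i := chart_extend c (fun y => w1 y * y 0 i).
pose rho := chart_extend c w2.
pose E i q := rho q *: (chart_vector c (chart_map c q) (e i) : vec M).
have fs i : @smooth R M (f i).
  apply: smooth_chart_extend => //; last exact: supported_inM.
  by apply: smooth_onM => //; [exact: smooth_on_sub w1s|exact: smooth_on_coord].
have rhos : @smooth R M rho.
  by apply: smooth_chart_extend => //; exact: smooth_on_sub w2s.
have rho1 : \forall q \near p, rho q = 1.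
  apply: filterS2 (near_chart_dom cp) (near_chart_map cp w21) => q cq.
  by rewrite /rho chart_extendE.
have rhoP q : rho q != 0 -> chart_dom c q /\ local_coords c f q.
  rewrite /rho /chart_extend; case: asboolP => [cq wq|]; last by rewrite eqxx.
  split=> //; split=> //.
  have [] : chart_img c (chart_map c q) /\ W (chart_map c q).
    apply: w2O; rewrite leNgt; apply/negP => /ltW /w20 K.
    by move: wq; rewrite K eqxx.
  move=> _ Wq.
  have K := near_chart_map cq (open_nbhs_nbhs (conj oW Wq)).
  apply: filterS2 (near_chart_dom cq) K => q' cq' /W1 w1q' i.
  by rewrite /f chart_extendE// w1q' mul1r.
have tE i q : @tangent R M q (E i q).
  have [E0|/rhoP[cq _]] := eqVneq (rho q) 0.
    by rewrite /E E0 scale0r; exact: tangent0.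
  apply: tangentZ; have := chart_vector_tangent (e i) cA (chart_img_map cq).
  by rewrite chart_mapK.
exists rho, f, E; split => //.
have [W' [oW' W'p rhoW']] := near_open rho1.
apply: filterS (open_nbhs_nbhs (conj oW' W'p)) => q0 W'q0.
have {}rho1 : \forall q \near q0, rho q = 1.
  by apply: filterS (open_nbhs_nbhs (conj oW' W'q0)) => q /rhoW'.
split => //.
- exact: nbhs_singleton rho1.
- move=> v tv; have H1 := smooth_cst smooth_closed_manifold 1.
  by rewrite (tangent_local tv rhos H1 rho1) (tangent_cst smooth_closed_manifold tv).
- move=> i; split=> [q|h hs]; first exact: tE.
  have -> : (fun q => E i q h) = chart_extend c (fun y => w2 y * 'D_(e i) (h \o chart_inv c) y).
    apply/funext => q; rewrite /E vecZE /rho /chart_extend.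
    by case: asboolP => cq; rewrite ?mul0r//; congr (_ * _); rewrite /chart_vector asboolT.
  apply: smooth_chart_extend => //; last exact: supported_inM.
  apply: smooth_onM => //; first exact: smooth_on_sub w2s.
  by apply: (@smooth_on_partial _ _ _ (h \o chart_inv c)); exact: hs.
(* Where [rho] vanishes so does [E i], by its factor [rho], and both sides are 0. *)
- move=> q v tv; have [E0|/rhoP[cq fc]] := eqVneq (rho q) 0.
    rewrite E0 scale0r big1// => i _; by rewrite /E E0 scale0r scaler0.
  rewrite {1}(tangent_coords cA cq fc tv) chart_vector_sum//; last exact: chart_img_map.
  rewrite scaler_sumr; apply: eq_bigr => i _; rewrite mxE /E !scalerA mulrC//.
Qed.

Lemma manifold_dual_bases : has_dual_bases M.
Proof.
move=> p; have [c cA cp] := atlas_cover (p : T).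
have [rho [f [E [B _]]]] := chart_frame cA cp.
by exists n, rho, f, E; exact: nbhs_singleton B.
Qed.

End Manifold.

(** * Tangent vectors of the sphere bundle *)

(* [proj] alone is a projection of a product topology. *)
Local Notation proj := Defs.proj.

Section Sphere.
Context {R : realType} {n : nat} {M : manifold R n}.
Context {g : M -> vec M -> vec M -> R}.
Local Notation T := (manifold_top M).
Local Notation N := (SM g).
Local Notation e i := (delta_mx 0 i).
Implicit Types (c : chart R n T) (u : N) (v : vec N) (F : N -> R).

Let MC : smooth_closed M := smooth_closed_manifold.

Lemma smooth_closed_sphere : smooth_closed N.
Proof.
move=> m f F fs Fs c x0 a0 u0 cA cx0 su0.
have /choice[/= W /choice[/= Phi WP]] : forall i, exists W Phi,
    [/\ open W, W (row_mx x0 a0), smooth_on W Phi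
      & forall (x a : 'rV[R]_n) u, chart_img c x -> W (row_mx x a) ->
          sval u = (chart_inv c x, chart_vector c x a) -> f i u = Phi (row_mx x a)].
  move=> i; have [W [Phi WP]] := fs i c x0 a0 u0 cA cx0 su0.
  by exists W, Phi.
have : \forall y \near row_mx x0 a0, forall i, W i y.
  apply: (@filter_forall _ _ W (nbhs (row_mx x0 a0))) => i.
  by have [oW Wz _ _] := WP i; exact: (open_nbhs_nbhs (conj oW Wz)).
move=> /near_open[V [oV Vz VW]].
exists V, (fun y => F (\row_i Phi i y)); split => //.
  apply: (@smooth_on_comp _ _ _ setT V (fun y => \row_i Phi i y)) => //; first exact: openT.
  move=> j; under eq_fun do rewrite mxE.
  by apply: (@smooth_on_sub _ _ (W j)) => [y /VW|]; [exact|have [] := WP j].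
move=> x a u cx Vy su; congr F; apply/rowP => i; rewrite !mxE.
by have [_ _ _] := WP i; apply => //; exact: VW.
Qed.
Let NC : smooth_closed N := smooth_closed_sphere.

Lemma smooth_on_lsubmx (W : set 'rV[R]_(n + n)) i :
  smooth_on W (fun y => lsubmx y 0 i).
Proof. by under eq_fun do rewrite mxE; exact: smooth_on_coord. Qed.

Lemma smooth_on_rsubmx (W : set 'rV[R]_(n + n)) i :
  smooth_on W (fun y => rsubmx y 0 i).
Proof. by under eq_fun do rewrite mxE; exact: smooth_on_coord. Qed.

Lemma continuous_lsubmx : continuous (fun y : 'rV[R]_(n + n) => lsubmx y).
Proof.
move=> y; apply: continuous_rV => i.
by apply: (@smooth_on_continuous _ _ setT) => //; exact: smooth_on_lsubmx.
Qed.

Lemma near_lsubmx (z : 'rV[R]_(n + n)) (V : set 'rV[R]_n) :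
  (\forall x \near lsubmx z, V x) -> \forall y \near z, V (lsubmx y).
Proof. exact: continuous_lsubmx. Qed.

Lemma open_lsubmx (V : set 'rV[R]_n) : open V ->
  open [set y : 'rV[R]_(n + n) | V (lsubmx y)].
Proof.
move=> oV; rewrite openE => y Vy.
exact: (@near_lsubmx y V (open_nbhs_nbhs (conj oV Vy))).
Qed.

Lemma smooth_on_fiber c (h : M -> R) : atlas c -> smooth h ->
  smooth_on [set y : 'rV[R]_(n + n) | chart_img c (lsubmx y)]
    (fun y => h (chart_inv c (lsubmx y))).
Proof.
move=> cA hs; have oI : open (chart_img c) by exact: chart_img_open.
apply: (@smooth_on_comp _ _ _ (chart_img c) _ (fun y => lsubmx y) (h \o chart_inv c)) => //.
- exact: open_lsubmx.
- by move=> j; exact: smooth_on_lsubmx.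
- exact: hs.
Qed.

Lemma smooth_proj (h : M -> R) : smooth h -> smooth (fun u : N => h (proj u)).
Proof.
move=> hs c x0 a0 u0 cA cx0 su0.
have oI : open (chart_img c) by exact: chart_img_open.
exists [set y : 'rV[R]_(n + n) | chart_img c (lsubmx y)], (fun y => h (chart_inv c (lsubmx y))).
split; [exact: open_lsubmx|by rewrite /= row_mxKl|exact: smooth_on_fiber|].
by move=> x a u cx _ su; rewrite row_mxKl /proj su.
Qed.

Lemma tautological_tangent u : tangent (proj u) (tautological u).
Proof. by have [] := svalP u. Qed.

Lemma tautological_unit u : g (proj u) (tautological u) (tautological u) = 1.
Proof. by have [] := svalP u. Qed.

Lemma section_tautological : section_along (@proj R n M g) (@tautological R n M g).
Proof.
split=> [u|h hs]; first exact: tautological_tangent.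
move=> c x0 a0 u0 cA cx0 su0.
have oI : open (chart_img c) by exact: chart_img_open.
exists [set y : 'rV[R]_(n + n) | chart_img c (lsubmx y)],
  (fun y => \sum_i rsubmx y 0 i * 'D_(e i) (h \o chart_inv c) (lsubmx y)).
split; [exact: open_lsubmx|by rewrite /= row_mxKl| |].
  apply: smooth_on_sum => [|i]; first exact: open_lsubmx.
  apply: smooth_onM; [exact: open_lsubmx|exact: smooth_on_rsubmx|].
  apply: (@smooth_on_comp _ _ _ (chart_img c) _ (fun y => lsubmx y)
    (fun x => 'D_(e i) (h \o chart_inv c) x)) => //.
  - exact: open_lsubmx.
  - by move=> j; exact: smooth_on_lsubmx.
  - by apply: smooth_on_partial; exact: hs.
by move=> x a u cx _ su; rewrite row_mxKl row_mxKr /tautological su /= chart_vectorE.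
Qed.

(** Smoothness on SM is local over the base: neighbourhoods are taken in M and [Q] is globally
    smooth. *)
Lemma sphere_smooth_local F :
  (forall u0, exists Q (V : set T), [/\ smooth Q, \forall q \near (proj u0 : T), V q
    & forall u, V (proj u) -> F u = Q u]) -> smooth F.
Proof.
move=> H c x0 a0 u0 cA cx0 su0.
have [Q [V [Qs Vu FQ]]] := H u0.
have [W [Phi [oW Wz Phis QP]]] := Qs c x0 a0 u0 cA cx0 su0.
have p0 : proj u0 = chart_inv c x0 by rewrite /proj su0.
rewrite p0 in Vu.
have : \forall y \near row_mx x0 a0, W y /\ V (chart_inv c (lsubmx y)).
  apply: filterI; first exact: (open_nbhs_nbhs (conj oW Wz)).
  by apply: (@near_lsubmx _ (fun x => V (chart_inv c x))); rewrite row_mxKl; exact: near_chart_inv.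
move=> /near_open[W' [oW' W'z W'W]]; exists W', Phi; split => //.
  by apply: smooth_on_sub Phis => y /W'W[].
move=> x a u cx /W'W[Wy]; rewrite row_mxKl => Vx su.
rewrite FQ; first exact: QP.
by rewrite /proj su.
Qed.

Section FiberCoords.
Context {f : 'I_n -> M -> R}.
Hypothesis fs : forall i, smooth (f i).

(** The bundle coordinates (x, a) of TM as global functions on SM; they are the actual ones over
    points where [local_coords] holds. *)
Definition fiber_coord (k : 'I_(n + n)) u : R :=
  match fintype.split k with
  | inl i => f i (proj u)
  | inr i => tautological u (f i)
  end.

Lemma smooth_fiber_coord k : smooth (fiber_coord k).
Proof.
rewrite /fiber_coord; case: (fintype.split k) => i; first exact: smooth_proj.
exact: (section_smooth section_tautological).
Qed.

Lemma fiber_coordE u : \row_k fiber_coord k u =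
  row_mx (\row_i f i (proj u)) (\row_i tautological u (f i)).
Proof.
by apply/rowP => k; rewrite !mxE /fiber_coord; case: (fintype.split k) => i; rewrite mxE.
Qed.

Lemma fiber_coord_chart c x a u : atlas c -> chart_img c x ->
  sval u = (chart_inv c x, chart_vector c x a) -> local_coords c f (chart_inv c x) ->
  \row_k fiber_coord k u = row_mx x a.
Proof.
move=> cA cx su fc; rewrite fiber_coordE /proj /tautological su /=; congr row_mx.
  apply/rowP => i; rewrite mxE (nbhs_singleton fc.2).
  by rewrite (chart_img_inv cx).2.
by apply/rowP => i; rewrite mxE; exact: chart_vector_coord.
Qed.

Lemma chart_fiber_coord c u : atlas c -> chart_dom c (proj u) ->
  local_coords c f (proj u) ->
  exists x a, [/\ chart_img c x, sval u = (chart_inv c x, chart_vector c x a) &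
    \row_k fiber_coord k u = row_mx x a].
Proof.
move=> cA cu fc; exists (chart_map c (proj u)), (\row_i tautological u (f i)).
have su : sval u = (chart_inv c (chart_map c (proj u)),
    chart_vector c (chart_map c (proj u)) (\row_i tautological u (f i))).
  rewrite chart_mapK// -(tangent_coords cA cu fc (tautological_tangent u)).
  by rewrite /proj /tautological; case: (sval u).
split=> //; first exact: chart_img_map.
apply: (fiber_coord_chart cA _ su); first exact: chart_img_map.
by rewrite chart_mapK.
Qed.

(** The chain rule for a function known in coordinates only over [rho != 0] and inside [W]; two
    cutoffs make the coordinate expression global. *)
Lemma tangent_fiber_coords c (rho : M -> R) F (W : set 'rV[R]_(n + n)) Phi u v :
  smooth rho -> smooth F -> open W -> smooth_on W Phi ->
  (forall u, rho (proj u) != 0 -> W (\row_k fiber_coord k u) ->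
    F u = Phi (\row_k fiber_coord k u)) ->
  tangent u v -> rho (proj u) != 0 -> W (\row_k fiber_coord k u) ->
  v F = \sum_k 'D_(e k) Phi (\row_k fiber_coord k u) * v (fiber_coord k).
Proof.
move=> rhos Fs oW Ps FP tv rhou Wu; set z := \row_k fiber_coord k u.
have [w [r [r0 ws wW w0 w1]]] := exists_bump (open_nbhs_nbhs (conj oW Wu)).
pose Q := extend_by0 W (fun y => w y * Phi y).
have Qs : smooth_on setT Q.
  apply: smooth_extend_by0 => //; last by apply: supported_inM; exists z, r.
  by apply: smooth_onM => //; exact: smooth_on_sub ws.
have rs := smooth_proj rhos.
have cs := smooth_fiber_coord.
have wcs : smooth (fun u => w (\row_k fiber_coord k u)) by exact: (NC cs ws).
have Qcs : smooth (fun u => Q (\row_k fiber_coord k u)) by exact: (NC cs Qs).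
(* [rho] removes the points where the coordinates are not valid, [w] those where [Phi] is not
   controlled. *)
have E : (fun u => rho (proj u) * (w (\row_k fiber_coord k u) * F u)) =
    (fun u => rho (proj u) * Q (\row_k fiber_coord k u)).
  apply/funext => u'; have [->|ru'] := eqVneq (rho (proj u')) 0; first by rewrite !mul0r.
  congr (_ * _); rewrite /Q /extend_by0; case: asboolP => [Wu'|nW].
    by rewrite FP.
  rewrite w0 ?mul0r// leNgt; apply/negP => /ltW /wW; exact: nW.
have := congr1 v E.
rewrite (tangent_mul tv rs (smoothM NC wcs Fs)) (tangent_mul tv wcs Fs).
rewrite (tangent_mul tv rs Qcs) (tangent_chain NC tv cs ws) (tangent_chain NC tv cs Qs) -/z.
have w1z : w z = 1 by exact: nbhs_singleton w1.
have QE : \forall y \near z, Q y = Phi y.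
  apply: filterS2 (open_nbhs_nbhs (conj oW Wu)) w1 => y Wy wy.
  by rewrite /Q /extend_by0 asboolT// wy mul1r.
have -> : Q z = F u by rewrite (nbhs_singleton QE) FP.
(* The terms with [v rho] agree on both sides and drop out; then [rho (proj u)] is cancelled. *)
rewrite w1z !mul1r => /addrI /(mulfI rhou).
rewrite big1 ?mul0r ?add0r.
  move=> ->; apply: eq_bigr => k _; congr (_ * _).
  exact: (@near_eq_derive _ _ _ Q Phi z (e k) QE).
move=> k _; have w1' : \forall y \near z, w y = cst 1 y by [].
by rewrite (near_eq_derive _ w1') derive_cst mul0r.
Qed.

End FiberCoords.

Lemma eq_sphere_tangent u v v' : tangent u v -> tangent u v' ->
  (forall h, smooth h -> v (fun x => h (proj x)) = v' (fun x => h (proj x))) ->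
  (forall h, smooth h -> v (fun x => tautological x h) = v' (fun x => tautological x h)) ->
  v = v'.
Proof.
move=> tv tv' vh vU; apply: (eq_tangent tv tv') => F Fs.
have [c cA cu] := atlas_cover (proj u : T).
have [rho [f [E [/nbhs_singleton B rP]]]] := chart_frame cA cu.
have fs := dual_basis_coord B.
have ru : rho (proj u) != 0 by rewrite (dual_basis_cutoff1 B) oner_eq0.
have [x0 [a0 [cx su zu]]] := chart_fiber_coord cA cu (rP _ ru).2.
have [W [Phi [oW Wz Phis FP]]] := Fs c x0 a0 u cA cx su.
have H := @tangent_fiber_coords f fs c rho F W Phi u _ (dual_basis_cutoff B) Fs oW Phis.
have K : forall u, rho (proj u) != 0 -> W (\row_k @fiber_coord f k u) ->
    F u = Phi (\row_k @fiber_coord f k u).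
  move=> u' /rP[cu' fc'].
  have [x [a [cx' su' ->]]] := chart_fiber_coord cA cu' fc'.
  by move=> Wu'; exact: FP.
rewrite -zu in Wz.
rewrite (H v K tv ru Wz) (H v' K tv' ru Wz); apply: eq_bigr => k _; congr (_ * _).
by rewrite /fiber_coord; case: (fintype.split k) => i; [exact: vh|exact: vU].
Qed.

(** By [tangent_fiber_coords], [X F] is locally a combination of the values of [X] on the fibre
    coordinates, which are smooth by hypothesis. *)
Lemma sphere_vector_field (X : N -> vec N) : (forall u, tangent u (X u)) ->
  (forall h, smooth h -> smooth (fun u => X u (fun x => h (proj x)))) ->
  (forall h, smooth h -> smooth (fun u => X u (fun x => tautological x h))) ->
  vector_field X.
Proof.
move=> tX Xh XU; split=> // F Fs c x0 a0 u0 cA cx0 su0.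
have cu : chart_dom c (proj u0) by rewrite /proj su0; exact: (chart_img_inv cx0).1.
have [rho [f [E [B rP]]]] := chart_frame cA cu.
have B0 := nbhs_singleton B; have fs := dual_basis_coord B0.
have [W [Phi [oW Wz Phis FP]]] := Fs c x0 a0 u0 cA cx0 su0.
have Ks k : smooth (fun u => X u (@fiber_coord f k)).
  rewrite /fiber_coord; case: (fintype.split k) => i; first exact: Xh.
  exact: XU.
have /choice[/= V /choice[/= Psi VP]] : forall k, exists V Psi,
    [/\ open V, V (row_mx x0 a0), smooth_on V Psi
      & forall (x a : 'rV[R]_n) u, chart_img c x -> V (row_mx x a) ->
          sval u = (chart_inv c x, chart_vector c x a) ->
          X u (@fiber_coord f k) = Psi (row_mx x a)].
  move=> k; have [V [Psi VP]] := Ks k c x0 a0 u0 cA cx0 su0.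
  by exists V, Psi.
have p0 : proj u0 = chart_inv c x0 by rewrite /proj su0.
rewrite p0 in B.
have : \forall y \near row_mx x0 a0, (W y /\ (forall k, V k y)) /\
    rho (chart_inv c (lsubmx y)) != 0.
  apply: filterI; [apply: filterI|]; first exact: (open_nbhs_nbhs (conj oW Wz)).
    apply: (@filter_forall _ _ V (nbhs (row_mx x0 a0))) => k.
    by have [oV Vz _ _] := VP k; exact: (open_nbhs_nbhs (conj oV Vz)).
  apply: (@near_lsubmx _ (fun x => rho (chart_inv c x) != 0)); rewrite row_mxKl.
  apply: (@near_chart_inv _ _ _ c x0 (fun q => rho q != 0)) => //.
  by apply: filterS B => q Bq; rewrite (dual_basis_cutoff1 Bq) oner_eq0.
move=> /near_open[W' [oW' W'z W'P]].
exists W', (fun y => \sum_k 'D_(e k) Phi y * Psi k y); split => //.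
  apply: smooth_on_sum => // k; apply: smooth_onM => //.
    by apply: smooth_on_partial; apply: smooth_on_sub Phis => y /W'P[[]].
  have [_ _ Ps _] := VP k; by apply: smooth_on_sub Ps => y /W'P[[]].
move=> x a u cx /W'P[[Wy Vy]]; rewrite row_mxKl => ru su.
have pu : proj u = chart_inv c x by rewrite /proj su.
rewrite -pu in ru.
have zu : \row_k @fiber_coord f k u = row_mx x a.
  by apply: (fiber_coord_chart cA cx su); rewrite -pu; exact: (rP _ ru).2.
have K : forall u, rho (proj u) != 0 -> W (\row_k @fiber_coord f k u) ->
    F u = Phi (\row_k @fiber_coord f k u).
  move=> u' /rP[cu' fc'].
  have [x' [a' [cx' su' ->]]] := chart_fiber_coord cA cu' fc'.
  by move=> Wu'; exact: FP.
rewrite (@tangent_fiber_coords f fs c rho F W Phi u _ (dual_basis_cutoff B0) Fs oW Phis K (tX u) ru);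
  last by rewrite zu.
rewrite zu; apply: eq_bigr => k _; congr (_ * _).
by have [_ _ _] := VP k; exact.
Qed.

End Sphere.

(** * Pointwise algebra of a Riemannian metric *)

Section Metric.
Context {R : realType} {M : smooth_space R} {g : M -> vec M -> vec M -> R}.
Hypothesis gP : riemannian_metric g.
Context {p : M}.
Implicit Types (v w : vec M).

Lemma metric_symmetric v w : tangent p v -> tangent p w -> g p v w = g p w v.
Proof. by move=> tv tw; exact: (Defs.metric_sym gP tv tw). Qed.

Lemma metricDl v v' w : tangent p v -> tangent p v' -> tangent p w ->
  g p (v + v') w = g p v w + g p v' w.
Proof. by move=> *; rewrite -[v]scale1r (metric_linear gP)// scale1r mul1r. Qed.

Lemma metric0l w : tangent p w -> g p 0 w = 0.
Proof.
move=> tw; have := metricDl (tangent0 p) (tangent0 p) tw.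
rewrite addr0 => /eqP; rewrite -subr_eq0 opprD addrA subrr sub0r oppr_eq0.
by move/eqP.
Qed.

Lemma metricZl (a : R) v w : tangent p v -> tangent p w -> g p (a *: v) w = a * g p v w.
Proof.
move=> tv tw; have := metric_linear gP a tv (tangent0 p) tw.
by rewrite addr0 metric0l// addr0.
Qed.

Lemma metricNl v w : tangent p v -> tangent p w -> g p (- v) w = - g p v w.
Proof. by move=> tv tw; rewrite -scaleN1r metricZl// mulN1r. Qed.

Lemma metricBl v v' w : tangent p v -> tangent p v' -> tangent p w ->
  g p (v - v') w = g p v w - g p v' w.
Proof. by move=> tv tv' tw; rewrite metricDl ?metricNl//; exact: tangentN. Qed.

Lemma metric_suml (I : Type) (s : seq I) (v : I -> vec M) w :
  (forall i, tangent p (v i)) -> tangent p w ->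
  g p (\sum_(i <- s) v i : vec M) w = \sum_(i <- s) g p (v i) w.
Proof.
move=> tv tw; elim: s => [|i s IH]; first by rewrite !big_nil metric0l.
by rewrite !big_cons metricDl ?IH//; exact: tangent_sum.
Qed.

Lemma metricDr w v v' : tangent p v -> tangent p v' -> tangent p w ->
  g p w (v + v') = g p w v + g p w v'.
Proof.
move=> tv tv' tw; rewrite metric_symmetric//; last exact: tangentD.
by rewrite metricDl// !(@metric_symmetric w).
Qed.

Lemma metricZr (a : R) w v : tangent p v -> tangent p w -> g p w (a *: v) = a * g p w v.
Proof.
move=> tv tw; rewrite metric_symmetric//; last exact: tangentZ.
by rewrite metricZl// (@metric_symmetric w).
Qed.

Lemma metric0r w : tangent p w -> g p w 0 = 0.
Proof. by move=> tw; rewrite metric_symmetric ?metric0l//; exact: tangent0. Qed.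

Lemma metric_sumr (I : Type) (s : seq I) w (v : I -> vec M) :
  (forall i, tangent p (v i)) -> tangent p w ->
  g p w (\sum_(i <- s) v i : vec M) = \sum_(i <- s) g p w (v i).
Proof.
move=> tv tw; elim: s => [|i s IH]; first by rewrite !big_nil metric0r.
by rewrite !big_cons metricDr ?IH//; exact: tangent_sum.
Qed.

Lemma metric_nondegenerate v : tangent p v ->
  (forall w, tangent p w -> g p v w = 0) -> v = 0.
Proof.
move=> tv H; apply: contrapT => v0; have := metric_pos gP tv v0.
by rewrite H// ltxx.
Qed.

Lemma metric_dual_basis m rho (f : 'I_m -> M -> R) E v w :
  dual_basis p rho f E -> tangent p v -> tangent p w ->
  g p v w = \sum_i \sum_j v (f i) * w (f j) * g p (E i p) (E j p).
Proof.
move=> B tv tw; have tE i := field_tangent p (dual_basis_field B i).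
have tZ (a : R) i := tangentZ a (tE i).
rewrite {1}(dual_basis_expand1 B tv) {1}(dual_basis_expand1 B tw).
rewrite metric_suml//; last exact: tangent_sum.
apply: eq_bigr => i _; rewrite metric_sumr//; apply: eq_bigr => j _.
by rewrite metricZl// metricZr// mulrA.
Qed.

End Metric.

(** * Existence of tangent vectors on the sphere bundle *)

Section SphereTangent.
Context {R : realType} {n : nat} {M : manifold R n}.
Context {g : M -> vec M -> vec M -> R}.
Hypothesis gP : riemannian_metric g.
Local Notation T := (manifold_top M).
Local Notation N := (SM g).
Local Notation e i := (delta_mx 0 i).
Implicit Types (c : chart R n T) (u : N) (v : vec N) (F : N -> R).

Let MC : smooth_closed M := smooth_closed_manifold.
Let NC : smooth_closed N := smooth_closed_sphere.

Lemma sphere_point_inj (u u' : N) : sval u = sval u' -> u = u'.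
Proof.
case: u u' => [x Px] [y Py] /= xy; subst y.
by rewrite (Prop_irrelevance Px Py).
Qed.

Section Curve.
Context {c : chart R n T} {u : N} {rho : M -> R} {f : 'I_n -> M -> R} {E : 'I_n -> M -> vec M}.
Hypotheses (cA : atlas c) (cu : chart_dom c (proj u)).
Hypothesis B : \forall q \near (proj u : T), @dual_basis R M q n rho f E.
Hypothesis rP : forall q, rho q != 0 -> chart_dom c q /\ local_coords c f q.

Let x0 := chart_map c (proj u).
Let a0 := \row_i tautological u (f i).
Let z0 := row_mx x0 a0.
Let B0 : @dual_basis R M (proj u) n rho f E := nbhs_singleton B.

Let coords q : @dual_basis R M q n rho f E -> local_coords c f q.
Proof. by move=> Bq; apply: (rP _).2; rewrite (dual_basis_cutoff1 Bq) oner_eq0. Qed.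

Let su : sval u = (chart_inv c x0, chart_vector c x0 a0).
Proof.
rewrite chart_mapK// -(tangent_coords cA cu (coords B0) (tautological_tangent u)).
by rewrite /proj /tautological; case: (sval u).
Qed.

Let cx0 : chart_img c x0. Proof. exact: chart_img_map. Qed.

(** The squared length of the vector with coordinates (x, a), by [square_normE] where the dual basis
    is valid. Written with the global fields [E i], it is smooth over the whole chart. *)
Definition square_norm (y : 'rV[R]_(n + n)) : R :=
  \sum_i \sum_j rsubmx y 0 i * rsubmx y 0 j *
    g (chart_inv c (lsubmx y)) (E i (chart_inv c (lsubmx y))) (E j (chart_inv c (lsubmx y))).

Let O1 := [set y : 'rV[R]_(n + n) | chart_img c (lsubmx y)].
Let oO1 : open O1.
Proof. by apply: open_lsubmx; exact: chart_img_open. Qed.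

Let smooth_square_norm : smooth_on O1 square_norm.
Proof.
apply: smooth_on_sum => // i; apply: smooth_on_sum => // j.
apply: smooth_onM => //; first by apply: smooth_onM => //; exact: smooth_on_rsubmx.
apply: (@smooth_on_fiber _ _ _ c (fun q => g q (E i q) (E j q))) => //.
by apply: (metric_smooth gP); exact: dual_basis_field B0 _.
Qed.

Let square_normE x a : chart_img c x -> @dual_basis R M (chart_inv c x) n rho f E ->
  g (chart_inv c x) (chart_vector c x a) (chart_vector c x a) = square_norm (row_mx x a).
Proof.
move=> cx Bx; have tx := chart_vector_tangent a cA cx.
rewrite (metric_dual_basis gP Bx tx tx) /square_norm row_mxKl row_mxKr.
apply: eq_bigr => i _; apply: eq_bigr => j _.
by rewrite !(chart_vector_coord _ _ cA cx (coords Bx)).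
Qed.

Let square_normZ x a (k : R) : square_norm (row_mx x (k *: a)) = k ^+ 2 * square_norm (row_mx x a).
Proof.
rewrite /square_norm mulr_sumr; apply: eq_bigr => i _.
rewrite mulr_sumr; apply: eq_bigr => j _.
by rewrite !row_mxKl !row_mxKr !mxE; ring.
Qed.

Let S0 : square_norm z0 = 1.
Proof.
rewrite -square_normE//; last by rewrite chart_mapK.
by have := tautological_unit u; rewrite /proj /tautological su.
Qed.

Definition inv_norm y : R := (Num.sqrt (square_norm y))^-1.
Definition normalize (y : 'rV[R]_(n + n)) : 'rV[R]_(n + n) :=
  row_mx (lsubmx y) (inv_norm y *: rsubmx y).

Let inv_norm0 : inv_norm z0 = 1. Proof. by rewrite /inv_norm S0 sqrtr1 invr1. Qed.

Let normalize0 : normalize z0 = z0.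
Proof. by rewrite /normalize inv_norm0 scale1r hsubmxK. Qed.

Let Oz0 : O1 z0. Proof. by rewrite /O1 /= row_mxKl. Qed.

Let Sc : {for z0, continuous square_norm}.
Proof. exact: smooth_on_continuous Oz0 smooth_square_norm. Qed.

Let inv_norm_continuous : {for z0, continuous inv_norm}.
Proof.
have c1 : {for z0, continuous (fun y => Num.sqrt (square_norm y))}.
  by apply: (@continuous_comp _ _ _ square_norm (@Num.sqrt R)) => //; exact: sqrt_continuous.
by apply: cvgV c1; rewrite S0 sqrtr1 oner_eq0.
Qed.

Let inv_norm_derivable b : derivable inv_norm z0 b.
Proof.
have d1 : derivable square_norm z0 b.
  exact: (@ex_derive _ _ _ _ _ _ _ (is_derive_dir b (smooth_on_C1 oO1 Oz0 smooth_square_norm))).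
apply: derivableV; first by rewrite S0 sqrtr1 oner_eq0.
apply/derivable1P.
have d2 : is_derive (0 : R) (1 : R) (fun h : R => square_norm (h *: b + z0)) ('D_b square_norm (0 *: b + z0)).
  by apply: is_derive_line; rewrite scale0r add0r.
have d3 : is_derive (square_norm (0 *: b + z0)) (1 : R) (@Num.sqrt R) (2 * Num.sqrt (square_norm (0 *: b + z0)))^-1.
  by apply: is_derive1_sqrt; rewrite scale0r add0r S0.
exact: (@ex_derive _ _ _ _ _ _ _ (@is_derive1_comp _ (@Num.sqrt R) (fun h : R => square_norm (h *: b + z0)) 0 _ _ d3 d2)).
Qed.

Let normalize_coord k y : normalize y 0 k =
  match fintype.split k with inl i => lsubmx y 0 i | inr i => inv_norm y * rsubmx y 0 i end.
Proof. by rewrite /normalize mxE; case: fintype.split => i; rewrite ?mxE. Qed.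

Let normalize_continuous : {for z0, continuous normalize}.
Proof.
apply: continuous_rV => k.
have -> : (fun y => normalize y 0 k) = (fun y => match fintype.split k with
    inl i => lsubmx y 0 i | inr i => inv_norm y * rsubmx y 0 i end).
  by apply/funext => y; exact: normalize_coord.
case: (fintype.split k) => i.
  by apply: (@smooth_on_continuous _ _ setT) => //; exact: smooth_on_lsubmx.
have c2 : {for z0, continuous (fun y : 'rV[R]_(n + n) => rsubmx y 0 i)}.
  by apply: (@smooth_on_continuous _ _ setT) => //; exact: smooth_on_rsubmx.
exact: (continuousM inv_norm_continuous c2).
Qed.

Let derivable_lsubmx i b : is_derive z0 b (fun y : 'rV[R]_(n + n) => lsubmx y 0 i) (lsubmx b 0 i).
Proof. under eq_fun do rewrite mxE; rewrite mxE; exact: derive_coord. Qed.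

Let derivable_rsubmx i b : is_derive z0 b (fun y : 'rV[R]_(n + n) => rsubmx y 0 i) (rsubmx b 0 i).
Proof. under eq_fun do rewrite mxE; rewrite mxE; exact: derive_coord. Qed.

Let is_derive_normalized i b : is_derive z0 b (fun y : 'rV[R]_(n + n) => inv_norm y * rsubmx y 0 i)
  (rsubmx b 0 i + 'D_b inv_norm z0 * a0 0 i).
Proof.
have d1 := derivable_rsubmx i b.
have d2 : is_derive z0 b inv_norm ('D_b inv_norm z0) by apply: DeriveDef.
apply: (is_derive_eq (is_deriveM d2 d1)).
by rewrite inv_norm0 row_mxKr [_ *: _]mul1r [_ *: _]mulrC.
Qed.

Definition normalized_point (y : 'rV[R]_(n + n)) : N :=
  if pselect (exists u' : N, sval u' =
    (chart_inv c (lsubmx y), chart_vector c (lsubmx y) (inv_norm y *: rsubmx y)))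
  is left H then sval (cid H) else u.
Local Notation pt := normalized_point.

Let ptP : \forall y \near z0, [/\ chart_img c (lsubmx y),
  @dual_basis R M (chart_inv c (lsubmx y)) n rho f E &
  sval (pt y) = (chart_inv c (lsubmx y), chart_vector c (lsubmx y) (inv_norm y *: rsubmx y))].
Proof.
have n1 : \forall y \near z0, 0 < square_norm y.
  by apply: (@cvgr_gt _ _ _ _ square_norm _ Sc); rewrite S0.
have n2 : \forall y \near z0, @dual_basis R M (chart_inv c (lsubmx y)) n rho f E.
  apply: (@near_lsubmx _ _ _ (fun x => @dual_basis R M (chart_inv c x) n rho f E)).
  rewrite row_mxKl; apply: (@near_chart_inv _ _ _ c x0 (fun q => @dual_basis R M q n rho f E)) => //.
  by rewrite chart_mapK.
apply: filterS3 (open_nbhs_nbhs (conj oO1 Oz0)) n1 n2 => y cy Sy By; split=> //.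
set x := lsubmx y; set a := inv_norm y *: rsubmx y.
have [t1 t2] : @tangent R M (chart_inv c x) (chart_vector c x a) /\
    g (chart_inv c x) (chart_vector c x a) (chart_vector c x a) = 1.
  split; first exact: chart_vector_tangent.
  rewrite square_normE// square_normZ hsubmxK /inv_norm exprVn sqr_sqrtr ?ltW//.
  by rewrite mulVf// gt_eqF.
have H : exists u' : N, sval u' = (chart_inv c x, chart_vector c x a).
  by exists (exist _ (chart_inv c x : M, chart_vector c x a) (conj t1 t2)).
rewrite /normalized_point; case: pselect => // H'; exact: svalP (cid H').
Qed.

Let pt0 : pt z0 = u.
Proof.
apply: sphere_point_inj; have [_ _ ->] := nbhs_singleton ptP.
by rewrite row_mxKl row_mxKr inv_norm0 scale1r su.
Qed.

(** Near [z0] the function is [Phi \o normalize] with [Phi] smooth, so [is_derive_chain] needs only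
    derivability of the coordinates of [normalize]. *)
Let derivable_pt F b : smooth F -> derivable (F \o pt) z0 b.
Proof.
move=> Fs; have [W [Phi [oW Wz Phis FP]]] := Fs c x0 a0 u cA cx0 su.
have E1 : \forall y \near z0, (Phi \o normalize) y = (F \o pt) y.
  have n1 : \forall y \near z0, W (normalize y).
    apply: normalize_continuous; rewrite normalize0.
    exact: (open_nbhs_nbhs (conj oW Wz)).
  apply: filterS2 ptP n1 => y [cy By sy] Wy /=.
  by rewrite (FP _ _ _ cy Wy sy).
apply: (near_eq_derivable E1).
have C : C1_near Phi (normalize z0) by rewrite normalize0; exact: smooth_on_C1 Wz Phis.
apply: (@ex_derive _ _ _ _ _ _ _ (is_derive_chain C (v := b) _)) => k.
under eq_fun do rewrite normalize_coord.
case: (fintype.split k) => i; first exact: (@ex_derive _ _ _ _ _ _ _ (derivable_lsubmx i b)).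
exact: (@ex_derive _ _ _ _ _ _ _ (is_derive_normalized i b)).
Qed.

(* The correction [lam] comes from differentiating the normalization [a / |a|];
   it vanishes for a velocity tangent to the sphere. *)
Lemma exists_sphere_tangent (xi eta : 'I_n -> R) : exists (v : vec N) (lam : R),
  [/\ tangent u v, forall i, v (fun x => f i (proj x)) = xi i &
    forall i, v (fun x => tautological x (f i)) = eta i + lam * tautological u (f i)].
Proof.
have fs := dual_basis_coord B0.
pose b : 'rV[R]_(n + n) := row_mx (\row_i xi i) (\row_i eta i).
pose v : vec N := fun F => if `[< smooth F >] then 'D_b (F \o pt) z0 else 0.
have vE F : smooth F -> v F = 'D_b (F \o pt) z0 by move=> Fs; rewrite /v asboolT.
exists v, ('D_b inv_norm z0); split.
- split=> [a h k hs ks|h k hs ks|h hs]; last by rewrite /v asboolF.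
  + rewrite !vE//; last by apply: smoothD => //; exact: smoothZ.
    have db : derivable (a *: (h \o pt)) z0 b by exact/derivableZ/derivable_pt.
    have := deriveD db (@derivable_pt _ b ks); rewrite deriveZ; last exact: derivable_pt.
    by move=> <-.
  + rewrite !vE//; last exact: smoothM.
    have := deriveM (@derivable_pt _ b hs) (@derivable_pt _ b ks) => /= ->.
    by rewrite !pt0 addrC; congr (_ + _); rewrite [LHS]mulrC.
- move=> i; rewrite vE; last exact: smooth_proj.
  have E1 : \forall y \near z0, lsubmx y 0 i = ((fun x => f i (proj x)) \o pt) y.
    apply: filterS ptP => y [cy By sy] /=.
    by rewrite /proj sy /= (nbhs_singleton (coords By).2) (chart_img_inv cy).2.
  rewrite -(near_eq_derive _ E1) (@derive_val _ _ _ _ _ _ _ (derivable_lsubmx i b)).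
  by rewrite row_mxKl mxE.
- move=> i; rewrite vE; last exact: (section_smooth section_tautological).
  have E1 : \forall y \near z0, inv_norm y * rsubmx y 0 i =
      ((fun x => tautological x (f i)) \o pt) y.
    apply: filterS ptP => y [cy By sy] /=.
    by rewrite /tautological sy /= (chart_vector_coord _ _ cA cy (coords By)) !mxE.
  rewrite -(near_eq_derive _ E1) (@derive_val _ _ _ _ _ _ _ (is_derive_normalized i b)).
  by rewrite row_mxKr !mxE.
Qed.

End Curve.

End SphereTangent.

(** * Horizontal and vertical lifts *)

Section Lifts.
Context {R : realType} {n : nat} {M : manifold R n}.
Context {g : M -> vec M -> vec M -> R}.
Context {D : M -> vec M -> (M -> vec M) -> vec M}.
Local Notation T := (manifold_top M).
Local Notation N := (SM g).
Context {fD : N -> vec N -> (N -> vec M) -> vec M}.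
Hypothesis gP : riemannian_metric g.
Hypothesis DP : metric_connection g D.
Hypothesis fP : pullback_connection D fD.
Implicit Types (u : N) (v w : vec N) (s t : N -> vec M).

Let MC : smooth_closed M := smooth_closed_manifold.
Let MB : has_dual_bases M := manifold_dual_bases.
Let NC : smooth_closed N := smooth_closed_sphere.
Let prs : forall h, smooth h -> smooth (fun u : N => h (proj u)) := smooth_proj.
Let DC : linear_connection D := DP.1.
Let fC : connection_along (@Defs.proj R n M g) fD := fP.1.
Let fE := fP.2.
Local Notation section := (section_along (@Defs.proj R n M g)).
Local Notation U := (@tautological R n M g).
Local Notation df := (differential (@Defs.proj R n M g)).
Local Notation conn := (connector fD).
Local Notation "<< s , t >>_ u" := (g (proj u) s t) (at level 10, u at level 2).
Let sU : section U := section_tautological.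

Lemma connection_tangentM p (w : vec M) (X : M -> vec M) : tangent p w ->
  vector_field X -> tangent p (D p w X).
Proof.
move=> tw fX; have [Y [fY Yp]] := vector_field_through MC MB tw.
by apply: (connection_tangent DC _ fX); exists Y.
Qed.

(** [connection_smooth] would need a vector field on SM through [v], whose existence
    ([sphere_field_through]) relies on this lemma; the explicit expansion avoids the circle. *)
Lemma pullback_tangent u v s : tangent u v -> section s ->
  tangent (proj u) (fD u v s).
Proof.
move=> tv ss; have [m [rho [f [E B]]]] := MB (proj u).
rewrite (pullback_expand MC NC prs fC fE B tv ss); apply: tangent_sum => i.
apply: tangentD; apply: tangentZ; first exact/field_tangent/(dual_basis_field B).
apply: connection_tangentM; last exact: (dual_basis_field B).
exact: differential_tangent.
Qed.

Lemma connector_tangent u v : tangent u v -> tangent (proj u) (conn u v).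
Proof. by move=> tv; exact: pullback_tangent. Qed.

(** The metric is known to be smooth on fields of M; expansion over a neighbourhood in the base
    reduces to the Gram matrix of the [E i]. *)
Lemma smooth_inner s t : section s -> section t ->
  smooth (fun u => << s u, t u >>_u).
Proof.
move=> ss st; apply: sphere_smooth_local => u0.
have [c cA cu] := atlas_cover (proj u0 : T).
have [rho [f [E [B _]]]] := chart_frame cA cu; have B0 := nbhs_singleton B.
exists (fun u => \sum_i \sum_j s u (f i) * t u (f j) * g (proj u) (E i (proj u)) (E j (proj u))).
exists (fun q => @dual_basis R M q n rho f E); split => //.
  have fs := dual_basis_coord B0.
  apply: (smooth_sum NC) => i; apply: (smooth_sum NC) => j; apply: (smoothM NC).
    by apply: (smoothM NC); [exact: (section_smooth ss (fs i))|exact: (section_smooth st (fs j))].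
  apply: (@smooth_proj _ _ _ _ (fun q => g q (E i q) (E j q))).
  by apply: (metric_smooth gP); exact: (dual_basis_field B0).
by move=> u Bu; rewrite (metric_dual_basis gP Bu (section_tangent u ss) (section_tangent u st)).
Qed.

(** The defect [K] is symmetric and linear over functions in each argument, so it vanishes once it
    does on pulled-back fields. *)
Lemma pullback_metric u v s t : tangent u v -> section s -> section t ->
  v (fun x => << s x, t x >>_x) = << fD u v s, t u >>_u + << s u, fD u v t >>_u.
Proof.
move=> tv ss st; have [m [rho [f [E B]]]] := MB (proj u).
(* [R^o] presents the scalars as a module over themselves, as [tensorial_expand] expects. *)
pose K a b : R^o := v (fun x => << a x, b x >>_x) - << fD u v a, b u >>_u - << a u, fD u v b >>_u.
have tS a x : section a -> tangent (proj x) (a x) by move=> sa; exact: section_tangent.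
have tF a : section a -> tangent (proj u) (fD u v a) by move=> sa; exact: pullback_tangent.
have Ksym a b : section a -> section b -> K a b = K b a.
  move=> sa sb; rewrite /K.
  have -> : (fun x => << a x, b x >>_x) = (fun x => << b x, a x >>_x).
    by apply/funext => x; rewrite (metric_symmetric gP)//; exact: tS.
  rewrite (metric_symmetric gP (tF a sa) (tS b u sb)) (metric_symmetric gP (tS a u sa) (tF b sb)).
  by rewrite addrAC.
have KD b : section b -> forall a a', section a -> section a' ->
    K (fun x => a x + a' x) b = K a b + K a' b.
  move=> sb a a' sa sa'; rewrite /K.
  have -> : (fun x => << a x + a' x, b x >>_x) = (fun x => << a x, b x >>_x + << a' x, b x >>_x).
    by apply/funext => x; rewrite (metricDl gP)//; exact: tS.
  rewrite (tangentDf tv); try exact: smooth_inner.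
  rewrite (connection_additive fC)// !(metricDl gP)//; try (exact: tS || exact: tF).
  by ring.
have KZ b : section b -> forall h a, smooth h -> section a ->
    K (fun x => h x *: a x) b = h u *: K a b.
  move=> sb h a hs sa; rewrite /K.
  have -> : (fun x => << h x *: a x, b x >>_x) = (fun x => h x * << a x, b x >>_x).
    by apply/funext => x; rewrite (metricZl gP)//; exact: tS.
  rewrite (tangent_mul tv hs); last exact: smooth_inner.
  have ta := tS a u sa; have tb := tS b u sb; have tfa := tF a sa; have tfb := tF b sb.
  rewrite (connection_leibniz fC)// (metricDl gP) ?(metricZl gP)//; try exact: tangentZ.
  by rewrite /GRing.scale/=; ring.
have sE i : section (fun x => E i (proj x)).
  by apply: section_pullback => //; exact: (dual_basis_field B).
have Kexp a b : section a -> section b -> K a b = \sum_i a u (f i) *: K (fun x => E i (proj x)) b.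
  by move=> sa sb; exact: (tensorial_expand NC prs B (KD b sb) (KZ b sb) sa).
have K0 i j : K (fun x => E i (proj x)) (fun x => E j (proj x)) = 0.
  have fi := dual_basis_field B i; have fj := dual_basis_field B j.
  have td := differential_tangent MC prs tv.
  (* Compatibility of D is stated for vector fields, so the direction [df v] is extended to one. *)
  have [X [fX Xp]] := vector_field_through MC MB td.
  rewrite /K; have := DP.2 X _ _ fX fi fj (proj u).
  rewrite Xp (differentialE _ (metric_smooth gP fi fj)).
  have := fE fi tv; have := fE fj tv; rewrite /comp => -> -> ->.
  by ring.
have K00 : K s t = 0.
  rewrite Kexp// big1// => i _; rewrite Ksym// Kexp// big1 ?scaler0// => j _.
  by rewrite K0 scaler0.
by move: K00; rewrite /K => K00; apply/eqP; rewrite -subr_eq0 opprD addrA; apply/eqP.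
Qed.

(** Differentiate [<U, U> = 1]. *)
Lemma connector_orth u v : tangent u v -> << conn u v, U u >>_u = 0.
Proof.
move=> tv; have := pullback_metric tv sU sU.
have -> : (fun x : N => << U x, U x >>_x) = (fun=> 1).
  by apply/funext => x; exact: tautological_unit.
rewrite (tangent_cst NC tv) (metric_symmetric gP (tautological_tangent u)); last exact: pullback_tangent.
rewrite -/(conn u v) => H; lra.
Qed.

Lemma section_connector (X : N -> vec N) : vector_field X -> section (fun x => conn x (X x)).
Proof. by move=> fX; exact: (connection_smooth fC). Qed.

Lemma connectorZD u (a : R) v w : tangent u v -> tangent u w ->
  conn u (a *: v + w) = a *: conn u v + conn u w.
Proof. by move=> tv tw; exact: (connection_linear fC). Qed.

(* Apply [v] to [rho U(h) = sum_i U(f_i) E_i(h)] and compare with the expansion of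
   [(f^*D)_v U]. *)
Lemma tautological_derivative u v m rho f E (h : M -> R) :
  @dual_basis R M (proj u) m rho f E -> tangent u v -> smooth h ->
  v (fun x => U x h) = conn u v h +
    \sum_i U u (f i) * (df v (fun q => E i q h) - D (proj u) (df v) (E i) h).
Proof.
move=> B tv hs; have rs := dual_basis_cutoff B; have fs := dual_basis_coord B.
have Uhs k : smooth k -> smooth (fun x => U x k) by move=> ks; exact: (section_smooth sU ks).
have Es i : smooth (fun q => E i q h) by apply: field_smooth => //; exact: (dual_basis_field B).
have E1 : (fun x : N => rho (proj x) * U x h) = (fun x => \sum_i U x (f i) * E i (proj x) h).
  apply/funext => x; have := dual_basis_expand B (section_tangent x sU).
  by move=> /(congr1 (fun w : vec M => w h)); rewrite vec_sumE.
have := congr1 v E1; rewrite (tangent_mul tv (prs rs) (Uhs h hs)).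
rewrite -(differentialE v rs) (dual_basis_flat B) ?mul0r ?add0r; last exact: differential_tangent.
rewrite (dual_basis_cutoff1 B) mul1r => ->.
rewrite (tangent_sumf NC tv); last by move=> i; apply: (smoothM NC); [exact: Uhs|exact: prs (Es i)].
rewrite /conn (pullback_expand MC NC prs fC fE B tv sU) vec_sumE -big_split/=.
apply: eq_bigr => i _; rewrite (tangent_mul tv (Uhs _ (fs i)) (prs (Es i))).
rewrite (differentialE v (Es i)) (@vecDE _ M) !(@vecZE _ M); ring.
Qed.

(** The horizontal and vertical components determine a vector: [tautological_derivative] expresses
    [v] on the functions [U h] through [df v] and [conn u v]. *)
Lemma eq_by_parts u v w : tangent u v -> tangent u w ->
  df v = df w -> conn u v = conn u w -> v = w.
Proof.
move=> tv tw dvw cvw; apply: (eq_sphere_tangent tv tw) => h hs.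
  by have := congr1 (fun w : vec M => w h) dvw; rewrite !differentialE.
have [m [rho [f [E B]]]] := MB (proj u).
by rewrite !(tautological_derivative B)// dvw cvw.
Qed.

(** The map [v |-> (df v, conn u v)] is onto the pairs whose second entry is orthogonal to U; both
    lifts are special cases. *)
Lemma exists_lift u (w t : vec M) : tangent (proj u) w -> tangent (proj u) t ->
  << t, U u >>_u = 0 ->
  exists v, [/\ tangent u v, df v = w & conn u v = t].
Proof.
move=> tw tt tU; have [c cA cu] := atlas_cover (proj u : T).
have [rho [f [E [B rP]]]] := chart_frame cA cu; have B0 := nbhs_singleton B.
have fEi i : vector_field (E i) by exact: (dual_basis_field B0).
have tEi i : tangent (proj u) (E i (proj u)) by exact: field_tangent.
have fs := dual_basis_coord B0.
(* The Christoffel part of [conn u v], fixed by [w] alone; the fibre velocity is prescribed as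
   [t - S] to compensate for it. *)
pose S : vec M := \sum_i U u (f i) *: D (proj u) w (E i).
have tS : tangent (proj u) S.
  by apply: tangent_sum => i; apply: tangentZ; exact: connection_tangentM.
have [v [lam [tv vf vU]]] := exists_sphere_tangent gP cA cu B rP (fun i => w (f i))
  (fun i => (t - S : vec M) (f i)).
have tdv := differential_tangent MC prs tv.
have dv : df v = w.
  rewrite (dual_basis_expand1 B0 tdv) [RHS](dual_basis_expand1 B0 tw).
  by apply: eq_bigr => i _; rewrite differentialE ?vf.
have cv : conn u v = t + lam *: U u.
  rewrite /conn (pullback_expand MC NC prs fC fE B0 tv sU) dv big_split/= -/S.
  under eq_bigr do rewrite vU scalerDl -scalerA.
  rewrite big_split/= -scaler_sumr -(dual_basis_expand1 B0 (tautological_tangent u)).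
  rewrite -(dual_basis_expand1 B0 (tangentB tt tS)).
  by rewrite addrAC subrK.
exists v; split=> //; rewrite cv.
(* Both [t] and [conn u v] are orthogonal to the unit vector U, so [lam] is 0. *)
have := connector_orth tv; rewrite cv (metricDl gP)//; try exact: tautological_tangent.
  rewrite (metricZl gP) ?tautological_unit ?tU; try exact: tautological_tangent.
  by rewrite add0r mulr1 => ->; rewrite scale0r addr0.
by apply: tangentZ; exact: tautological_tangent.
Qed.

(** Lifts may be chosen point by point: their values on both generating families of functions are
    forced, and these depend smoothly on the point. *)
Lemma lift_field s t : section s -> section t -> (forall x, << t x, U x >>_x = 0) ->
  exists X, [/\ vector_field X, forall x, df (X x) = s x & forall x, conn x (X x) = t x].
Proof.
move=> ss st tU.
have /choice[X XP] : forall x : N, exists v, [/\ tangent x v, df v = s x & conn x v = t x].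
  by move=> x; apply: exists_lift => //; exact: section_tangent.
exists X; split=> [|x|x]; try by have [] := XP x.
have Xs h : smooth h -> (fun x => X x (fun y => h (proj y))) = (fun x => s x h).
  by move=> hs; apply/funext => x; have [_ <- _] := XP x; rewrite differentialE.
apply: sphere_vector_field => [x|h hs|h hs]; first by have [] := XP x.
  by rewrite Xs//; exact: (section_smooth ss hs).
apply: sphere_smooth_local => u0.
have [c cA cu] := atlas_cover (proj u0 : T).
have [rho [f [E [B _]]]] := chart_frame cA cu; have B0 := nbhs_singleton B.
have fEi i : vector_field (E i) by exact: (dual_basis_field B0).
have fs := dual_basis_coord B0.
(* The value given by [tautological_derivative], with the direction [s x] of [D] expanded along
   [E j] so that smoothness is visible. *)
exists (fun x => t x h + \sum_i U x (f i) * (s x (fun q => E i q h) -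
  \sum_j s x (f j) * D (proj x) (E j (proj x)) (E i) h)).
exists (fun q => @dual_basis R M q n rho f E); split => //.
  apply: (smoothD NC); first exact: (section_smooth st hs).
  apply: (smooth_sum NC) => i; apply: (smoothM NC); first exact: (section_smooth sU (fs i)).
  apply: (smoothB NC); first exact: (section_smooth ss (field_smooth (fEi i) hs)).
  apply: (smooth_sum NC) => j; apply: (smoothM NC); first exact: (section_smooth ss (fs j)).
  apply: (@smooth_proj _ _ _ _ (fun q => D q (E j q) (E i) h)).
  exact: (field_smooth (connection_smooth DC (fEi j) (fEi i)) hs).
move=> x Bx; have [tX dX cX] := XP x.
rewrite (tautological_derivative Bx tX hs) dX cX; congr (_ + _).
apply: eq_bigr => i _; congr (_ * (_ - _)).
have tE j : tangent (proj x) (E j (proj x)) by exact: field_tangent.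
rewrite [X in D _ X](dual_basis_expand1 Bx (section_tangent x ss)).
rewrite (connection_dir_sum DC _ (fun j => tangentZ _ (tE j)) (fEi i)) (@vec_sumE _ M).
by apply: eq_bigr => j _; rewrite (connection_dirZ DC _ (tE j) (fEi i)).
Qed.

(** Extend both components of [v] by fields on M, correct the second, and lift them. *)
Lemma sphere_field_through u v : tangent u v -> exists X, vector_field X /\ X u = v.
Proof.
move=> tv.
have [Y [fY Yp]] := vector_field_through MC MB (differential_tangent MC prs tv).
have [Z [fZ Zp]] := vector_field_through MC MB (connector_tangent tv).
have sY := section_pullback prs fY; have sZ := section_pullback prs fZ.
(* Removing the U-component makes [t] liftable everywhere; at [u] nothing is removed, by
   [connector_orth]. *)
pose t x : vec M := Z (proj x) - << Z (proj x), U x >>_x *: U x.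
have st : section t.
  apply: (sectionB NC) => //; apply: (sectionZ NC) => //; exact: smooth_inner.
have tU x : << t x, U x >>_x = 0.
  have tZ := field_tangent (proj x) fZ; have tUx := tautological_tangent x.
  rewrite /t (metricBl gP)//; last exact: tangentZ.
  by rewrite (metricZl gP)// tautological_unit mulr1 subrr.
have [X [fX dX cX]] := lift_field sY st tU.
exists X; split=> //; apply: (eq_by_parts (field_tangent u fX) tv).
  by rewrite dX.
by rewrite cX /t Zp connector_orth// scale0r subr0.
Qed.

(** Existence shows that [xget] returns a genuine lift and not its default 0. *)
Lemma hliftP u (w : vec M) : tangent (proj u) w ->
  [/\ tangent u (hlift fD u w), conn u (hlift fD u w) = 0 & df (hlift fD u w) = w].
Proof.
move=> tw; have tU := tautological_tangent u.
have [v [tv dv cv]] := exists_lift tw (tangent0 (proj u)) (metric0l gP tU).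
have H : exists v, horizontal fD u v /\ df v = w by exists v.
have := @xgetPex _ 0 [set v | horizontal fD u v /\ df v = w] H.
by rewrite -/(hlift fD u w) => -[[]].
Qed.

Lemma vliftP u (t : vec M) : tangent (proj u) t -> << t, U u >>_u = 0 ->
  [/\ tangent u (vlift fD u t), df (vlift fD u t) = 0 & conn u (vlift fD u t) = t].
Proof.
move=> tt tU; have [v [tv dv cv]] := exists_lift (tangent0 (proj u)) tt tU.
have H : exists v, vertical u v /\ conn u v = t by exists v.
have := @xgetPex _ 0 [set v | vertical u v /\ conn u v = t] H.
by rewrite -/(vlift fD u t) => -[[]].
Qed.

(** Split both vectors into lifts of their components; the mixed terms vanish. Afterwards all
    computations on SM take place in TM. *)
Lemma induced_metricE G u v w : induced_metric fD G -> tangent u v -> tangent u w ->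
  G u v w = << df v, df w >>_u + << conn u v, conn u w >>_u.
Proof.
move=> [GP Ghv Gh Gv] tv tw.
have dec z : tangent u z -> exists zh zv, [/\ horizontal fD u zh, vertical u zv,
    df zh = df z, conn u zv = conn u z & z = zh + zv].
  move=> tz; have [t1 c1 d1] := hliftP (differential_tangent MC prs tz).
  have [t2 d2 c2] := vliftP (connector_tangent tz) (connector_orth tz).
  exists (hlift fD u (df z)), (vlift fD u (conn u z)); split=> //.
  apply: (eq_by_parts tz); first exact: tangentD.
    rewrite -[hlift _ _ _]scale1r differentialZD d1 d2 scale1r addr0//.
  by rewrite -[hlift _ _ _]scale1r connectorZD// c1 c2 scaler0 add0r.
have [vh [vv [hh hv dvh cvv ->]]] := dec v tv.
have [wh [wv [hh' hv' dwh cwv ->]]] := dec w tw.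
have [tvh _] := hh; have [tvv _] := hv; have [twh _] := hh'; have [twv _] := hv'.
rewrite (metricDl GP)//; last exact: tangentD.
rewrite !(metricDr GP)// (Ghv _ _ _ hh hv') (Gh _ _ _ hh hh') (Gv _ _ _ hv hv').
rewrite (metric_symmetric GP tvv twh) (Ghv _ _ _ hh' hv) addr0 add0r.
rewrite -[vh]scale1r -[wh]scale1r !differentialZD !connectorZD// !scale1r.
by rewrite hv.2 hv'.2 hh.2 hh'.2 !addr0 !add0r.
Qed.

End Lifts.

(** * The Koszul formula *)

Section Koszul.
Context {R : realType} {N : smooth_space R} {G : N -> vec N -> vec N -> R}.
Context {nabla : N -> vec N -> (N -> vec N) -> vec N}.
Hypothesis NC : smooth_closed N.
Hypothesis GP : riemannian_metric G.
Hypothesis LC : levi_civita G nabla.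

Lemma koszul (X Y Z : N -> vec N) u :
  vector_field X -> vector_field Y -> vector_field Z ->
  2 * G u (nabla u (X u) Y) (Z u) =
    X u (fun q => G q (Y q) (Z q)) + Y u (fun q => G q (X q) (Z q))
    - Z u (fun q => G q (X q) (Y q))
    + G u (bracket X Y u) (Z u) - G u (bracket X Z u) (Y u)
    - G u (bracket Y Z u) (X u).
Proof.
move=> fX fY fZ; have [[nC nG] nT] := LC.
have t (V W : N -> vec N) : vector_field V -> vector_field W -> tangent u (nabla u (V u) W).
  by move=> fV fW; exact: (field_tangent u (connection_smooth nC fV fW)).
have tt (V : N -> vec N) : vector_field V -> tangent u (V u) by exact: field_tangent.
have B (V W : N -> vec N) : vector_field V -> vector_field W ->
    bracket V W u = nabla u (V u) W - nabla u (W u) V.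
  move=> fV fW; have := nT V W fV fW u; rewrite /torsion => /eqP.
  by rewrite subr_eq0 => /eqP ->.
rewrite (nG X Y Z fX fY fZ) (nG Y X Z fY fX fZ) (nG Z X Y fZ fX fY).
rewrite (B X Y)// (B X Z)// (B Y Z)//.
rewrite (metricBl GP (t _ _ fX fY) (t _ _ fY fX) (tt _ fZ)).
rewrite (metricBl GP (t _ _ fX fZ) (t _ _ fZ fX) (tt _ fY)).
rewrite (metricBl GP (t _ _ fY fZ) (t _ _ fZ fY) (tt _ fX)).
rewrite (metric_symmetric GP (tt _ fY) (t _ _ fX fZ)).
rewrite (metric_symmetric GP (tt _ fX) (t _ _ fY fZ)).
rewrite (metric_symmetric GP (tt _ fX) (t _ _ fZ fY)).
ring.
Qed.

End Koszul.

(** * The terms of the formula as inner products in TM *)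

Section Comparison.
Context {R : realType} {n : nat} {M : manifold R n}.
Context {g : M -> vec M -> vec M -> R}.
Context {D : M -> vec M -> (M -> vec M) -> vec M}.
Local Notation T := (manifold_top M).
Local Notation N := (SM g).
Context {fD : N -> vec N -> (N -> vec M) -> vec M}.
Context {G : N -> vec N -> vec N -> R}.
Hypothesis gP : riemannian_metric g.
Hypothesis DP : metric_connection g D.
Hypothesis fP : pullback_connection D fD.
Hypothesis GI : induced_metric fD G.

Let MC : smooth_closed M := smooth_closed_manifold.
Let MB : has_dual_bases M := manifold_dual_bases.
Let NC : smooth_closed N := smooth_closed_sphere.
Let prs : forall h, smooth h -> smooth (fun u : N => h (proj u)) := smooth_proj.
Let DC : linear_connection D := DP.1.
Let fC : connection_along (@Defs.proj R n M g) fD := fP.1.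
Let fE := fP.2.
Let GP : riemannian_metric G. Proof. by case: GI. Qed.
Local Notation section := (section_along (@Defs.proj R n M g)).
Local Notation U := (@tautological R n M g).
Local Notation df := (differential (@Defs.proj R n M g)).
Local Notation conn := (connector fD).
Local Notation "<< s , t >>_ u" := (g (proj u) s t) (at level 10, u at level 2).
Let sU : section U := section_tautological.
Implicit Types (u : N) (X Y Z : N -> vec N).

Local Notation hor X := (fun x => df (X x)).
Local Notation ver X := (fun x => conn x (X x)).
Local Notation torX u X Y := (torsion_at D (proj u) (df (X u)) (df (Y u))).
Local Notation curX u X Y := (curvature_at D (proj u) (df (X u)) (df (Y u)) (U u)).

Let th X u : vector_field X -> tangent (proj u) (df (X u)).
Proof. by move=> fX; apply: differential_tangent => //; exact: field_tangent. Qed.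
Let tv X u : vector_field X -> tangent (proj u) (conn u (X u)).
Proof. by move=> fX; apply: (connector_tangent DP fP); exact: field_tangent. Qed.
Let tf X s u : vector_field X -> section s -> tangent (proj u) (fD u (X u) s).
Proof. by move=> fX ss; apply: (pullback_tangent DP fP) => //; exact: field_tangent. Qed.
Let sh X : vector_field X -> section (hor X).
Proof. by move=> fX; exact: section_differential. Qed.
Let sv X : vector_field X -> section (ver X).
Proof. by move=> fX; exact: (section_connector fP). Qed.

Lemma hor_bracket X Y u : vector_field X -> vector_field Y ->
  df (bracket X Y u) = fD u (X u) (hor Y) - fD u (Y u) (hor X) - torX u X Y.
Proof.
move=> fX fY; rewrite -(torsion_along NC MC MB prs DC fC fE u fX fY).
by rewrite opprB addrC subrK.
Qed.

Lemma ver_bracket X Y u : vector_field X -> vector_field Y ->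
  conn u (bracket X Y u) = fD u (X u) (ver Y) - fD u (Y u) (ver X) - curX u X Y.
Proof.
move=> fX fY; rewrite -(curvature_alongE NC MC MB prs DC fC fE u fX fY sU).
by rewrite opprB addrC subrK.
Qed.

Lemma torsion_tangent X Y u : vector_field X -> vector_field Y ->
  tangent (proj u) (torX u X Y).
Proof.
move=> fX fY; rewrite -(torsion_along NC MC MB prs DC fC fE u fX fY).
have tb := bracket_tangent NC u fX fY.
apply: tangentB; last exact: differential_tangent.
by apply: tangentB; apply: tf => //; exact: sh.
Qed.

Lemma curvature_tangent X Y u : vector_field X -> vector_field Y ->
  tangent (proj u) (curX u X Y).
Proof.
move=> fX fY; rewrite -(curvature_alongE NC MC MB prs DC fC fE u fX fY sU).
have tb := bracket_tangent NC u fX fY.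
apply: tangentB; last exact: (pullback_tangent DP fP).
by apply: tangentB; apply: tf => //; exact: sv.
Qed.

Lemma ver_orth X u : vector_field X -> << conn u (X u), U u >>_u = 0.
Proof. by move=> fX; apply: (connector_orth gP DP fP); exact: field_tangent. Qed.

(** Differentiate [<conn Y, U> = 0]. The result is exactly what the U-term of [Dstar]
    compensates. *)
Lemma ver_derivative_orth X Y u : vector_field X -> vector_field Y ->
  << fD u (X u) (ver Y), U u >>_u = - << conn u (Y u), conn u (X u) >>_u.
Proof.
move=> fX fY; have := pullback_metric gP DP fP (field_tangent u fX) (sv fY) sU.
have -> : (fun x : N => << conn x (Y x), U x >>_x) = (fun=> 0).
  by apply/funext => x; exact: ver_orth.
rewrite (tangent_cst NC (field_tangent u fX)) => /eqP; rewrite eq_sym addr_eq0 => /eqP ->.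
by [].
Qed.

(** Skewness of the curvature is bypassed: in [ver_bracket] the connector of the bracket is
    orthogonal to U, and the U-components of the two derivatives cancel by symmetry. *)
Lemma curvature_orth X Y u : vector_field X -> vector_field Y ->
  << curX u X Y, U u >>_u = 0.
Proof.
move=> fX fY; have tU := tautological_tangent u.
have tb := bracket_tangent NC u fX fY.
have := connector_orth gP DP fP tb; rewrite ver_bracket//.
have tc := curvature_tangent u fX fY.
have t1 := tf u fX (sv fY); have t2 := tf u fY (sv fX).
rewrite (metricBl gP)//; last exact: tangentB.
rewrite (metricBl gP)// !ver_derivative_orth// (metric_symmetric gP (tv u fX) (tv u fY)).
by rewrite subrr sub0r => /eqP; rewrite oppr_eq0 => /eqP.
Qed.

Lemma metric_derivative X Y Z u : vector_field X -> vector_field Y -> vector_field Z ->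
  X u (fun q => G q (Y q) (Z q)) =
    << fD u (X u) (hor Y), df (Z u) >>_u + << fD u (X u) (hor Z), df (Y u) >>_u
    + << fD u (X u) (ver Y), conn u (Z u) >>_u + << fD u (X u) (ver Z), conn u (Y u) >>_u.
Proof.
move=> fX fY fZ; have tX := field_tangent u fX.
have -> : (fun q => G q (Y q) (Z q)) =
    (fun q => << df (Y q), df (Z q) >>_q + << conn q (Y q), conn q (Z q) >>_q).
  apply/funext => q; rewrite (induced_metricE gP DP fP)//; exact: field_tangent.
rewrite (tangentDf tX).
- rewrite (pullback_metric gP DP fP tX (sh fY) (sh fZ)).
  rewrite (pullback_metric gP DP fP tX (sv fY) (sv fZ)) addrA.
  rewrite (metric_symmetric gP (th u fY) (tf u fX (sh fZ))).
  by rewrite (metric_symmetric gP (tv u fY) (tf u fX (sv fZ))).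
- by apply: (smooth_inner gP); exact: sh.
- by apply: (smooth_inner gP); exact: sv.
Qed.

Let GE u v w : tangent u v -> tangent u w ->
  G u v w = << df v, df w >>_u + << conn u v, conn u w >>_u.
Proof. exact: (induced_metricE gP DP fP). Qed.

Lemma metric_bracket X Y Z u : vector_field X -> vector_field Y -> vector_field Z ->
  G u (bracket X Y u) (Z u) =
    << fD u (X u) (hor Y), df (Z u) >>_u - << fD u (Y u) (hor X), df (Z u) >>_u
    - << torX u X Y, df (Z u) >>_u
    + << fD u (X u) (ver Y), conn u (Z u) >>_u - << fD u (Y u) (ver X), conn u (Z u) >>_u
    - << curX u X Y, conn u (Z u) >>_u.
Proof.
move=> fX fY fZ; have tb := bracket_tangent NC u fX fY.
rewrite (GE tb (field_tangent u fZ)) hor_bracket// ver_bracket//.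
have h1 := tf u fX (sh fY); have h2 := tf u fY (sh fX).
have v1 := tf u fX (sv fY); have v2 := tf u fY (sv fX).
have tT := torsion_tangent u fX fY; have tR := curvature_tangent u fX fY.
have hZ := th u fZ; have vZ := tv u fZ.
rewrite (metricBl gP (tangentB h1 h2) tT hZ) (metricBl gP h1 h2 hZ).
rewrite (metricBl gP (tangentB v1 v2) tR vZ) (metricBl gP v1 v2 vZ).
ring.
Qed.

(** Needed because [is_tau] contains T*(Y, X, Z) while the bracket in the Koszul formula produces
    T*(X, Y, Z). *)
Lemma torsion_antisym X Y Z u : vector_field X -> vector_field Y -> vector_field Z ->
  << torX u Y X, df (Z u) >>_u = - << torX u X Y, df (Z u) >>_u.
Proof.
move=> fX fY fZ; have hZ := th u fZ; have tT := torsion_tangent u fX fY.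
rewrite -(metricNl gP)//; congr (g _ _ _).
rewrite -(torsion_along NC MC MB prs DC fC fE u fX fY).
rewrite -(torsion_along NC MC MB prs DC fC fE u fY fX).
have -> : df (bracket Y X u) = - df (bracket X Y u).
  apply/funext => h; rewrite (@vecNE _ M) /differential /bracket.
  by case: ifP => _; rewrite ?opprB ?oppr0.
by rewrite opprK !opprB [LHS]addrC.
Qed.

Lemma calR_metric X Y Z u : vector_field X -> vector_field Y -> vector_field Z ->
  tangent u (calR D fD u (X u) (Y u)) /\
  G u (calR D fD u (X u) (Y u)) (Z u) = << curX u X Y, conn u (Z u) >>_u.
Proof.
move=> fX fY fZ.
have [t d c] := vliftP gP DP fP (curvature_tangent u fX fY) (curvature_orth u fX fY).
split=> //; rewrite (GE t (field_tangent u fZ)) d c (metric0l gP) ?add0r//.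
exact: th.
Qed.

Lemma Tstar_metric X Y Z u : vector_field X -> vector_field Y -> vector_field Z ->
  G u (Tstar D fD u (X u) (Y u)) (Z u) = << torX u X Y, df (Z u) >>_u.
Proof.
move=> fX fY fZ.
have [t c d] := hliftP gP DP fP (torsion_tangent u fX fY).
rewrite (GE t (field_tangent u fZ)) d c (metric0l gP) ?addr0//.
exact: tv.
Qed.

(** The U-term brings the argument of [vlift] into the orthogonal of U and then disappears when
    paired with [conn u (Z u)]. *)
Lemma Dstar_metric X Y Z u : vector_field X -> vector_field Y -> vector_field Z ->
  tangent u (Dstar fD X Y u) /\
  G u (Dstar fD X Y u) (Z u) =
    << fD u (X u) (hor Y), df (Z u) >>_u + << fD u (X u) (ver Y), conn u (Z u) >>_u.
Proof.
move=> fX fY fZ; have tU := tautological_tangent u.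
have h1 := tf u fX (sh fY); have v1 := tf u fX (sv fY).
have hZ := th u fZ; have vZ := tv u fZ.
pose a := << conn u (Y u), conn u (X u) >>_u.
have ta : tangent (proj u) (fD u (X u) (ver Y) + a *: U u).
  by apply: tangentD => //; exact: tangentZ.
have aU : << fD u (X u) (ver Y) + a *: U u, U u >>_u = 0.
  rewrite (metricDl gP)//; last exact: tangentZ.
  by rewrite (metricZl gP)// tautological_unit mulr1 ver_derivative_orth// addNr.
have [t c d] := hliftP gP DP fP h1.
have [t' d' c'] := vliftP gP DP fP ta aU.
have -> : Dstar fD X Y u = hlift fD u (fD u (X u) (hor Y)) +
    vlift fD u (fD u (X u) (ver Y) + a *: U u) by [].
split; first exact: tangentD.
have tZ := field_tangent u fZ.
rewrite (metricDl GP)// !GE// c d c' d' !(metric0l gP)// addr0 add0r; congr (_ + _).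
rewrite (metricDl gP)//; last exact: tangentZ.
rewrite (metricZl gP)// (metric_symmetric gP tU vZ) ver_orth//.
by rewrite mulr0 addr0.
Qed.

End Comparison.

Theorem theorem1p1 (R : realType) (n : nat) (M : manifold R n)
    (g : M -> vec M -> vec M -> R)
    (D : M -> vec M -> (M -> vec M) -> vec M)
    (fD : SM g -> vec (SM g) -> (SM g -> vec M) -> vec M)
    (G : SM g -> vec (SM g) -> vec (SM g) -> R)
    (nabla : SM g -> vec (SM g) -> (SM g -> vec (SM g)) ->
             vec (SM g))
    (A tau : SM g -> vec (SM g) -> vec (SM g) ->
             vec (SM g)) :
  orientable M ->
  riemannian_metric g ->
  metric_connection g D ->
  pullback_connection D fD ->
  induced_metric fD G ->
  levi_civita G nabla ->
  is_A D fD G A ->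
  is_tau D fD G tau ->
  forall X Y : SM g -> vec (SM g),
    vector_field X -> vector_field Y ->
    forall u : SM g,
      nabla u (X u) Y =
        Dstar fD X Y u - 2^-1 *: calR D fD u (X u) (Y u)
        + A u (X u) (Y u) + tau u (X u) (Y u).
Proof.
move=> _ gP DP fP GI LC AP tauP X Y fX fY u.
have [GP _ _ _] := GI; have [[nC _] _] := LC.
have NC : smooth_closed (SM g) := smooth_closed_sphere.
have MC : smooth_closed M := smooth_closed_manifold.
have tX := field_tangent u fX; have tY := field_tangent u fY.
have tn := field_tangent u (connection_smooth nC fX fY).
(* Only tangency is wanted here; the third field is arbitrary. *)
have [tD _] := Dstar_metric gP DP fP GI u fX fY fX.
have [tR _] := calR_metric gP DP fP GI u fX fY fX.
have [[tA _] AE] := AP u _ _ tX tY.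
have [[tt ct] tauE] := tauP u _ _ tX tY.
have tRH : tangent u (Dstar fD X Y u - 2^-1 *: calR D fD u (X u) (Y u)).
  by apply: tangentB => //; exact: tangentZ.
have tRHS : tangent u (Dstar fD X Y u - 2^-1 *: calR D fD u (X u) (Y u)
    + A u (X u) (Y u) + tau u (X u) (Y u)).
  by apply: tangentD => //; exact: tangentD.
apply/eqP; rewrite -subr_eq0; apply/eqP; apply: (@metric_nondegenerate _ _ _ GP u).
  exact: tangentB.
(* The Koszul formula needs a field, so the test vector is extended. *)
move=> z tz; have [Z [fZ Zu]] := sphere_field_through gP DP fP tz.
rewrite -Zu in tz *.
rewrite (metricBl GP)// (metricDl GP)//; last exact: tangentD.
rewrite (metricDl GP)// (metricBl GP)//; last exact: tangentZ.
rewrite (metricZl GP)// AE//.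
(* [is_tau] prescribes pairings with horizontal parts only; as [tau] is horizontal, the vertical
   part of [Z] contributes nothing. *)
have -> : G u (tau u (X u) (Y u)) (Z u) = G u (tau u (X u) (Y u)) (hproj fD u (Z u)).
  have [t c d] := hliftP gP DP fP (differential_tangent MC (@smooth_proj _ _ _ g) tz).
  by rewrite !(induced_metricE gP DP fP GI)// d ct !(metric0l gP)//; apply: (connector_tangent DP fP).
rewrite tauE//.
have [_ ->] := Dstar_metric gP DP fP GI u fX fY fZ.
have [_ ->] := calR_metric gP DP fP GI u fX fY fZ.
have [_ ->] := calR_metric gP DP fP GI u fX fZ fY.
have [_ ->] := calR_metric gP DP fP GI u fY fZ fX.
rewrite !(Tstar_metric gP DP fP GI)//.
have := koszul GP LC u fX fY fZ.
rewrite !(metric_derivative gP DP fP GI)// !(metric_bracket gP DP fP GI)//.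
rewrite (torsion_antisym gP DP fP u fX fY fZ).
(* With the pairings in TM as unknowns, the Koszul formula and the goal are linear and differ by the
   factor 2. *)
by move=> K; lra.
Qed.
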